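(* Let $-1<\alpha<\infty$ and $c\in\mathbb{R}$. Then there exists a pair $(p,q)\in[1,+\infty]\times[1,+\infty]$ such that $K_c^\alpha: L^p_\alpha\to L^q_\alpha$ is bounded if and only if $c<n+2(1+\alpha)$.
   Context: Let $n\ge 1$ be an integer, $\mathbb{B}_n$ the open unit ball of $\mathbb{C}^n$, $\langle z,w\rangle=\sum_{j=1}^n z_j\overline{w_j}$, and $dv$ the normalized volume measure on $\mathbb{B}_n$, so $v(\mathbb{B}_n)=1$. For $\alpha>-1$ let $dv_\alpha(z)=c_\alpha(1-|z|^2)^\alpha\,dv(z)$ with $c_\alpha=\Gamma(n+\alpha+1)/[n!\,\Gamma(\alpha+1)]$, so that $v_\alpha(\mathbb{B}_n)=1$. For $1\le p<\infty$, $L^p_\alpha=L^p(\mathbb{B}_n,dv_\alpha)$; $L^\infty_\alpha=L^\infty$ is the space of essentially bounded measurable functions on $\mathbb{B}_n$ with the essential supremum norm. For $c\in\mathbb{R}$ and $\alpha>-1$ define $$K_c^\alpha f(z)=\int_{\mathbb{B}_n}\frac{f(w)}{(1-\langle z,w\rangle)^c}\,dv_\alpha(w),$$ where the power is the principal branch ($\operatorname{Re}(1-\langle z,w\rangle)>0$). *)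

(* Defs.v *)
From HB Require Import structures.
From mathcomp Require Import all_boot all_order all_algebra.
From mathcomp Require Import all_classical all_reals all_analysis.
From mathcomp Require Import measurable_realfun ess_sup_inf.
From mathcomp Require Import complex.

Set Implicit Arguments.
Unset Strict Implicit.
Unset Printing Implicit Defensive.

Import Order.TTheory GRing.Theory Num.Theory.
Import numFieldNormedType.Exports.

Local Open Scope classical_set_scope.
Local Open Scope ring_scope.

Section complex_measurable.
Variable R : realType.

Definition mkC (p : measurableTypeR R * measurableTypeR R) : R[i] :=
  Complex p.1 p.2.
Definition unC (z : R[i]) : measurableTypeR R * measurableTypeR R :=
  (complex.Re z, complex.Im z).

Lemma mkCK : cancel mkC unC.
Proof. by case. Qed.

HB.instance Definition _ := isPointed.Build R[i] 0.

(* The Borel sigma-algebra of C, transported from R * R. *)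
Definition measurable_complex : set (set R[i]) :=
  [set A | measurable (mkC @^-1` A)].

Let measurable_complex0 : measurable_complex set0.
Proof. by rewrite /measurable_complex/= preimage_set0. Qed.

Let measurable_complexC A : measurable_complex A -> measurable_complex (~` A).
Proof. by rewrite /measurable_complex/= preimage_setC; exact: measurableC. Qed.

Let measurable_complex_bigcup (F : (set R[i])^nat) :
  (forall i, measurable_complex (F i)) -> measurable_complex (\bigcup_i F i).
Proof.
by rewrite /measurable_complex/= preimage_bigcup; exact: bigcupT_measurable.
Qed.

HB.instance Definition _ := @isMeasurable.Build default_measure_display R[i]
  measurable_complex measurable_complex0 measurable_complexC
  measurable_complex_bigcup.

Lemma measurable_mkC : measurable_fun setT mkC.
Proof. by move=> _ A mA; rewrite setTI. Qed.

Lemma measurable_unC : measurable_fun setT unC.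
Proof.
move=> _ A mA; rewrite setTI /measurable/= /measurable_complex/=.
by rewrite (_ : _ @^-1` _ = A)//; apply/seteqP; split=> -[].
Qed.

Lemma measurable_Re : measurable_fun setT (@complex.Re R).
Proof. exact: (measurableT_comp measurable_fst measurable_unC). Qed.

Lemma measurable_Im : measurable_fun setT (@complex.Im R).
Proof. exact: (measurableT_comp measurable_snd measurable_unC). Qed.

End complex_measurable.

Section tuple_cons.
Context d (T : measurableType d) (n : nat).

Definition tcons (p : T * n.-tuple T) : n.+1.-tuple T := [tuple of p.1 :: p.2].
Definition tuncons (t : n.+1.-tuple T) : T * n.-tuple T :=
  (thead t, [tuple of behead t]).

Lemma tconsK : cancel tcons tuncons.
Proof. by move=> [x t]; congr pair; apply/val_inj. Qed.

Lemma measurable_tcons : measurable_fun setT tcons.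
Proof. exact: measurable_cons. Qed.

Lemma measurable_tuncons : measurable_fun setT tuncons.
Proof.
apply/measurable_fun_pairP; split; first exact: measurable_tnth.
exact: measurable_behead.
Qed.

End tuple_cons.

Section product_image.
Local Open Scope ereal_scope.
Context d1 d2 d (T1 : measurableType d1) (T2 : measurableType d2)
  (T : measurableType d) (R : realType).
Variables (m1 : {sigma_finite_measure set T1 -> \bar R})
  (m2 : {sigma_finite_measure set T2 -> \bar R}).
Variables (f : T1 * T2 -> T) (g : T -> T1 * T2).

(* The image of m1 \x m2 under f; the left inverse g keeps it sigma-finite. *)
Definition product_image of measurable_fun setT f & measurable_fun setT g &
  cancel f g : set T -> \bar R := pushforward (m1 \x m2) f.

Hypotheses (mf : measurable_fun setT f) (mg : measurable_fun setT g).
Hypothesis fK : cancel f g.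

Local Notation mu := (product_image mf mg fK).

Let mu0 : mu set0 = 0.
Proof. by rewrite /product_image /pushforward preimage_set0 measure0. Qed.

Let mu_ge0 A : 0 <= mu A.
Proof. exact: measure_ge0. Qed.

Let mu_sigma_additive : semi_sigma_additive mu.
Proof.
move=> F mF tF mUF; rewrite /product_image /pushforward preimage_bigcup.
apply: measure_semi_sigma_additive.
- by move=> n; rewrite -[X in measurable X]setTI; exact: mf.
- apply/trivIsetP => /= i j _ _ ij; rewrite -preimage_setI.
  by move/trivIsetP : tF => /(_ _ _ _ _ ij) ->//; rewrite preimage_set0.
- by rewrite -preimage_bigcup -[X in measurable X]setTI; exact: mf.
Qed.

HB.instance Definition _ := isMeasure.Build _ _ _ mu
  mu0 mu_ge0 mu_sigma_additive.

Let mu_sigma_finite : sigma_finite setT mu.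
Proof.
have /sigma_finiteP[F [TF ndF Foo]] := sigma_finiteT m1.
have /sigma_finiteP[G [TG ndG Goo]] := sigma_finiteT m2.
exists (fun i => g @^-1` (F i `*` G i)).
  rewrite -preimage_bigcup; apply/seteqP; split=> // y _ /=.
  have [k _ Fk] : (\bigcup_i F i) (g y).1 by rewrite -TF.
  have [l _ Gl] : (\bigcup_i G i) (g y).2 by rewrite -TG.
  exists (maxn k l) => //; split.
    by move: Fk; exact/subsetPset/ndF/leq_maxl.
  by move: Gl; exact/subsetPset/ndG/leq_maxr.
move=> i; have [mF Fi] := Foo i; have [mG Gi] := Goo i; split.
  by rewrite -[X in measurable X]setTI; apply: mg => //; exact: measurableX.
rewrite /product_image /pushforward (_ : _ @^-1` _ = F i `*` G i); last first.
  by apply/seteqP; split=> x /=; rewrite fK.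
by rewrite product_measure1E// lte_mul_pinfty// ge0_fin_numE.
Qed.

HB.instance Definition _ := Measure_isSigmaFinite.Build _ _ _ mu
  mu_sigma_finite.

End product_image.

Section lebesgue_Cn.
Variable R : realType.

Definition lebesgueC : {sigma_finite_measure set R[i] -> \bar R} :=
  product_image (@lebesgue_measure R) (@lebesgue_measure R)
    (@measurable_mkC R) (@measurable_unC R) (@mkCK R).

(* C^0 is a point, and C^(k+1) is C * C^k. *)
Fixpoint lebesgueCn (n : nat) :
    {sigma_finite_measure set (n.-tuple R[i]) -> \bar R} :=
  match n with
  | 0 => \d_[tuple]
  | k.+1 => product_image lebesgueC (lebesgueCn k)
      (@measurable_tcons _ R[i] k) (@measurable_tuncons _ R[i] k)
      (@tconsK _ R[i] k)
  end.

End lebesgue_Cn.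

Section unit_ball.
Variables (R : realType) (n : nat).
Implicit Types z w : n.-tuple R[i].

Definition inner z w : R[i] :=
  \sum_(j < n) tnth z j * (tnth w j)^*%C.

Definition cnorm z : R :=
  Num.sqrt (\sum_(j < n) Normc.normc (tnth z j) ^+ 2).

Definition unit_ball : set (n.-tuple R[i]) := [set z | cnorm z < 1].

Lemma measurable_normc : measurable_fun setT (@Normc.normc R).
Proof.
have -> : @Normc.normc R = fun x : R[i] =>
    Num.sqrt (complex.Re x ^+ 2 + complex.Im x ^+ 2).
  by apply/funext => -[].
apply: measurableT_comp.
  exact: (continuous_measurable_fun (@sqrt_continuous R)).
apply: measurable_funD; apply: measurable_funX.
  exact: measurable_Re.
exact: measurable_Im.
Qed.

Lemma measurable_cnorm : measurable_fun setT cnorm.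
Proof.
apply: measurableT_comp.
  exact: (continuous_measurable_fun (@sqrt_continuous R)).
apply: measurable_sum => j; apply: measurable_funX.
apply: measurableT_comp; first exact: measurable_normc.
exact: measurable_tnth.
Qed.

Lemma measurable_unit_ball : measurable unit_ball.
Proof.
rewrite -[X in measurable X]setTI.
rewrite (_ : unit_ball = cnorm @^-1` `]-oo, 1[).
  exact: measurable_cnorm.
by apply/seteqP; split => z; rewrite /unit_ball/= in_itv.
Qed.

End unit_ball.

Definition Gamma (R : realType) (x : R) : R :=
  \int[lebesgue_measure]_(t in `]0, +oo[%classic) (t `^ (x - 1) * expR (- t)).

Section weighted_measure.
Variables (R : realType) (n : nat).

Let inv_vol_ge0 : 0 <= (fine (lebesgueCn R n (@unit_ball R n)))^-1.
Proof. by rewrite invr_ge0 fine_ge0. Qed.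

(* dv, as the measure A |-> vol (A `&` B_n) / vol B_n on the whole of C^n. *)
Definition ball_measure : {measure set (n.-tuple R[i]) -> \bar R} :=
  mscale (NngNum inv_vol_ge0)
    (mrestr (lebesgueCn R n) (@measurable_unit_ball R n)).

Variable alpha : R.

Definition weight_const : R :=
  Gamma (n%:R + alpha + 1) / (n`!%:R * Gamma (alpha + 1)).

Definition weight (z : n.-tuple R[i]) : R :=
  weight_const * (1 - cnorm z ^+ 2) `^ alpha.

(* dv_alpha; like dv, it is carried by the unit ball. *)
Definition weighted_measure (A : set (n.-tuple R[i])) : \bar R :=
  (\int[ball_measure]_(z in A) (weight z)%:E)%E.

Lemma Gamma_ge0 (x : R) : 0 <= Gamma x.
Proof.
apply: Rintegral_ge0 => t _.
by rewrite mulr_ge0 ?powR_ge0 ?expR_ge0.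
Qed.

Lemma weight_ge0 z : 0 <= weight z.
Proof.
by rewrite mulr_ge0 ?powR_ge0// divr_ge0 ?Gamma_ge0// mulr_ge0 ?Gamma_ge0.
Qed.

Lemma measurable_weight : measurable_fun setT weight.
Proof.
apply: measurable_funM => //.
apply: (measurableT_comp (measurable_powR alpha)).
by apply: measurable_funB => //; apply: measurable_funX; exact: measurable_cnorm.
Qed.

Let weighted0 : weighted_measure set0 = 0%E.
Proof. by rewrite /weighted_measure integral_set0. Qed.

Let weighted_ge0 A : (0 <= weighted_measure A)%E.
Proof. by apply: integral_ge0 => z _; rewrite lee_fin weight_ge0. Qed.

Let weighted_sigma_additive : semi_sigma_additive weighted_measure.
Proof.
move=> /= F mF tF mUF; rewrite /weighted_measure; apply: cvg_toP.
  apply: ereal_nondecreasing_is_cvgn => m k mk.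
  apply: lee_sum_nneg_natr => // j _ _; apply: integral_ge0 => /= x _.
  by rewrite lee_fin weight_ge0.
rewrite ge0_integral_bigcup//=.
- apply/measurable_funTS/measurableT_comp => //.
  exact: measurable_weight.
- by move=> x _; rewrite lee_fin weight_ge0.
Qed.

HB.instance Definition _ := isMeasure.Build _ _ _ weighted_measure
  weighted0 weighted_ge0 weighted_sigma_additive.

End weighted_measure.

Section operators.
Variables (R : realType) (n : nat) (alpha : R).
Implicit Types (f : n.-tuple R[i] -> R[i]) (p q : \bar R).

Local Notation B := (@unit_ball R n).
Local Notation v_alpha := (@weighted_measure R n alpha).

(* Functions on B_n are represented by functions on C^n; the norm and the
   measurability condition only involve their values on B_n. *)
Definition Lpnorm p f : \bar R :=
  'N[v_alpha]_p[EFin \o ((@Normc.normc R \o f) \_ B)]%E.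

Definition in_Lp p f : Prop :=
  measurable_fun B f /\ (Lpnorm p f < +oo)%E.

Definition bounded_Lp_Lq p q
    (K : (n.-tuple R[i] -> R[i]) -> n.-tuple R[i] -> R[i]) : Prop :=
  exists M : R, forall f, in_Lp p f ->
    in_Lp q (K f) /\ (Lpnorm q (K f) <= M%:E * Lpnorm p f)%E.

(* The principal branch of u^c on the half-plane Re u > 0, where the principal
   argument of u is atan (Im u / Re u); not meaningful elsewhere. *)
Definition cpow (u : R[i]) (c : R) : R[i] :=
  let theta := atan (complex.Im u / complex.Re u) in
  let r := Normc.normc u `^ c in
  Complex (r * cos (c * theta)) (r * sin (c * theta)).

(* On B_n the kernel is bounded in w for each z, and v_alpha is finite, so the
   integral converges absolutely for every f in L^p, 1 <= p <= oo. *)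
Definition Kop (c : R) f (z : n.-tuple R[i]) : R[i] :=
  let h w := f w / cpow (1 - inner z w) c in
  Complex (\int[v_alpha]_(w in B) complex.Re (h w))
          (\int[v_alpha]_(w in B) complex.Im (h w)).

End operators.

(* Main.v *)
(* Write a = 1 - |z|^2, b = 1 - |w|^2, u = 1 - <z, w>, so that
   Re u = (a + b + |z - w|^2) / 2, and let S = n + 2 (1 + alpha).

   If c < S, then K_c maps L^oo to L^1, because |u|^(-c) is integrable for
   v_alpha x v_alpha.  One may take c = theta S with 0 < theta < 1; where |u| is
   small some coordinate has Re (z_i conj w_i) bounded below, and there |u|^(-c)
   is dominated by a product of powers of a, of |Im u| and of
   b + sum_(j <> i) |z_j - w_j|^2.  This is integrated first in z_i, then in the
   other z_j, and finally in w.

   If c >= S and K_c is bounded from some L^p to some L^q, then the integral of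
   |Re K_c g| is bounded uniformly over real g with |g| <= 1, and so is the form
   B(g, g) = int g Re K_c g.  The shell r^2 < 1 - |z|^2 <= 2 r^2 contains about
   r^(-2n) disjoint cells of volume about r^(2n+2) on which Re u is comparable to
   r^2 and Im u / Re u is as small as desired, so that Re u^(-c) >= const r^(-2c).
   Choosing signs of the cells one after the other, one finds g equal to +-1 on
   the cells with B(g, g) at least the sum of the diagonal terms; since c >= S,
   each of infinitely many disjoint shells contributes a fixed positive amount. *)

Require Import Defs.
From mathcomp Require Import all_boot all_order all_algebra.
From mathcomp Require Import all_classical all_reals all_analysis.
From mathcomp Require Import measurable_realfun ess_sup_inf complex ring lra.

Set Implicit Arguments.
Unset Strict Implicit.
Unset Printing Implicit Defensive.

Import Order.TTheory GRing.Theory Num.Theory.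
Import numFieldNormedType.Exports.

Local Open Scope classical_set_scope.
Local Open Scope ring_scope.

(** * Integration lemmas *)

(** Since [v_alpha] is finite, the pair (oo, 1) asks least of the operator: L^oo lies in every L^p
    and every L^q lies in L^1. So one absolute integral settles sufficiency, and necessity may test
    bounded functions.

    The obstacle to necessity is oscillation. For c > 1 the argument of u^(-c) can pass pi/2, so Re
    u^(-c) changes sign and nothing is known about the interaction of distinct cells. Only diagonal
    blocks are controlled; the signs make the unknown cross terms harmless. To keep arg u of size e,
    a cell must be thin, of order e r^2, in one real direction, but it may have width e r in the
    complex tangential ones.

    The same count gives the threshold in both directions. A shell has about r^(-2n) cells, each
    contributing r^(-2c) (r^(2 alpha) r^(2n+2))^2, altogether r^(2 (S - c)). Conversely, theta S
    splits into theta (1 + alpha) for the weight in z, theta for Im u, (n - 1) theta for the other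
    coordinates and theta (1 + alpha) for the weight in w; each share is integrable because theta <
    1. *)

Section integral_tools.
Local Open Scope ereal_scope.
Context d (T : measurableType d) (R : realType).
Variable mu : {measure set T -> \bar R}.

Import HBNNSimple.

(** A nonnegative integral is a supremum over the simple functions below the integrand, so
    comparison holds for arbitrary functions. This applies directly to the inner integrals of
    iterated integrals. *)
Lemma ge0_le_integralT (f g : T -> \bar R) : (forall x, 0 <= f x) ->
  (forall x, f x <= g x) -> \int[mu]_x f x <= \int[mu]_x g x.
Proof.
move=> f0 fg; have g0 x : 0 <= g x by exact: le_trans (fg x).
rewrite !ge0_integralTE//; apply: le_ereal_sup => _ [h hf <-].
by exists h => // x; exact: le_trans (fg x).
Qed.

Lemma ge0_integralZl_le (k : R) (f : T -> \bar R) : (0 <= k)%R ->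
  (forall x, 0 <= f x) -> \int[mu]_x (k%:E * f x) <= k%:E * \int[mu]_x f x.
Proof.
rewrite le_eqVlt => /predU1P[<- _|k0 f0].
  by under eq_integral do rewrite mul0e; rewrite integral0 mul0e.
have kf0 x : 0 <= k%:E * f x by rewrite mule_ge0// lee_fin ltW.
rewrite !ge0_integralTE//; apply: ge_ereal_sup => _ [h hf <-].
have k1 : (0 <= k^-1)%R by rewrite invr_ge0 ltW.
pose h' := scale_nnsfun h k1.
have -> : sintegral mu h = k%:E * sintegral mu h'.
  rewrite sintegralrM muleA -EFinM divff ?gt_eqF// mul1e.
  by [].
rewrite lee_pmul2l ?lte_fin//; apply: ereal_sup_ubound; exists h' => // x.
by rewrite /= EFinM lee_pdivrMl.
Qed.

Lemma ge0_integral_leZ (k : R) (f g : T -> \bar R) (c : \bar R) :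
  (0 < k)%R -> (forall x, 0 <= g x) -> (forall x, 0 <= f x) ->
  (forall x, f x <= k%:E * g x) -> \int[mu]_x g x <= c ->
  \int[mu]_x f x <= k%:E * c.
Proof.
move=> k0 g0 f0 fg gc; apply: le_trans (ge0_le_integralT f0 fg) _.
apply: le_trans (ge0_integralZl_le (ltW k0) g0) _.
by rewrite lee_pmul2l ?lte_fin.
Qed.

End integral_tools.

Section density.
Local Open Scope ereal_scope.
Context d (T : measurableType d) (R : realType).
Variables (mu nu : {measure set T -> \bar R}) (phi : T -> R).
Hypotheses (mphi : measurable_fun setT phi) (phi0 : forall x, (0 <= phi x)%R).
Hypothesis nuE : forall A, measurable A -> nu A = \int[mu]_(x in A) (phi x)%:E.

Import HBNNSimple.

Let ephi0 x : 0 <= (phi x)%:E. Proof. by rewrite lee_fin. Qed.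

Let mephi : measurable_fun setT (EFin \o phi). Proof. exact/measurable_EFinP. Qed.

Let integral_density_nnsfun (h : {nnsfun T >-> R}) :
  \int[nu]_x (h x)%:E = \int[mu]_x ((h x)%:E * (phi x)%:E).
Proof.
have mI r : measurable_fun setT (fun x => (r * \1_(h @^-1` [set r]) x)%:E).
  by apply/measurable_EFinP; exact: measurable_funM.
have hE x : (h x)%:E = \sum_(y \in range h) (y * \1_(h @^-1` [set y]) x)%:E.
  by rewrite fimfunE -fsumEFin.
under eq_integral do rewrite hE.
rewrite ge0_integral_fsum//; last by move=> r x _; exact: nnfun_muleindic_ge0.
transitivity (\int[mu]_x
    \sum_(y \in range h) ((y * \1_(h @^-1` [set y]) x)%:E * (phi x)%:E)); last first.
  apply: eq_integral => x _; rewrite hE ge0_mule_fsuml// => y.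
  exact: nnfun_muleindic_ge0.
rewrite ge0_integral_fsum//; last 2 first.
- by move=> r; exact: emeasurable_funM.
- by move=> r x _; rewrite mule_ge0// nnfun_muleindic_ge0.
apply: eq_fsbigr => r _.
have mr : measurable (h @^-1` [set r]) by exact: measurable_funPTI.
have [r0|r0] := ltP r 0%R.
  by rewrite preimage_nnfun0//; under eq_integral do rewrite indic0 mulr0;
    under [RHS]eq_integral do rewrite indic0 mulr0 mul0e; rewrite !integral0.
under [RHS]eq_integral do rewrite EFinM -muleA.
under eq_integral do rewrite EFinM.
have m1 : measurable_fun setT (fun x => (\1_(h @^-1` [set r]) x : R)%:E).
  by apply/measurable_EFinP/measurable_indic.
rewrite !ge0_integralZl//; last 2 first.
- exact: emeasurable_funM.
- by move=> x _; rewrite mule_ge0.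
rewrite integral_indic// setIT nuE//; congr (_ * _).
rewrite integral_mkcond; apply: eq_integral => x _.
by rewrite epatch_indic muleC.
Qed.

(** On indicators this is [nuE]; linearity gives simple functions, and monotone convergence along
    [nnsfun_approx] gives the rest. *)
Lemma integral_density (f : T -> \bar R) :
  measurable_fun setT f -> (forall x, 0 <= f x) ->
  \int[nu]_x f x = \int[mu]_x (f x * (phi x)%:E).
Proof.
move=> mf f0; pose h := nnsfun_approx measurableT mf.
have cvgh x : EFin \o h^~ x @ \oo --> f x by exact: cvg_nnsfun_approx.
have ndh x : {homo h^~ x : m n / (m <= n)%N >-> (m <= n)%R}.
  by move=> m n mn; exact/lefP/nd_nnsfun_approx.
transitivity (limn (fun n => \int[nu]_x (h n x)%:E)).
  rewrite -monotone_convergence//=.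
  - by apply: eq_integral => x _; apply/esym/cvg_lim => //; exact: cvgh.
  - by move=> n; exact/measurable_EFinP.
  - by move=> n x _; rewrite lee_fin.
  - by move=> x _ m n mn; rewrite lee_fin ndh.
under eq_fun do rewrite integral_density_nnsfun.
rewrite -monotone_convergence//=.
- apply: eq_integral => x _; apply/cvg_lim => //.
  by apply: cvgeZr => //; exact: cvgh.
- by move=> n; apply: emeasurable_funM => //; exact/measurable_EFinP.
- by move=> n x _; rewrite mule_ge0// lee_fin.
- by move=> x _ m n mn; rewrite lee_wpmul2r// lee_fin ndh.
Qed.

End density.

(** * Singular integrals on the line and in the disc *)

Section real_line.
Context (R : realType).
Local Notation leb := (@lebesgue_measure R).

Let affine (p c : R) : measurableTypeR R -> measurableTypeR R := fun x => p * x + c.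

Let measurable_affine p c : measurable_fun setT (affine p c).
Proof.
apply: measurable_funD; last exact: measurable_cst.
by apply: measurable_funM => //; exact: measurable_cst.
Qed.

Let image (p c : R) : {measure set (measurableTypeR R) -> \bar R}.
Proof.
by refine (pushforward leb (affine p c)); exact: measurable_affine.
Defined.

(** By uniqueness of Lebesgue measure it suffices to look at half-open intervals; for [p < 0] the
    preimage is half-open on the other side. *)
Let image_affine (p c : R) (A : set (measurableTypeR R)) : p != 0 ->
  measurable A -> leb A = (`|p|%:E * image p c A)%E.
Proof.
move=> p0 mA.
have np0 : 0 <= `|p| by [].
suff : leb A = mscale (NngNum np0) (image p c) A by [].
apply: lebesgue_measure_unique => // _ [[a b]] _ <-.
transitivity (`|p|%:E * leb (affine p c @^-1` `]a, b]%classic))%E; last by [].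
have [pp|pn|p00] := ltgtP p 0; last by rewrite p00 eqxx in p0.
- have -> : affine p c @^-1` `]a, b] = `[(b - c) / p, (a - c) / p[%classic.
    apply/seteqP; split=> x; rewrite /affine/= !in_itv/= => /andP[h1 h2].
      by rewrite ler_ndivrMr// ltr_ndivlMr// mulrC lerBrDr h2/= ltrBlDr h1.
    move: h1 h2; rewrite ler_ndivrMr// ltr_ndivlMr// => h1 h2.
    by rewrite -ltrBlDr -lerBrDr mulrC h1 h2.
  rewrite !lebesgue_measure_itv/= !lte_fin ltr_nM2r ?invr_lt0// ltrD2r.
  case: ifPn => [ab|]; last by rewrite mule0.
  rewrite -!EFinB -EFinM; congr EFin.
  by rewrite ltr0_norm//; field; exact: p0.
- have -> : affine p c @^-1` `]a, b] = `](a - c) / p, (b - c) / p]%classic.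
    apply/seteqP; split=> x; rewrite /affine/= !in_itv/= => /andP[h1 h2].
      by rewrite ler_pdivlMr// ltr_pdivrMr// mulrC lerBrDr h2 andbT ltrBlDr h1.
    move: h1 h2; rewrite ler_pdivlMr// ltr_pdivrMr// => h1 h2.
    by rewrite -ltrBlDr -lerBrDr mulrC h1 h2.
  rewrite !lebesgue_measure_itv/= !lte_fin ltr_pM2r ?invr_gt0// ltrD2r.
  case: ifPn => [ab|]; last by rewrite mule0.
  rewrite -!EFinB -EFinM; congr EFin.
  by rewrite gtr0_norm//; field; exact: p0.
Qed.

Local Open Scope ereal_scope.

Lemma ge0_integral_affine (p c : R) (g : R -> \bar R) : p != 0%R ->
  measurable_fun [set: measurableTypeR R] g -> (forall x, 0 <= g x) ->
  \int[leb]_x g x = `|p|%:E * \int[leb]_x g (p * x + c)%R.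
Proof.
move=> p0 mg g0.
have np0 : (0 <= `|p|)%R by [].
transitivity (\int[mscale (NngNum np0) (image p c)]_x g x).
  by apply: eq_measure_integral => A mA _; exact: image_affine.
rewrite ge0_integral_mscale//=; congr (_ * _).
by rewrite ge0_integral_pushforward//=; exact: measurable_affine.
Qed.

Let cont_powR (a x : R) : (0 < x)%R -> {for x, continuous (@powR R ^~ a)}.
Proof.
move=> x0; apply: differentiable_continuous; apply/derivable1_diffP.
by apply: derivable_powR; rewrite in_itv/= andbT.
Qed.

Let integral_powR_itv (s a : R) : (0 <= s < 1)%R -> (0 < a < 1)%R ->
  \int[leb]_(x in `[a, 1%R]) (x `^ (- s))%:E <= ((1 - s)^-1)%:E.
Proof.
move=> /andP[s0 s1] /andP[a0 a1].
have s1' : (1 - s != 0)%R by rewrite subr_eq0 gt_eqF.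
pose F x : R := ((1 - s)^-1 * x `^ (1 - s))%R.
have cF x : (0 < x)%R -> {for x, continuous F}.
  by move=> x0; apply: cvgM; [exact: cvg_cst|exact: cont_powR].
rewrite (@continuous_FTC2 _ _ F)//.
- rewrite -EFinB lee_fin /F powR1 mulr1 gerBl mulr_ge0 ?powR_ge0//.
  by rewrite invr_ge0 subr_ge0 ltW.
- apply: continuous_in_subspaceT => x /[!inE]/=; rewrite in_itv/= => /andP[ax _].
  by apply: cont_powR; exact: lt_le_trans ax.
- split.
  + move=> x; rewrite in_itv/= => /andP[ax _]; apply: derivableM => //.
    by apply: derivable_powR; rewrite in_itv/= andbT (lt_trans a0).
  + by apply: cvg_at_right_filter; exact: cF.
  + by apply: cvg_at_left_filter; exact: cF.
- move=> x; rewrite in_itv/= => /andP[ax _].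
  have x0 := lt_trans a0 ax.
  rewrite derive1E /F deriveMl//; last first.
    by apply: derivable_powR; rewrite in_itv/= andbT.
  rewrite -derive1E powR_derive1 ?in_itv/= ?andbT// mulrA mulVf// mul1r.
  by congr (_ `^ _)%R; ring.
Qed.

(** The offset 2 keeps the left end strictly below 1, as [integral_powR_itv] requires. *)
Let itv_inv (i : nat) : set (measurableTypeR R) :=
  [set x | (i.+2%:R^-1 <= x <= 1)%R].

Let itv_invE i : itv_inv i = `[(i.+2%:R^-1)%R, 1%R]%classic.
Proof. by apply/seteqP; split=> x; rewrite /itv_inv/= in_itv. Qed.

Lemma integral_powR01 (s : R) : (0 <= s < 1)%R ->
  \int[leb]_(x in `]0%R, 1%R]) (x `^ (- s))%:E <= ((1 - s)^-1)%:E.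
Proof.
move=> s01.
have nd : {homo itv_inv : p q / (p <= q)%N >-> (p <= q)%O}.
  move=> p q pq; apply/subsetPset => x /= /andP[px x1]; apply/andP; split=> //.
  by rewrite (le_trans _ px)// lef_pV2 ?posrE// ler_nat.
have mI i : measurable (itv_inv i) by rewrite itv_invE.
have mf i : measurable_fun (itv_inv i) (fun x : R => (x `^ (- s))%:E).
  by apply/measurable_EFinP; apply: measurable_funTS; exact: measurable_powR.
have f0 i x : itv_inv i x -> 0 <= (x `^ (- s))%:E by rewrite lee_fin powR_ge0.
have -> : `]0%R, 1%R]%classic = \bigcup_i itv_inv i.
  apply/seteqP; split=> x /=; rewrite in_itv/=.
    move=> /andP[x0 x1]; exists (Num.truncn x^-1) => //=.
    apply/andP; split=> //; rewrite -[leRHS]invrK lef_pV2 ?posrE ?invr_gt0//.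
    by rewrite (le_trans (ltW (truncnS_gt _)))// ler_nat.
  by move=> [i _]/= /andP[ix ->]; rewrite (lt_le_trans _ ix).
have /cvg_lim <- // := ge0_nondecreasing_set_cvg_integral (mu := leb) nd mI mf f0.
apply: lime_le.
  apply: ereal_nondecreasing_is_cvgn => m n mn.
  exact: ge0_nondecreasing_set_nondecreasing_integral.
near=> n; rewrite itv_invE; apply: integral_powR_itv => //.
by rewrite invr_gt0 ltr0n/= invf_lt1// ltr1n.
Unshelve. all: by end_near. Qed.

(* The value +oo at 0 makes the pointwise bounds below hold everywhere:
   [0 `^ (- s)] is 0, not +oo. *)
Definition sing (s t : R) : \bar R := if t == 0%R then +oo else (`|t| `^ (- s))%:E.

Lemma sing_gt0 s t : 0 < sing s t.
Proof.
by rewrite /sing; case: ifPn => // t0; rewrite lte_fin powR_gt0// normr_gt0.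
Qed.

Lemma sing_ge0 s t : 0 <= sing s t.
Proof. exact/ltW/sing_gt0. Qed.

Lemma measurable_sing s : measurable_fun [set: measurableTypeR R] (sing s).
Proof.
apply: measurable_fun_ifT.
- by apply: measurable_fun_eqr; [exact: measurable_id|exact: measurable_cst].
- exact: measurable_cst.
- apply/measurable_EFinP.
  apply: (measurableT_comp (measurable_powR _)); exact: normr_measurable.
Qed.

(** Uniformity in the centre [r] comes from |x - r|^(-s) <= 1 + g (x - r) + g (r - x), where [g] is
    x^(-s) cut to ]0, 1]: the constant 1 covers |x - r| > 1 and contributes the length 2, and the
    two translates contribute 1 / (1 - s) each. *)
Lemma integral_sing (s : R) : (0 <= s < 1)%R -> exists C : R, (0 < C)%R /\
  forall r : R, \int[leb]_(x in `[(-1)%R, 1%R]) sing s (x - r)%R <= C%:E.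
Proof.
move=> s01; have /andP[s0 s1] := s01.
have s1' : (0 < (1 - s)^-1)%R by rewrite invr_gt0 subr_gt0.
exists (2 + ((1 - s)^-1 + (1 - s)^-1))%R; split.
  by rewrite !addr_gt0.
move=> r.
pose g (x : R) : \bar R := ((fun x => (x `^ (- s))%:E) \_ `]0%R, 1%R]) x.
have g0 x : 0 <= g x.
  by rewrite /g patchE; case: ifPn => // _; rewrite lee_fin powR_ge0.
have mg : measurable_fun [set: measurableTypeR R] g.
  apply/(measurable_restrictT _ _).1 => //.
  by apply/measurable_EFinP; apply: measurable_funTS; exact: measurable_powR.
have ig : \int[leb]_x g x <= ((1 - s)^-1)%:E.
  by rewrite -integral_mkcond; exact: integral_powR01.
pose h x := g (1 * x + (- r))%R + g ((- 1) * x + r)%R.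
have ig1 (p c : R) : `|p|%R = 1%R -> \int[leb]_x g (p * x + c)%R = \int[leb]_x g x.
  move=> p1; rewrite (@ge0_integral_affine p c g)// ?p1 ?mul1e//.
  by rewrite -normr_eq0 p1 oner_eq0.
have mgc (p c : R) : measurable_fun [set: measurableTypeR R] (fun x => g (p * x + c)%R).
  by apply: (measurableT_comp mg); exact: measurable_affine.
apply: (@le_trans _ _ (\int[leb]_(x in `[(-1)%R, 1%R]) (1 + h x))).
  apply: ae_ge0_le_integral => //=.
  - by move=> x _; exact: sing_ge0.
  - apply: measurable_funTS; apply: (measurableT_comp (measurable_sing s)).
    by apply: measurable_funB; [exact: measurable_id|exact: measurable_cst].
  - by move=> x _; rewrite !adde_ge0.
  - apply: measurable_funTS; apply: emeasurable_funD; first exact: measurable_cst.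
    exact: emeasurable_funD.
  (* The comparison is only almost everywhere: at x = r the left side is +oo while the right side is
     finite. *)
  - exists [set r]; split; [exact: measurable_set1|exact: lebesgue_measure_set1|].
    move=> x /=; apply: contra_notP => /eqP xr _.
    rewrite /sing subr_eq0 (negbTE xr) /h mul1r mulN1r /g !patchE.
    have [d1|d1] := leP `|x - r|%R 1%R; last first.
      apply: (@le_trans _ _ 1%:E); last first.
        by rewrite leeDl// adde_ge0//; case: ifPn; rewrite // lee_fin powR_ge0.
      have d0 := lt_trans ltr01 d1.
      rewrite lee_fin powRN invf_le1 ?powR_gt0//.
      by rewrite -(powRr0 `|x - r|%R) ler_powR// ltW.
    have [xr0|xr0] := ltP 0%R (x - r)%R.
      rewrite gtr0_norm// in d1 *.
      rewrite mem_set/=; last by rewrite in_itv/= xr0.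
      rewrite addeCA leeDl// adde_ge0//.
      by case: ifPn; rewrite // lee_fin powR_ge0.
    have xr1 : (x - r < 0)%R by rewrite lt_neqAle xr0 subr_eq0 xr.
    rewrite ltr0_norm// opprB in d1 *.
    rewrite [X in _ <= _ + (_ + X)]ifT; last first.
      by rewrite mem_set//= in_itv/= addrC subr_gt0 -subr_lt0 xr1.
    rewrite addrC [X in _ <= X]addeA leeDr// adde_ge0//.
    by case: ifPn; rewrite // lee_fin powR_ge0.
rewrite ge0_integralD//=; last 2 first.
- by move=> x _; rewrite adde_ge0.
- by apply: measurable_funTS; exact: emeasurable_funD.
rewrite EFinD leeD//.
  rewrite integral_cst//= lebesgue_measure_itv/= lte_fin mul1e.
  by rewrite ifT -?EFinB ?lee_fin ?opprK//; lra.
apply: (@le_trans _ _ (\int[leb]_x h x)).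
  apply: ge0_subset_integral => //; first exact: emeasurable_funD.
  by move=> x _; rewrite adde_ge0.
rewrite ge0_integralD//= !ig1 ?normrN ?normr1//.
by rewrite EFinD leeD.
Qed.

End real_line.

(** * Integration over C^n one coordinate at a time *)

Section product_image_integral.
Local Open Scope ereal_scope.
Context d1 d2 d (T1 : measurableType d1) (T2 : measurableType d2)
  (T : measurableType d) (R : realType).
Variables (m1 : {sigma_finite_measure set T1 -> \bar R})
  (m2 : {sigma_finite_measure set T2 -> \bar R}).
Variables (f : T1 * T2 -> T) (g : T -> T1 * T2).
Hypotheses (mf : measurable_fun setT f) (mg : measurable_fun setT g).
Hypothesis fK : cancel f g.

Lemma integral_product_image (F : T -> \bar R) :
  measurable_fun setT F -> (forall x, 0 <= F x) ->
  \int[product_image m1 m2 mf mg fK]_x F x =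
  \int[m1]_x \int[m2]_y F (f (x, y)).
Proof.
move=> mF F0; rewrite (ge0_integral_pushforward mf)//.
rewrite preimage_setT fubini_tonelli1//.
- exact: measurableT_comp.
- by move=> x; exact: F0.
Qed.

End product_image_integral.

Section complex_space.
Context (R : realType).
Local Open Scope ereal_scope.
Local Notation leb := (@lebesgue_measure R).
Local Notation lebC := (lebesgueC R).

Lemma integralC (F : R[i] -> \bar R) : measurable_fun setT F ->
  (forall z, 0 <= F z) ->
  \int[lebC]_z F z = \int[leb]_x \int[leb]_y F (Complex x y).
Proof. by move=> mF F0; rewrite integral_product_image. Qed.

(** The coordinate to integrate first is one that is large at the given point, so it can be any of
    them; [ins i] makes Tonelli available at every index, whereas [lebesgueCn] only peels off index
    0. *)
Definition ins n (i : 'I_n.+1) (p : R[i] * n.-tuple R[i]) : n.+1.-tuple R[i] :=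
  [tuple if unlift i k is Some j then tnth p.2 j else p.1 | k < n.+1].

Lemma tnth_ins n (i : 'I_n.+1) p : tnth (ins i p) i = p.1.
Proof. by rewrite tnth_mktuple unlift_none. Qed.

Lemma tnth_ins_lift n (i : 'I_n.+1) p j : tnth (ins i p) (lift i j) = tnth p.2 j.
Proof. by rewrite tnth_mktuple liftK. Qed.

Lemma ins_tcons n (i : 'I_n.+1) x y t :
  ins (lift ord0 i) (x, tcons (y, t)) = tcons (y, ins i (x, t)).
Proof.
apply: eq_from_tnth => k.
have [<-|/unlift_some[j -> _]] := eqVneq (lift ord0 i) k.
  by rewrite tnth_ins /= tnthS tnth_ins.
rewrite tnth_ins_lift /=.
have [->|] := eqVneq j ord0.
  have -> : lift (lift ord0 i) ord0 = ord0 by apply/val_inj; rewrite /= /bump ltn0.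
  by rewrite !tnth0.
rewrite eq_sym => /unlift_some[l -> _].
have -> : lift (lift ord0 i) (lift ord0 l) = lift ord0 (lift i l).
  by apply/val_inj; rewrite /= /bump /= !add1n ltnS addnS.
by rewrite !tnthS tnth_ins_lift.
Qed.

Lemma ins0 n p : ins (@ord0 n) p = tcons p.
Proof.
apply: eq_from_tnth => k; have [->|] := eqVneq k ord0.
  by rewrite tnth_ins tnth0.
by rewrite eq_sym => /unlift_some[j -> _]; rewrite tnth_ins_lift tnthS.
Qed.

Lemma measurable_ins n (i : 'I_n.+1) : measurable_fun setT (ins i).
Proof.
apply/measurable_fun_tnthP => k.
have [->|] := eqVneq i k.
  rewrite (_ : _ \o _ = fst)//; apply/funext => p /=; exact: tnth_ins.
move=> /unlift_some[j -> _].
rewrite (_ : _ \o _ = (fun t => tnth t j) \o snd).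
  by apply: measurableT_comp => //; exact: measurable_tnth.
by apply/funext => p /=; exact: tnth_ins_lift.
Qed.

Lemma integralCn0 (F : 0.-tuple R[i] -> \bar R) : measurable_fun setT F ->
  \int[lebesgueCn R 0]_z F z = F [tuple].
Proof. by move=> mF; rewrite integral_dirac// diracT mul1e. Qed.

Lemma integralCnS n (F : n.+1.-tuple R[i] -> \bar R) : measurable_fun setT F ->
  (forall z, 0 <= F z) ->
  \int[lebesgueCn R n.+1]_z F z =
  \int[lebC]_x \int[lebesgueCn R n]_t F (tcons (x, t)).
Proof. by move=> mF F0; rewrite integral_product_image. Qed.

Let integralCn_ins0 n (F : n.+1.-tuple R[i] -> \bar R) :
  measurable_fun setT F -> (forall z, 0 <= F z) ->
  \int[lebesgueCn R n.+1]_z F z =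
  \int[lebesgueCn R n]_t \int[lebC]_x F (ins ord0 (x, t)).
Proof.
move=> mF F0; rewrite integralCnS//.
transitivity (\int[lebesgueCn R n]_t \int[lebC]_x F (tcons (x, t))); last first.
  by apply: eq_integral => t _; apply: eq_integral => x _; rewrite ins0.
apply: (fubini_tonelli (fun p => F (tcons p))).
  by apply: (measurableT_comp mF); exact: measurable_tcons.
by move=> x; exact: F0.
Qed.

(** Induction on the dimension: peel off coordinate 0, use the induction hypothesis on the tail, and
    commute the two insertions by [ins_tcons]. *)
Lemma integralCn_ins n (i : 'I_n.+1) (F : n.+1.-tuple R[i] -> \bar R) :
  measurable_fun setT F -> (forall z, 0 <= F z) ->
  \int[lebesgueCn R n.+1]_z F z =
  \int[lebesgueCn R n]_t \int[lebC]_x F (ins i (x, t)).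
Proof.
elim: n => [|n IH] in i F *.
  by rewrite ord1; exact: integralCn_ins0.
move=> mF F0.
have [->|] := eqVneq i ord0; first exact: integralCn_ins0.
rewrite eq_sym => /unlift_some[j -> _].
have mFt x : measurable_fun setT (fun t => F (tcons (x, t))).
  apply: (measurableT_comp mF); apply: (measurableT_comp (@measurable_tcons _ _ _)).
  exact: pair1_measurable.
have mG : measurable_fun setT (fun t => \int[lebC]_x F (ins (lift ord0 j) (x, t))).
  apply: (measurable_fun_fubini_tonelli_G (m1 := lebC)
    (fun p => F (ins (lift ord0 j) p))) => //.
  by apply: (measurableT_comp mF); exact: measurable_ins.
rewrite integralCnS//.
transitivity (\int[lebC]_x \int[lebesgueCn R n]_t
    \int[lebC]_y F (tcons (x, ins j (y, t)))).
  apply: eq_integral => x _.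
  exact: (IH j (fun t => F (tcons (x, t))) (mFt x) (fun t => F0 _)).
have G0 t : 0 <= \int[lebC]_x F (ins (lift ord0 j) (x, t)) by exact: integral_ge0.
apply: etrans; last exact/esym/(integralCnS mG G0).
apply: eq_integral => x _; apply: eq_integral => t _; apply: eq_integral => y _.
by congr F; exact/esym/ins_tcons.
Qed.

End complex_space.

Section measurability.
Context d (T : measurableType d) (R : realType).

Lemma measurable_powRl (f : T -> R) (p : R) : measurable_fun setT f ->
  measurable_fun setT (fun t => f t `^ p).
Proof. exact: (measurableT_comp (measurable_powR _)). Qed.

Lemma measurable_sing_comp (f : T -> R) (s : R) : measurable_fun setT f ->
  measurable_fun setT (fun t => sing s (f t)).
Proof. exact: (measurableT_comp (measurable_sing s)). Qed.

End measurability.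

(* Syntax-directed: plain higher-order unification with the library lemmas does
   not terminate in reasonable time here. *)
Ltac meas1 :=
  match goal with
  | |- measurable_fun _ (fun _ => ?c) => exact: measurable_cst
  | |- measurable_fun _ (fun z => z) => exact: measurable_id
  | |- measurable_fun _ (fun z => z.1) => exact: measurable_fst
  | |- measurable_fun _ (fun z => z.2) => exact: measurable_snd
  | |- measurable_fun _ (fun z => if _ then _ else _) =>
      apply: measurable_fun_ifT
  | |- measurable_fun _ (fun z => @?f z && @?g z) =>
      apply: (@measurable_and _ _ _ f g)
  | |- measurable_fun _ (fun z => (@?f z <= @?g z)%R) =>
      apply: (@measurable_fun_ler _ _ _ _ f g)
  | |- measurable_fun _ (fun z => (@?f z < @?g z)%R) =>
      apply: (@measurable_fun_ltr _ _ _ _ f g)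
  | |- measurable_fun _ (fun z => (@?f z)%:E) =>
      apply/(@measurable_EFinP _ _ _ _ f)
  | |- measurable_fun _ (fun z => (@?f z * @?g z)%E) =>
      apply: (@emeasurable_funM _ _ _ _ f g)
  | |- measurable_fun _ (fun z => sing _ (@?f z)) =>
      apply: (@measurable_sing_comp _ _ _ f)
  | |- measurable_fun _ (fun z => (@?f z) `^ _) =>
      apply: (@measurable_powRl _ _ _ f)
  | |- measurable_fun _ (fun z => (@?f z) ^+ _) =>
      apply: (@measurable_funX _ _ _ _ f)
  | |- measurable_fun _ (fun z => (@?f z * @?g z)%R) =>
      apply: (@measurable_funM _ _ _ _ f g)
  | |- measurable_fun _ (fun z => (- (@?f z))%R) =>
      apply: (@measurable_funN _ _ _ _ f)
  | |- measurable_fun _ (fun z => (@?f z + @?g z)%R) =>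
      apply: (@measurable_funD _ _ _ _ f g)
  | H : measurable_fun _ ?f |- measurable_fun _ ?f => exact: H
  end.

Ltac meas := repeat (rewrite /=; meas1).

(** * The singular integral in one complex coordinate *)

Section planar.
Context (R : realType).
Local Notation leb := (@lebesgue_measure R).
Implicit Types (A k p q r x y v s t : R).

(** Models the dependence on one coordinate z_i = x + i y with the others fixed: p + i q is w_i, [A]
    is 1 minus the square norm of the other coordinates, so that A - |z_i|^2 = 1 - |z|^2, and [k] is
    their share of Im <z, w>. *)
Definition planar_kernel s t r A k p q (z : R * R) : \bar R :=
  if [&& z.1 ^+ 2 + z.2 ^+ 2 <= 1, z.1 ^+ 2 + z.2 ^+ 2 < A &
         r <= z.1 * p + z.2 * q]
  then (((A - (z.1 ^+ 2 + z.2 ^+ 2)) `^ (- s))%:E *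
        sing t (k + (z.2 * p - z.1 * q)))%E
  else 0%E.

Lemma planar_kernel_ge0 s t r A k p q z : (0 <= planar_kernel s t r A k p q z)%E.
Proof.
rewrite /planar_kernel; case: ifPn => // _.
by rewrite mule_ge0 ?sing_ge0// lee_fin powR_ge0.
Qed.

Lemma measurable_planar_kernel s t r A k p q :
  measurable_fun [set: measurableTypeR R * measurableTypeR R]
    (planar_kernel s t r A k p q).
Proof.
rewrite /planar_kernel.
meas.
Qed.

(* Completing the square: in the coordinate v = Im (z conj w) transversal to
   w = p + iq, |z|^2 is a quadratic polynomial in x whose derivative is bounded
   below where Re (z conj w) >= r; so A - |z|^2 has a single zero there and
   dominates the distance of x to it. *)
Lemma planar_root_bound r A p q v : 0 < r -> p != 0 -> p ^+ 2 + q ^+ 2 <= 1 ->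
  exists x0 : R, forall x y, v = y * p - x * q ->
    x ^+ 2 + y ^+ 2 < A -> r <= x * p + y * q ->
    x != x0 /\ r * `|x - x0| <= A - (x ^+ 2 + y ^+ 2).
Proof.
move=> r0 p0 pq1.
pose W := p ^+ 2 + q ^+ 2.
have W0 : 0 < W by rewrite ltr_pwDl ?sqr_ge0// exprn_even_gt0.
pose D := (p ^+ 2 / W) * (A - v ^+ 2 / W).
pose m := - v * q / W.
(* Of the two zeros m +- sqrt D only the one on the side given by the sign of [p] matters, because
   (W / p) (x - m) = x p + y q is positive. *)
exists (m + Num.sg p * Num.sqrt D) => x y vE xA rxy.
pose X := x - m.
have E1 : A - (x ^+ 2 + y ^+ 2) = (W / p ^+ 2) * (D - X ^+ 2).
  by rewrite /D /X /m vE /W; field; rewrite p0/= gt_eqF.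
have E2 : (W / p) * X = x * p + y * q.
  by rewrite /X /m vE /W; field; rewrite p0/= gt_eqF.
have absp0 : 0 < `|p| by rewrite normr_gt0.
have absp1 : `|p| <= 1.
  rewrite -(@ler_pXn2r _ 2) ?nnegrE// expr1n real_normK ?num_real//.
  by rewrite (le_trans _ pq1)// lerDl sqr_ge0.
have Xp : X / p = `|X| / `|p|.
  have h : 0 <= X / p.
    suff : 0 <= W * (X / p) by rewrite pmulr_rge0.
    by rewrite mulrA mulrAC E2 (le_trans (ltW r0)).
  by rewrite -(ger0_norm h) normrM normfV.
have sX : X = Num.sg p * `|X|.
  have -> : `|X| = `|p| * (X / p) by rewrite Xp mulrCA divff ?mulr1// gt_eqF.
  by rewrite mulrA -numEsg mulrC divfK.
have sp : Num.sg p * Num.sg p = 1 by rewrite -expr2 sqr_sg p0.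
have DX : 0 < D - X ^+ 2.
  have : 0 < A - (x ^+ 2 + y ^+ 2) by rewrite subr_gt0.
  by rewrite E1 pmulr_rgt0// divr_gt0// exprn_even_gt0.
have D0 : 0 < D by rewrite (le_lt_trans (sqr_ge0 X))// -subr_gt0.
set e := Num.sqrt D; have e0 : 0 < e by rewrite sqrtr_gt0.
have eD : e ^+ 2 = D by rewrite sqr_sqrtr// ltW.
have Xe : `|X| < e.
  by rewrite -(@ltr_pXn2r _ 2) ?nnegrE ?(ltW e0)// eD real_normK ?num_real// -subr_gt0.
have xx0 : x - (m + Num.sg p * e) = Num.sg p * (`|X| - e).
  by rewrite mulrBr -sX /X; ring.
have nxx0 : `|x - (m + Num.sg p * e)| = e - `|X|.
  by rewrite xx0 normrM normr_sg p0 mul1r ltr0_norm ?opprB// subr_lt0.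
split.
  by rewrite -subr_eq0 -normr_gt0 nxx0 subr_gt0.
rewrite nxx0 E1 -eD -(real_normK (num_real X)) subr_sqr.
rewrite mulrCA mulrC ler_pM2l ?subr_gt0//.
apply: (@le_trans _ _ (W / p ^+ 2 * `|X|)); last first.
  by rewrite ler_pM2l ?divr_gt0 ?exprn_even_gt0// lerDr ltW.
have -> : W / p ^+ 2 * `|X| = (W * (X / p)) / `|p|.
  rewrite Xp -(real_normK (num_real p)).
  by field; rewrite normr_eq0.
have -> : W * (X / p) = x * p + y * q by rewrite -E2; field.
by rewrite ler_pdivlMr// (le_trans _ rxy)// ler_piMr// ltW.
Qed.

Local Open Scope ereal_scope.

(** In the coordinates (x, v) with v = y p - x q the two singularities separate: one depends on [v]
    alone, the other is dominated by a power of |x - x0|. The centre [x0] varies with [v], which is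
    harmless since [integral_sing] is uniform in the centre. *)
Let planar_kernel_le s t r A k p q : (0 <= s)%R -> (0 < r)%R -> p != 0%R ->
  (p ^+ 2 + q ^+ 2 <= 1)%R -> forall v, exists x0 : R, forall x,
  planar_kernel s t r A k p q (x, p^-1 * v + x * q / p)%R <=
  ((fun v => sing t (v - (- k)%R)%R) \_ `[(-1)%R, 1%R]) v * (r `^ (- s))%:E *
  ((fun x => sing s (x - x0)%R) \_ `[(-1)%R, 1%R]) x.
Proof.
move=> s0 r0 p0 pq1 v.
have [x0 hx0] := planar_root_bound A v r0 p0 pq1.
exists x0 => x; rewrite /planar_kernel/=.
set y := (p^-1 * v + x * q / p)%R.
have vE : v = (y * p - x * q)%R by rewrite /y; field.
have H0 : 0 <= ((fun v => sing t (v - (- k)%R)%R) \_ `[(-1)%R, 1%R]) v.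
  by rewrite patchE; case: ifPn => // _; exact: sing_ge0.
have H1 : 0 <= ((fun x => sing s (x - x0)%R) \_ `[(-1)%R, 1%R]) x.
  by rewrite patchE; case: ifPn => // _; exact: sing_ge0.
case: ifPn => [/and3P[xy1 xyA xyr]|_]; last first.
  by rewrite !mule_ge0// lee_fin powR_ge0.
have [xx0 rx0] := hx0 x y vE xyA xyr.
have sq1 (u : R) : (u ^+ 2 <= 1)%R -> (-1 <= u <= 1)%R.
  by move=> u1; rewrite -ler_norml -(@ler_pXn2r _ 2) ?nnegrE// expr1n real_normK ?num_real.
have x1 : (-1 <= x <= 1)%R.
  by apply: sq1; rewrite (le_trans _ xy1)// lerDl sqr_ge0.
have v1 : (-1 <= v <= 1)%R.
  apply: sq1; rewrite vE.
  apply: (@le_trans _ _ ((x ^+ 2 + y ^+ 2) * (p ^+ 2 + q ^+ 2))%R).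
    rewrite -subr_ge0 (_ : (_ - _)%R = (x * p + y * q) ^+ 2)%R ?sqr_ge0//.
    by ring.
  by rewrite -[leRHS]mulr1 ler_pM// ?addr_ge0// ?sqr_ge0.
rewrite !patchE !mem_set/= ?in_itv//=.
rewrite -vE opprK (addrC v) -[leRHS]muleA [leRHS]muleC.
rewrite lee_wpmul2r//; first exact: sing_ge0.
rewrite /sing subr_eq0 (negbTE xx0) -EFinM lee_fin -powRM ?(ltW r0)//.
rewrite !powRN lef_pV2 ?posrE ?powR_gt0 ?subr_gt0//; last first.
  by rewrite mulr_gt0// normr_gt0 subr_eq0.
by rewrite ge0_ler_powR// ?nnegrE ?subr_ge0 ?(ltW xyA)// mulr_ge0// ltW.
Qed.

Let measurable_subst p q :
  measurable_fun [set: measurableTypeR R * measurableTypeR R]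
    (fun z : measurableTypeR R * measurableTypeR R =>
      (z.1, p^-1 * z.2 + z.1 * q / p)%R : measurableTypeR R * measurableTypeR R).
Proof. by apply/measurable_fun_pairP; split; rewrite /comp; meas. Qed.

Let integral_planar_p s t r : (0 <= s < 1)%R -> (0 <= t < 1)%R -> (0 < r)%R ->
  exists C : R, (0 < C)%R /\ forall A k p q, (p ^+ 2 + q ^+ 2 <= 1)%R ->
    (r / 2 <= `|p|)%R ->
    \int[leb]_x \int[leb]_y planar_kernel s t r A k p q (x, y) <= C%:E.
Proof.
move=> s01 t01 r0; have /andP[s0 s1] := s01.
have [Cs [Cs0 hCs]] := integral_sing s01.
have [Ct [Ct0 hCt]] := integral_sing t01.
exists (2 / r * (r `^ (- s) * Cs * Ct))%R; split.
  by rewrite !mulr_gt0 ?invr_gt0 ?powR_gt0.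
move=> A k p q pq1 rp.
have ap0 : (0 < `|p|)%R by rewrite (lt_le_trans _ rp)// divr_gt0.
have p0 : p != 0%R by rewrite -normr_gt0.
pose K := planar_kernel s t r A k p q.
pose H (z : R * R) := K (z.1, p^-1 * z.2 + z.1 * q / p)%R.
have mK := measurable_planar_kernel s t r A k p q.
have mH : measurable_fun [set: measurableTypeR R * measurableTypeR R] H.
  exact: (measurableT_comp mK (measurable_subst p q)).
have K0 z : 0 <= K z by exact: planar_kernel_ge0.
have H0 z : 0 <= H z by exact: K0.
rewrite EFinM; apply: (@ge0_integral_leZ _ _ _ leb _ _
    (fun x => \int[leb]_v H (x, v))).
- by rewrite divr_gt0.
- by move=> x; apply: integral_ge0 => v _; exact: (H0 (x, v)).
- by move=> x; apply: integral_ge0 => y _; exact: (K0 (x, y)).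
(* The Jacobian of y = v / p + x q / p is 1 / |p|, at most 2 / r. *)
- move=> x; rewrite (@ge0_integral_affine _ p^-1 (x * q / p)%R) ?invr_eq0//.
  + rewrite lee_wpmul2r//; first by apply: integral_ge0 => v _; exact: (H0 (x, v)).
    rewrite lee_fin normfV -[leRHS]invrK lef_pV2 ?posrE ?invr_gt0 ?divr_gt0//.
    by rewrite invf_div.
  + apply: (measurableT_comp mK); exact: pair1_measurable.
rewrite [leLHS](_ : _ = \int[leb]_v \int[leb]_x H (x, v)); last first.
  exact: (@fubini_tonelli _ _ _ _ _ leb leb H mH H0).
have hv v : \int[leb]_x H (x, v) <=
    (r `^ (- s) * Cs)%:E * ((fun v => sing t (v - (- k)%R)%R) \_ `[(-1)%R, 1%R]) v.
  have [x0 hx0] := @planar_kernel_le s t r A k p q s0 r0 p0 pq1 v.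
  apply: le_trans (@ge0_le_integralT _ _ _ leb _ _ (fun x => H0 (x, v)) hx0) _.
  rewrite ge0_integralZl//=; last 3 first.
  - apply/(measurable_restrictT _ _).1 => //; apply: measurable_funTS; meas.
  - by move=> x _; rewrite patchE; case: ifPn => // _; exact: sing_ge0.
  - rewrite mule_ge0//; last by rewrite lee_fin powR_ge0.
    by rewrite patchE; case: ifPn => // _; exact: sing_ge0.
  rewrite -integral_mkcond EFinM [leRHS]muleC [leRHS]muleA.
  rewrite lee_wpmul2l// mule_ge0 ?lee_fin ?powR_ge0// patchE.
  by case: ifPn => // _; exact: sing_ge0.
rewrite EFinM; apply: (@ge0_integral_leZ _ _ _ leb _ _ _ _ _ _ _ hv).
- by rewrite mulr_gt0// powR_gt0.
- by move=> v; rewrite patchE; case: ifPn => // _; exact: sing_ge0.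
- by move=> v; apply: integral_ge0 => x _; exact: (H0 (x, v)).
- by rewrite -integral_mkcond.
Qed.

(** On the support r <= x p + y q <= |p| + |q|, so |p| or |q| is at least r / 2 unless the support
    is empty. This removes the degenerate Jacobian at p = 0. *)
Lemma integral_planar s t r : (0 <= s < 1)%R -> (0 <= t < 1)%R -> (0 < r)%R ->
  exists C : R, (0 < C)%R /\ forall A k p q, (p ^+ 2 + q ^+ 2 <= 1)%R ->
    \int[leb]_x \int[leb]_y planar_kernel s t r A k p q (x, y) <= C%:E.
Proof.
move=> s01 t01 r0; have [C [C0 hC]] := integral_planar_p s01 t01 r0.
exists C; split=> // A k p q pq1.
have [rp|rp] := leP (r / 2)%R `|p|%R; first exact: hC.
have [rq|rq] := leP (r / 2)%R `|q|%R.
  (* Exchanging x with y and p with q turns y p - x q into its opposite; with [- k] in place of [k]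
     the argument of [sing], which is even, only changes sign. *)
  rewrite [leLHS](_ : _ =
    \int[leb]_y \int[leb]_x planar_kernel s t r A (- k) q p (y, x)).
    by apply: hC => //; rewrite addrC.
  apply: etrans (@fubini_tonelli _ _ _ _ _ leb leb _ (measurable_planar_kernel s t r A k p q)
    (planar_kernel_ge0 s t r A k p q)) _.
  apply: eq_integral => y _; apply: eq_integral => x _.
  rewrite /planar_kernel/= (addrC (y ^+ 2)%R) (addrC (y * q)%R); congr (if _ then _ else _).
  congr (_ * _); rewrite /sing -(normrN (k + _)%R) opprD opprB -oppr_eq0 opprD opprB.
  by [].
rewrite (_ : (fun x => _) = cst 0) ?integral_cst ?mul0e ?lee_fin ?ltW//.
apply/funext => x /=.
rewrite (_ : (fun y => _) = cst 0) ?integral_cst ?mul0e//.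
apply/funext => y /=; rewrite /planar_kernel/=; case: ifPn => // /and3P[xy1 _ rxy].
exfalso; move: rxy; apply/negP; rewrite -ltNge.
have le1 (a b : R) : (a ^+ 2 + b ^+ 2 <= 1)%R -> (`|a| <= 1)%R.
  move=> ab; rewrite -(@ler_pXn2r _ 2) ?nnegrE// expr1n real_normK ?num_real//.
  by rewrite (le_trans _ ab)// lerDl sqr_ge0.
have x1 := le1 _ _ xy1; have y1 : (`|y| <= 1)%R by apply: (le1 _ x); rewrite addrC.
rewrite (le_lt_trans (ler_norm _))// (le_lt_trans (ler_normD _ _))// !normrM.
rewrite [ltRHS](_ : r = r / 2 + r / 2)%R; last by field.
by rewrite ltrD// (le_lt_trans (ler_piMl _ _)).
Qed.

End planar.

(** * Integrability of the kernel over the ball *)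

Section sums_of_squares.
Context (R : realType).
Local Notation leb := (@lebesgue_measure R).
Local Notation lebC := (lebesgueC R).
Implicit Types (s t D g : R).

Definition nsq (z : R[i]) : R := complex.Re z ^+ 2 + complex.Im z ^+ 2.

Lemma nsq_ge0 z : 0 <= nsq z.
Proof. by rewrite addr_ge0// sqr_ge0. Qed.

Definition sumsq n (z : n.-tuple R[i]) : R := \sum_(j < n) nsq (tnth z j).

Lemma sumsq_ge0 n (z : n.-tuple R[i]) : 0 <= sumsq z.
Proof. by apply: sumr_ge0 => j _; exact: nsq_ge0. Qed.

Definition distsq n (z w : n.-tuple R[i]) : R :=
  \sum_(j < n) nsq (tnth z j - tnth w j).

Lemma distsq_ge0 n (z w : n.-tuple R[i]) : 0 <= distsq z w.
Proof. by apply: sumr_ge0 => j _; exact: nsq_ge0. Qed.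

Lemma measurable_ReC d (T : measurableType d) (f : T -> R[i]) :
  measurable_fun setT f -> measurable_fun setT (fun x => complex.Re (f x)).
Proof. exact: (measurableT_comp (@measurable_Re R)). Qed.

Lemma measurable_ImC d (T : measurableType d) (f : T -> R[i]) :
  measurable_fun setT f -> measurable_fun setT (fun x => complex.Im (f x)).
Proof. exact: (measurableT_comp (@measurable_Im R)). Qed.

Lemma measurable_nsq d (T : measurableType d) (f : T -> R[i]) :
  measurable_fun setT f -> measurable_fun setT (fun x => nsq (f x)).
Proof.
move=> mf; apply: measurable_funD; apply: measurable_funX.
  exact: measurable_ReC.
exact: measurable_ImC.
Qed.

Lemma ReB (z w : R[i]) : complex.Re (z - w) = complex.Re z - complex.Re w.
Proof. by case: z; case: w. Qed.

Lemma ImB (z w : R[i]) : complex.Im (z - w) = complex.Im z - complex.Im w.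
Proof. by case: z; case: w. Qed.

Lemma nsqB (z w : R[i]) : nsq (z - w) =
  (complex.Re z - complex.Re w) ^+ 2 + (complex.Im z - complex.Im w) ^+ 2.
Proof. by rewrite /nsq ReB ImB. Qed.

Lemma measurable_nsqB d (T : measurableType d) (f : T -> R[i]) w :
  measurable_fun setT f -> measurable_fun setT (fun x => nsq (f x - w)).
Proof.
move=> mf; rewrite (_ : (fun _ => _) = fun x =>
  (complex.Re (f x) - complex.Re w) ^+ 2 + (complex.Im (f x) - complex.Im w) ^+ 2).
  have := measurable_ReC mf; have := measurable_ImC mf => ? ?.
  by meas.
by apply/funext => x; rewrite nsqB.
Qed.

Lemma measurable_sumsq n : measurable_fun setT (@sumsq n).
Proof.
by apply: measurable_sum => j; apply: measurable_nsq; exact: measurable_tnth.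
Qed.

Lemma measurable_distsq n (w : n.-tuple R[i]) :
  measurable_fun setT (fun z => distsq z w).
Proof.
by apply: measurable_sum => j; apply: measurable_nsqB; exact: measurable_tnth.
Qed.

Definition dist_kernel n D g (w z : n.-tuple R[i]) : \bar R :=
  if sumsq z <= 1 then ((D + distsq z w) `^ (- g))%:E else 0%E.

Lemma measurable_dist_kernel n D g w : measurable_fun setT (@dist_kernel n D g w).
Proof.
have := @measurable_sumsq n; have := measurable_distsq w => ? ?.
by rewrite /dist_kernel; meas.
Qed.

Lemma dist_kernel_ge0 n D g w z : (0 <= @dist_kernel n D g w z)%E.
Proof. by rewrite /dist_kernel; case: ifPn; rewrite // lee_fin powR_ge0. Qed.

Local Open Scope ereal_scope.

Let distC_kernel D g (w z : R[i]) : \bar R :=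
  if (nsq z <= 1)%R then ((D + nsq (z - w)) `^ (- g))%:E else 0.

(** Split the exponent as - g = (t - g) - t. The first part is bounded by D^(t - g); for the second,
    D + X^2 + Y^2 >= |X| |Y| leaves a product of two integrable singularities on the line. *)
Let integral_distC_kernel t : (0 <= t < 1)%R -> exists C : R, (0 < C)%R /\
  forall D g w, (0 < D)%R -> (t <= g)%R ->
  \int[lebC]_z distC_kernel D g w z <= (C * D `^ (t - g))%:E.
Proof.
move=> t01; have /andP[t0 t1] := t01.
have [C [C0 hC]] := integral_sing t01.
exists (C * C)%R; split; first exact: mulr_gt0.
move=> D g w D0 tg.
have m1 := @measurable_nsq _ _ _ (@measurable_id _ R[i] setT).
have m2 := measurable_nsqB w (@measurable_id _ R[i] setT).
have K0 z : 0 <= distC_kernel D g w z.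
  by rewrite /distC_kernel; case: ifPn; rewrite // lee_fin powR_ge0.
rewrite integralC//; last by rewrite /distC_kernel; meas.
pose S (a : R) := (fun x => sing t (x - a)%R) \_ `[(-1)%R, 1%R].
have S0 a x : 0 <= S a x.
  by rewrite /S patchE; case: ifPn => // _; exact: sing_ge0.
have mS a : measurable_fun [set: measurableTypeR R] (S a).
  by apply/(measurable_restrictT _ _).1 => //; apply: measurable_funTS; meas.
have iS a : \int[leb]_x S a x <= C%:E by rewrite -integral_mkcond.
set a := complex.Re w; set b := complex.Im w.
have le1 (u v : R) : (u ^+ 2 + v ^+ 2 <= 1)%R -> (-1 <= u <= 1)%R.
  move=> uv; rewrite -ler_norml -(@ler_pXn2r _ 2) ?nnegrE// expr1n.
  by rewrite real_normK ?num_real// (le_trans _ uv)// lerDl sqr_ge0.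
have hK x y : distC_kernel D g w (Complex x y) <=
    (D `^ (t - g))%:E * S a x * S b y.
  rewrite /distC_kernel; rewrite {1}/nsq/=; case: ifPn => [xy1|_]; last first.
    by rewrite !mule_ge0// lee_fin powR_ge0.
  rewrite /S !patchE !mem_set/= ?in_itv//=; last 2 first.
  - by apply: (le1 y x); rewrite addrC.
  - exact: (le1 _ _ xy1).
  rewrite nsqB/=; set X := (x - a)%R; set Y := (y - b)%R.
  have D1 : (D <= D + (X ^+ 2 + Y ^+ 2))%R by rewrite lerDl addr_ge0 ?sqr_ge0.
  have D1' := lt_le_trans D0 D1.
  (* If X or Y vanishes, the right-hand side is +oo. *)
  rewrite /sing; have [X0|X0] := eqVneq X 0%R.
    rewrite gt0_muley ?lte_fin ?powR_gt0// gt0_mulye ?leey//.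
    exact: sing_gt0.
  have [Y0|Y0] := eqVneq Y 0%R.
    by rewrite gt0_muley ?leey// mule_gt0 ?lte_fin ?powR_gt0 ?normr_gt0.
  have XY0 : (0 < `|X| * `|Y|)%R by rewrite mulr_gt0 ?normr_gt0.
  rewrite -!EFinM lee_fin -mulrA -powRM//.
  set e := (t - g)%R; have -> : (- g = e + (- t))%R by rewrite /e; ring.
  rewrite [X in (X <= _)%R]powRD; last by rewrite (gt_eqF D1') implybT.
  rewrite ler_pM ?powR_ge0//.
    have -> : e = (- (g - t))%R by rewrite /e opprB.
    rewrite !powRN lef_pV2 ?posrE ?powR_gt0//.
    by rewrite ge0_ler_powR ?subr_ge0// ?nnegrE ltW.
  rewrite !powRN lef_pV2 ?posrE ?powR_gt0//.
  apply: ge0_ler_powR; rewrite // ?nnegrE ?ltW//.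
  rewrite -(real_normK (num_real X)) -(real_normK (num_real Y)).
  have : (0 <= (`|X| - `|Y|) ^+ 2)%R by exact: sqr_ge0.
  rewrite sqrrB; move: XY0 D0; nra.
apply: (@le_trans _ _ (\int[leb]_x ((D `^ (t - g))%:E * C%:E * S a x))).
  apply: ge0_le_integralT => x; first by apply: integral_ge0 => y _; exact: K0.
  apply: le_trans (@ge0_le_integralT _ _ _ leb _ _ _ (hK x)) _.
    by move=> y; exact: K0.
  rewrite ge0_integralZl//; last by rewrite mule_ge0// lee_fin powR_ge0.
  by rewrite [leRHS]muleAC lee_wpmul2l// mule_ge0// lee_fin powR_ge0.
rewrite ge0_integralZl//; last by rewrite mule_ge0// lee_fin ?powR_ge0// ltW.
rewrite [X in _ <= X%:E]mulrC mulrA !EFinM lee_wpmul2l//.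
by rewrite mule_ge0// lee_fin ?powR_ge0// ltW.
Qed.

(** Each complex coordinate lowers the exponent by [t]: after integrating the last coordinates, what
    is left is the one-dimensional kernel with the exponent reduced accordingly and the same [D]. *)
Lemma integral_dist_kernel t n : (0 <= t < 1)%R -> exists C : R, (0 < C)%R /\
  forall D g w, (0 < D)%R -> (n%:R * t <= g)%R ->
  \int[lebesgueCn R n]_z dist_kernel D g w z <= (C * D `^ (n%:R * t - g))%:E.
Proof.
move=> t01; have /andP[t0 t1] := t01.
have [C1 [C10 hC1]] := integral_distC_kernel t01.
elim: n => [|n [C [C0 IH]]].
  exists 1%R; split=> // D g w D0 _; rewrite integralCn0; last first.
    exact: measurable_dist_kernel.
  rewrite /dist_kernel /sumsq /distsq !big_ord0 ler01 addr0 mul0r sub0r mul1r.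
  by [].
exists (C * C1)%R; split; first exact: mulr_gt0.
move=> D g w D0 ntg; rewrite integralCnS; last 2 first.
- exact: measurable_dist_kernel.
- exact: dist_kernel_ge0.
have gE : (g = n%:R * t + (g - n%:R * t))%R by ring.
have tg' : (t <= g - n%:R * t)%R by move: ntg; rewrite -natr1; lra.
have hK x : \int[lebesgueCn R n]_y dist_kernel D g w (tcons (x, y)) <=
    C%:E * distC_kernel D (g - n%:R * t) (thead w) x.
  have sE y : sumsq (tcons (x, y)) = (nsq x + sumsq y)%R.
    rewrite /sumsq big_ord_recl tnth0; congr (_ + _)%R.
    by apply: eq_bigr => j _; rewrite tnthS.
  have dE y : distsq (tcons (x, y)) w =
      (nsq (x - thead w) + distsq y [tuple of behead w])%R.
    rewrite /distsq big_ord_recl tnth0; congr (_ + _)%R.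
    apply: eq_bigr => j _; rewrite tnthS tnth_behead.
    by congr (nsq (_ - tnth w _)%R); apply/val_inj; rewrite /= inordK// ltnS.
  rewrite /distC_kernel; case: ifPn => [x1|]; last first.
    rewrite -ltNge => x1; rewrite mule0.
    rewrite (_ : (fun y => _) = cst 0) ?integral_cst ?mul0e//.
    apply/funext => y; rewrite /dist_kernel sE ifF//; apply/negbTE; rewrite -ltNge.
    by rewrite (lt_le_trans x1)// lerDl sumsq_ge0.
  have D1 : (0 < D + nsq (x - thead w))%R by rewrite ltr_pwDl// nsq_ge0.
  rewrite -EFinM opprB; apply: le_trans (IH _ g [tuple of behead w] D1 _); last first.
    by move: ntg tg'; lra.
  apply: ge0_le_integralT => y; first exact: dist_kernel_ge0.
  rewrite /dist_kernel sE dE addrA; case: ifPn => [xy1|_].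
    by rewrite ifT// (le_trans _ xy1)// lerDr nsq_ge0.
  by case: ifPn; rewrite // lee_fin powR_ge0.
apply: le_trans (ge0_integral_leZ C0 _ _ hK (hC1 D _ (thead w) D0 tg')) _.
- by move=> x; rewrite /distC_kernel; case: ifPn; rewrite // lee_fin powR_ge0.
- by move=> x; apply: integral_ge0 => y _; exact: dist_kernel_ge0.
rewrite -EFinM mulrA (_ : t - (g - n%:R * t) = n.+1%:R * t - g)%R//.
by rewrite -natr1; ring.
Qed.

End sums_of_squares.

(** * Real and imaginary parts of 1 - <z, w> *)

Section inner_product.
Context (R : realType).

Lemma normc_nsq (z : R[i]) : Normc.normc z = Num.sqrt (nsq z).
Proof. by case: z. Qed.

Lemma sqr_normc_nsq (z : R[i]) : Normc.normc z ^+ 2 = nsq z.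
Proof. by rewrite normc_nsq sqr_sqrtr// nsq_ge0. Qed.

Lemma cnormE n (z : n.-tuple R[i]) : cnorm z = Num.sqrt (sumsq z).
Proof. by rewrite /cnorm; under eq_bigr do rewrite sqr_normc_nsq. Qed.

Lemma sqr_cnorm n (z : n.-tuple R[i]) : cnorm z ^+ 2 = sumsq z.
Proof. by rewrite cnormE sqr_sqrtr// sumsq_ge0. Qed.

Lemma unit_ballE n (z : n.-tuple R[i]) : unit_ball z <-> sumsq z < 1.
Proof. by rewrite /unit_ball/= cnormE -{1}(@sqrtr1 R) ltr_sqrt. Qed.

Lemma Re_le_normc (z : R[i]) : `|complex.Re z| <= Normc.normc z.
Proof. by rewrite normc_nsq -sqrtr_sqr ler_wsqrtr// lerDl sqr_ge0. Qed.

Lemma Im_le_normc (z : R[i]) : `|complex.Im z| <= Normc.normc z.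
Proof. by rewrite normc_nsq -sqrtr_sqr ler_wsqrtr// lerDr sqr_ge0. Qed.

Lemma Re_inner n (z w : n.-tuple R[i]) : complex.Re (inner z w) =
  \sum_(j < n) (complex.Re (tnth z j) * complex.Re (tnth w j) +
                complex.Im (tnth z j) * complex.Im (tnth w j)).
Proof.
rewrite /inner (big_morph (@complex.Re R) (id1 := 0) (op1 := +%R))//; last first.
  by case=> a b [c d].
apply: eq_bigr => j _; case: (tnth z j) => a b; case: (tnth w j) => c d /=.
by rewrite mulrN opprK.
Qed.

Lemma Im_inner n (z w : n.-tuple R[i]) : complex.Im (inner z w) =
  \sum_(j < n) (complex.Im (tnth z j) * complex.Re (tnth w j) -
                complex.Re (tnth z j) * complex.Im (tnth w j)).
Proof.
rewrite /inner (big_morph (@complex.Im R) (id1 := 0) (op1 := +%R))//; last first.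
  by case=> a b [c d].
apply: eq_bigr => j _; case: (tnth z j) => a b; case: (tnth w j) => c d /=.
by rewrite mulrN addrC.
Qed.

Lemma Re_1inner n (z w : n.-tuple R[i]) : complex.Re (1 - inner z w) =
  (1 - sumsq z + (1 - sumsq w) + distsq z w) / 2.
Proof.
rewrite ReB Re_inner/=.
have -> : distsq z w = sumsq z + sumsq w - 2 * \sum_(j < n)
   (complex.Re (tnth z j) * complex.Re (tnth w j) +
                complex.Im (tnth z j) * complex.Im (tnth w j)).
  rewrite /distsq /sumsq mulr_sumr -big_split -sumrB/=.
  by apply: eq_bigr => j _; rewrite nsqB /nsq; ring.
by field.
Qed.

Lemma Im_1inner n (z w : n.-tuple R[i]) :
  complex.Im (1 - inner z w) = - complex.Im (inner z w).
Proof. by rewrite ImB/= sub0r. Qed.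

End inner_product.

Section slices.
Context (R : realType) (n : nat).
Local Notation lam := (lebesgueCn R n.+1).
Implicit Types (z w : n.+1.-tuple R[i]) (i : 'I_n.+1) (s t r b g : R).

(* For fixed w, the i-th coordinate of z enters through the planar kernel only. *)
Definition slice_kernel s t r i b g w z : \bar R :=
  if sumsq z <= 1 then
    (planar_kernel s t r (1 - (sumsq z - nsq (tnth z i)))
       (complex.Im (inner z w) -
          (complex.Im (tnth z i) * complex.Re (tnth w i) -
           complex.Re (tnth z i) * complex.Im (tnth w i)))
       (complex.Re (tnth w i)) (complex.Im (tnth w i))
       (complex.Re (tnth z i), complex.Im (tnth z i)) *
    ((b + (distsq z w - nsq (tnth z i - tnth w i))) `^ (- g))%:E)%E
  else 0%E.

Lemma slice_kernel_ge0 s t r i b g w z : (0 <= slice_kernel s t r i b g w z)%E.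
Proof.
rewrite /slice_kernel; case: ifPn => // _.
by rewrite mule_ge0 ?planar_kernel_ge0// lee_fin powR_ge0.
Qed.

Lemma measurable_Im_inner w : measurable_fun setT (fun z => complex.Im (inner z w)).
Proof.
rewrite (_ : (fun z => _) = fun z => \sum_(j < n.+1)
   (complex.Im (tnth z j) * complex.Re (tnth w j) -
                complex.Re (tnth z j) * complex.Im (tnth w j))).
  apply: measurable_sum => j.
  have := measurable_ReC (@measurable_tnth _ R[i] _ j).
  have := measurable_ImC (@measurable_tnth _ R[i] _ j) => ? ?.
  by meas.
by apply/funext => z; rewrite Im_inner.
Qed.

Lemma measurable_slice_kernel s t r i b g w :
  measurable_fun setT (slice_kernel s t r i b g w).
Proof.
have := measurable_ReC (@measurable_tnth _ R[i] _ i).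
have := measurable_ImC (@measurable_tnth _ R[i] _ i).
have := measurable_nsq (@measurable_tnth _ R[i] _ i).
have := measurable_nsqB (tnth w i) (@measurable_tnth _ R[i] _ i).
have := @measurable_sumsq R n.+1.
have := measurable_distsq w.
have := measurable_Im_inner w => ? ? ? ? ? ? ?.
by rewrite /slice_kernel /planar_kernel/=; meas.
Qed.

Local Open Scope ereal_scope.

(** With the other coordinates fixed, the integral in z_i is bounded by [integral_planar], uniformly
    in [A], [k] and w_i; the remaining factor is [dist_kernel] in n coordinates with D = b. The
    bound stays uniform in [w] apart from the power of [b]. *)
Lemma integral_slice_kernel s t r : (0 <= s < 1)%R -> (0 <= t < 1)%R ->
  (0 < r)%R -> exists C : R, (0 < C)%R /\
  forall i b g w, (nsq (tnth w i) <= 1)%R -> (0 < b)%R -> (n%:R * t <= g)%R ->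
  \int[lam]_z slice_kernel s t r i b g w z <= (C * b `^ (n%:R * t - g))%:E.
Proof.
move=> s01 t01 r0.
have [Cp [Cp0 hCp]] := integral_planar s01 t01 r0.
have [Cd [Cd0 hCd]] := integral_dist_kernel n t01.
exists (Cp * Cd)%R; split; first exact: mulr_gt0.
move=> i b g w w1 b0 tg; rewrite (integralCn_ins i); last 2 first.
- exact: measurable_slice_kernel.
- exact: slice_kernel_ge0.
pose w' : n.-tuple R[i] := [tuple tnth w (lift i j) | j < n].
rewrite -mulrA EFinM.
apply: (@ge0_integral_leZ _ _ _ _ _ _ (dist_kernel b g w')) => //.
- by move=> y; exact: dist_kernel_ge0.
- by move=> y; apply: integral_ge0 => x _; exact: slice_kernel_ge0.
- move=> y.
  have sE x : (sumsq (ins i (x, y)) - nsq (tnth (ins i (x, y)) i) = sumsq y)%R.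
    rewrite /sumsq (bigD1_ord i)//= addrAC subrr add0r.
    by apply: eq_bigr => j _; rewrite tnth_ins_lift.
  have dE x : (distsq (ins i (x, y)) w -
      nsq (tnth (ins i (x, y)) i - tnth w i) = distsq y w')%R.
    rewrite /distsq (bigD1_ord i)//= addrAC subrr add0r.
    by apply: eq_bigr => j _; rewrite tnth_ins_lift tnth_mktuple.
  pose k := (\sum_(j < n) (complex.Im (tnth y j) * complex.Re (tnth w' j) -
                complex.Re (tnth y j) * complex.Im (tnth w' j)))%R.
  have iE x : (complex.Im (inner (ins i (x, y)) w) -
    (complex.Im (tnth (ins i (x, y)) i) * complex.Re (tnth w i) -
     complex.Re (tnth (ins i (x, y)) i) * complex.Im (tnth w i)) = k)%R.
    rewrite Im_inner (bigD1_ord i)//= addrAC subrr add0r.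
    by apply: eq_bigr => j _; rewrite tnth_ins_lift tnth_mktuple.
  pose K x := planar_kernel s t r (1 - sumsq y) k (complex.Re (tnth w i))
       (complex.Im (tnth w i)) (complex.Re x, complex.Im x).
  have mK : measurable_fun [set: R[i]] K.
    have := @measurable_Re R; have := @measurable_Im R => ? ?.
    by rewrite /K /planar_kernel/=; meas.
  have K0 x : 0 <= K x by exact: planar_kernel_ge0.
  apply: (@le_trans _ _ (\int[lebesgueC R]_x (dist_kernel b g w' y * K x))).
    apply: ge0_le_integralT => x; first exact: slice_kernel_ge0.
    rewrite /slice_kernel; case: ifPn => [xy1|_]; last first.
      by rewrite mule_ge0// dist_kernel_ge0.
    rewrite iE dE sE tnth_ins /dist_kernel ifT; last first.
      by rewrite -(sE x) (le_trans _ xy1)// gerBl nsq_ge0.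
    by rewrite muleC.
  rewrite ge0_integralZl//; last exact: dist_kernel_ge0.
  rewrite [leRHS]muleC lee_wpmul2l ?dist_kernel_ge0//.
  by rewrite integralC//; exact: hCp.
- exact: hCd.
Qed.

End slices.

Section powers.
Context (R : realType).
Implicit Types (x y s t c : R).

Lemma ler_powRN x y s : 0 <= s -> 0 < x -> x <= y -> y `^ (- s) <= x `^ (- s).
Proof.
move=> s0 x0 xy; have y0 := lt_le_trans x0 xy.
by rewrite !powRN lef_pV2 ?posrE ?powR_gt0// ge0_ler_powR// nnegrE ltW.
Qed.

Lemma ler_powR_exp x s t : 0 < x -> x <= 1 -> s <= t -> x `^ t <= x `^ s.
Proof. by move=> x0 x1 st; apply: ger_powR; rewrite ?x0. Qed.

End powers.

(** * Integrability of the weight *)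

Section ball_weight.
Context (R : realType) (n : nat).
Local Notation N := (n.+1%:R : R).
Local Notation lam := (lebesgueCn R n.+1).
Implicit Types (z w : n.+1.-tuple R[i]) (i : 'I_n.+1) (s t r b g : R).

Definition ball_weight s z : R := if sumsq z < 1 then (1 - sumsq z) `^ s else 0.

Lemma ball_weight_ge0 s z : 0 <= ball_weight s z.
Proof. by rewrite /ball_weight; case: ifPn => // _; exact: powR_ge0. Qed.

Lemma measurable_ball_weight s : measurable_fun setT (ball_weight s).
Proof.
by have := @measurable_sumsq R n.+1 => ?; rewrite /ball_weight; meas.
Qed.

Let N0 : 0 < N. Proof. by rewrite ltr0n. Qed.

Lemma exists_large_coord z : 2^-1 < sumsq z -> exists i, (2 * N)^-1 <= nsq (tnth z i).
Proof.
move=> hz; apply: contrapT => /forallNP h; move: hz; apply/negP; rewrite -leNgt.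
apply: (@le_trans _ _ (\sum_(j < n.+1) (2 * N)^-1)).
  by apply: ler_sum => j _; rewrite leNgt; apply/negP => /ltW; exact: h.
by rewrite sumr_const card_ord -[leLHS]mulr_natr invfM -mulrA mulVf ?mulr1//.
Qed.

Lemma nsq_le_sumsq m (z : m.-tuple R[i]) (j : 'I_m) : nsq (tnth z j) <= sumsq z.
Proof. by rewrite /sumsq (bigD1 j)//= lerDl sumr_ge0// => k _; exact: nsq_ge0. Qed.

Local Open Scope ereal_scope.

(** Artificial values 1, -1, i, -i for w_i: every z_i away from 0 has real inner product bounded
    below with one of them, so the slice estimate also controls the weight alone. *)
Let dir (a : 'I_4) : R[i] :=
  [:: Complex 1 0; Complex (-1) 0; Complex 0 1; Complex 0 (-1)]`_a.

Let nsq_dir a : nsq (dir a) = 1%R.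
Proof.
by case: a => -[|[|[|[|//]]]] h; rewrite /dir /nsq/= ?sqrrN !expr1n expr0n/= ?addr0 ?add0r.
Qed.

Let dir_large (u v r : R) : (0 <= r)%R -> (r <= u ^+ 2 + v ^+ 2 <= 1)%R ->
  exists a, (r / 2 <= u * complex.Re (dir a) + v * complex.Im (dir a))%R.
Proof.
move=> r0 /andP[ruv uv1].
have le1 (a b : R) : (a ^+ 2 + b ^+ 2 <= 1)%R -> (`|a| <= 1)%R.
  move=> ab; rewrite -(@ler_pXn2r _ 2) ?nnegrE// expr1n real_normK ?num_real//.
  by rewrite (le_trans _ ab)// lerDl sqr_ge0.
have u1 := le1 _ _ uv1; have v1 : (`|v| <= 1)%R by apply: (le1 _ u); rewrite addrC.
have sqle (a : R) : (`|a| <= 1 -> a ^+ 2 <= `|a|)%R.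
  by move=> a1; rewrite -(real_normK (num_real a)) expr2 ler_piMl.
have [hu|hu] := leP (r / 2)%R `|u|%R.
  have [u0|u0] := leP 0%R u.
    exists (@Ordinal 4 0 isT); rewrite /dir/= mulr1 mulr0 addr0.
    by rewrite ger0_norm in hu.
  exists (@Ordinal 4 1 isT); rewrite /dir/= mulrN1 mulr0 addr0.
  by rewrite ltr0_norm in hu.
have hv : (r / 2 <= `|v|)%R.
  by have := sqle _ u1; have := sqle _ v1; lra.
have [v0|v0] := leP 0%R v.
  exists (@Ordinal 4 2 isT); rewrite /dir/= mulr1 mulr0 add0r.
  by rewrite ger0_norm in hv.
exists (@Ordinal 4 3 isT); rewrite /dir/= mulrN1 mulr0 add0r.
by rewrite ltr0_norm in hv.
Qed.

Let dirw i a : n.+1.-tuple R[i] := [tuple if j == i then dir a else 0%R | j < n.+1].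

Let tnth_dirw i a : tnth (dirw i a) i = dir a.
Proof. by rewrite tnth_mktuple eqxx. Qed.

(** The slice kernel is used with exponent 0 on Im <z, w> and on the distance, so only (1 -
    |z|^2)^(-t) survives. Where |z|^2 > 1/2 some coordinate is large and one of the finitely many
    [F i a] dominates; where |z|^2 <= 1/2 the weight is at most 2^t, and [G], the indicator of the
    closed ball, suffices. *)
Lemma integral_ball_weight s : (-1 < s)%R ->
  \int[lam]_z (ball_weight s z)%:E < +oo.
Proof.
move=> s1; pose t := Num.max 0%R (- s)%R.
have t01 : (0 <= t < 1)%R by rewrite /t le_max lexx/= gt_max ltr01/= ltrNl.
have /andP[t0 t1] := t01.
pose r := ((2 * N)^-1 / 2)%R.
have r0 : (0 < r)%R by rewrite divr_gt0// invr_gt0 mulr_gt0.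
have z01 : (0 <= (0 : R) < 1)%R by rewrite lexx ltr01.
have [C [C0 hC]] := integral_slice_kernel n t01 z01 r0.
have [D [D0 hD]] := integral_dist_kernel n.+1 z01.
pose F i a := slice_kernel t 0 r i 1 0 (dirw i a).
pose G : n.+1.-tuple R[i] -> \bar R := dist_kernel 1 0 [tuple of nseq n.+1 0%R].
have F0 i a z : 0 <= F i a z by exact: slice_kernel_ge0.
have mF i a : measurable_fun setT (F i a) by exact: measurable_slice_kernel.
have G0 z : 0 <= G z by exact: dist_kernel_ge0.
have mG : measurable_fun setT G by exact: measurable_dist_kernel.
have sF0 z : 0 <= \sum_(p : 'I_n.+1 * 'I_4) F p.1 p.2 z.
  by apply: sume_ge0 => p _; exact: F0.
have hF i a : \int[lam]_z F i a z <= C%:E.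
  have := hC i 1%R 0%R (dirw i a).
  by rewrite tnth_dirw nsq_dir mulr0 subrr powRr0 mulr1; apply.
have hG : \int[lam]_z G z <= D%:E.
  have := hD 1%R 0%R [tuple of nseq n.+1 0%R].
  by rewrite mulr0 subrr powRr0 mulr1; apply.
pose K := (2 `^ t)%R.
have K1 : (1 <= K)%R by rewrite -(powRr0 2) ler_powR// ler1n.
have wle z : (sumsq z < 1)%R -> (ball_weight s z <= (1 - sumsq z) `^ (- t))%R.
  move=> z1; rewrite /ball_weight z1; apply: ler_powR_exp.
  - by rewrite subr_gt0.
  - by rewrite gerBl sumsq_ge0.
  - by rewrite lerNl /t le_max lexx orbT.
have hw z : (ball_weight s z)%:E <=
    K%:E * (G z + \sum_(p : 'I_n.+1 * 'I_4) F p.1 p.2 z).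
  have [z1|z1] := ltP (sumsq z) 1%R; last first.
    rewrite /ball_weight ltNge z1/= mule_ge0 ?adde_ge0//.
    by rewrite lee_fin (le_trans ler01).
  have [z2|z2] := leP (sumsq z) (2^-1)%R.
    apply: (@le_trans _ _ (K%:E * 1)); last first.
      rewrite lee_wpmul2l//; first by rewrite lee_fin (le_trans ler01).
      rewrite /G /dist_kernel (ltW z1) oppr0 powRr0.
      by rewrite leeDl.
    rewrite mule1 lee_fin (le_trans (wle _ z1))// /K.
    rewrite -[X in (_ <= X `^ _)%R]invrK -powR_inv1 ?invr_ge0// -powRrM mulN1r.
    by apply: ler_powRN; rewrite ?invr_gt0//; lra.
  have [i hi] := exists_large_coord z2.
  have r'0 : (0 <= (2 * N)^-1)%R by rewrite invr_ge0 mulr_ge0.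
  have [|a ha] := dir_large r'0 (_ : (2 * N)^-1 <=
      complex.Re (tnth z i) ^+ 2 + complex.Im (tnth z i) ^+ 2 <= 1)%R.
    by rewrite hi/= (le_trans (nsq_le_sumsq z i))// ltW.
  apply: (@le_trans _ _ (1%:E * F i a z)); last first.
    rewrite lee_pmul// (le_trans _ (leeDr _ _))//.
    by rewrite (bigD1 (i, a))//= leeDl// sume_ge0.
  rewrite mul1e /F /slice_kernel (ltW z1) oppr0 powRr0 mule1 /planar_kernel/=.
  rewrite tnth_dirw -/(nsq (tnth z i)) ifT; last first.
    apply/and3P; split=> //; first by rewrite (le_trans (nsq_le_sumsq z i))// ltW.
    by rewrite ltrBrDr addrC subrK.
  rewrite (_ : 1 - (sumsq z - nsq (tnth z i)) - nsq (tnth z i) = 1 - sumsq z)%R;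
    last by ring.
  rewrite -[leLHS]mule1; apply: lee_pmul => //; rewrite ?lee_fin ?ball_weight_ge0 ?wle//.
  rewrite /sing; case: ifPn; rewrite ?leey// => _.
  by rewrite oppr0 powRr0.
apply: (@le_lt_trans _ _ (K%:E * (D%:E + \sum_(p : 'I_n.+1 * 'I_4) C%:E))).
  apply: ge0_integral_leZ hw _.
  - exact: lt_le_trans K1.
  - by move=> z; rewrite adde_ge0.
  - by move=> z; rewrite lee_fin ball_weight_ge0.
  - rewrite ge0_integralD//; last by apply: emeasurable_sum => p; exact: mF.
    rewrite leeD// ge0_integral_sum//.
    by apply: lee_sum => p _; exact: hF.
by rewrite sumEFin -EFinD -EFinM ltry.
Qed.

End ball_weight.

(** * Domination of the kernel and its double integral *)

Section double_integral.
Context (R : realType) (n : nat).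
Local Notation N := (n.+1%:R : R).
Local Notation lam := (lebesgueCn R n.+1).
Implicit Types (z w : n.+1.-tuple R[i]) (i : 'I_n.+1) (s t r b g c a : R).

Let N0 : 0 < N. Proof. by rewrite ltr0n. Qed.

Lemma Re_1inner_ge z w : sumsq z < 1 -> sumsq w < 1 -> [/\
  (1 - sumsq z) / 2 <= complex.Re (1 - inner z w),
  0 < complex.Re (1 - inner z w) &
  (1 - sumsq w + distsq z w) / 2 <= complex.Re (1 - inner z w)].
Proof.
move=> z1 w1; rewrite Re_1inner; have := distsq_ge0 z w.
by move: (distsq z w) (sumsq z) (sumsq w) z1 w1 => ? ? ? *; split; lra.
Qed.

Lemma normc_1inner_gt0 z w : sumsq z < 1 -> sumsq w < 1 ->
  0 < Normc.normc (1 - inner z w).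
Proof.
move=> z1 w1; have [_ h _] := Re_1inner_ge z1 w1.
by apply: lt_le_trans (Re_le_normc _); rewrite gtr0_norm.
Qed.

(** Only boundedness of |u| matters: it allows the exponent [c] to be raised to [t * S] at the price
    of a constant. The value 5 is crude. *)
Lemma normc_1inner_le z w : sumsq z < 1 -> sumsq w < 1 ->
  Normc.normc (1 - inner z w) <= 5.
Proof.
move=> z1 w1; set u := 1 - inner z w.
have h1 : distsq z w <= 2 * (sumsq z + sumsq w).
  rewrite /distsq /sumsq -big_split mulr_sumr/=; apply: ler_sum => j _.
  rewrite nsqB /nsq -subr_ge0.
  set x := complex.Re _; set y := complex.Im _; set x' := complex.Re _; set y' := complex.Im _.
  have -> : 2 * (x ^+ 2 + y ^+ 2 + (x' ^+ 2 + y' ^+ 2)) -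
    ((x - x') ^+ 2 + (y - y') ^+ 2) = (x + x') ^+ 2 + (y + y') ^+ 2 by ring.
  by rewrite addr_ge0 ?sqr_ge0.
have h2 : `|complex.Im u| <= sumsq z + sumsq w.
  rewrite Im_1inner normrN Im_inner (le_trans (ler_norm_sum _ _ _))//.
  rewrite /sumsq -big_split/=; apply: ler_sum => j _; rewrite /nsq ler_norml.
  set x := complex.Re _; set y := complex.Im _; set x' := complex.Re _; set y' := complex.Im _.
  have := sqr_ge0 (x - y'); have := sqr_ge0 (x + y').
  have := sqr_ge0 (y - x'); have := sqr_ge0 (y + x').
  by move=> ? ? ? ?; apply/andP; split; nra.
have h3 : Normc.normc u <= `|complex.Re u| + `|complex.Im u|.
  rewrite normc_nsq -(@ler_pXn2r _ 2) ?nnegrE ?sqrtr_ge0 ?addr_ge0//.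
  rewrite sqr_sqrtr ?nsq_ge0// sqrrD !real_normK ?num_real// /nsq.
  by rewrite addrAC lerDl mulrn_wge0// mulr_ge0.
have [_ h4 _] := Re_1inner_ge z1 w1.
rewrite (le_trans h3)// gtr0_norm// Re_1inner.
by move: h1 h2 z1 w1 (sumsq_ge0 z) (sumsq_ge0 w); lra.
Qed.

Lemma measurable_normc_1inner d (T : measurableType d)
    (f h : T -> n.+1.-tuple R[i]) :
  measurable_fun setT f -> measurable_fun setT h ->
  measurable_fun setT (fun x => complex.Re (1 - inner (f x) (h x))) /\
  measurable_fun setT (fun x => complex.Im (1 - inner (f x) (h x))).
Proof.
move=> mf mh.
have mt (k : T -> n.+1.-tuple R[i]) j : measurable_fun setT k ->
    measurable_fun setT (fun x => tnth (k x) j).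
  by move=> mk; exact: (measurableT_comp (@measurable_tnth _ _ _ j) mk).
split.
  rewrite (_ : (fun x => _) = fun x => 1 - \sum_(j < n.+1)
    (complex.Re (tnth (f x) j) * complex.Re (tnth (h x) j) +
     complex.Im (tnth (f x) j) * complex.Im (tnth (h x) j))); last first.
    by apply/funext => x; rewrite ReB Re_inner.
  apply: measurable_funB; first exact: measurable_cst.
  apply: measurable_sum => j.
  have := measurable_ReC (mt f j mf); have := measurable_ImC (mt f j mf).
  have := measurable_ReC (mt h j mh); have := measurable_ImC (mt h j mh).
  by move=> ? ? ? ?; meas.
rewrite (_ : (fun x => _) = fun x => - \sum_(j < n.+1)
    (complex.Im (tnth (f x) j) * complex.Re (tnth (h x) j) -
     complex.Re (tnth (f x) j) * complex.Im (tnth (h x) j))); last first.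
  by apply/funext => x; rewrite Im_1inner Im_inner.
apply: measurable_funN; apply: measurable_sum => j.
have := measurable_ReC (mt f j mf); have := measurable_ImC (mt f j mf).
have := measurable_ReC (mt h j mh); have := measurable_ImC (mt h j mh).
by move=> ? ? ? ?; meas.
Qed.

Definition abs_kernel c z w : R := Normc.normc (1 - inner z w) `^ (- c).

Lemma abs_kernel_ge0 c z w : 0 <= abs_kernel c z w.
Proof. exact: powR_ge0. Qed.

Lemma measurable_abs_kernel c d (T : measurableType d)
    (f h : T -> n.+1.-tuple R[i]) :
  measurable_fun setT f -> measurable_fun setT h ->
  measurable_fun setT (fun x => abs_kernel c (f x) (h x)).
Proof.
move=> mf mh; have [m1 m2] := measurable_normc_1inner mf mh.
apply: measurable_powRl; rewrite (_ : (fun x => _) = fun x => Num.sqrt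
   (complex.Re (1 - inner (f x) (h x)) ^+ 2 + complex.Im (1 - inner (f x) (h x)) ^+ 2)).
  apply: measurableT_comp; first exact: (continuous_measurable_fun (@sqrt_continuous R)).
  by meas.
by apply/funext => x; rewrite normc_nsq.
Qed.

(** The exponent t (N + 2 (1 + a)) is c + t + g, and |u| is bounded below differently in each share:
    by (1 - |z|^2) / 2 for [c], merging with the weight into exponent - s; by |Im u| for [t]; by
    half of 1 - |w|^2 plus the distance in the other coordinates for [g]. As t < 1, also s < 1. *)
Let abs_kernel_le_slice a t z w i (s := Num.max 0 (t * (1 + a) - a))
    (c := t * (1 + a)) (g := n%:R * t + t * (1 + a)) :
  -1 < a -> 0 < t -> t < 1 -> sumsq z < 1 -> sumsq w < 1 ->
  (8 * N)^-1 <= complex.Re (tnth z i) * complex.Re (tnth w i) +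
            complex.Im (tnth z i) * complex.Im (tnth w i) ->
  ((ball_weight a z * abs_kernel (t * (N + 2 * (1 + a))) z w)%:E <=
   (2 `^ c * 2 `^ g)%:E *
     slice_kernel s t (8 * N)^-1 i (1 - sumsq w) g w z)%E.
Proof.
move=> a1 t0 t1 z1 w1 hr.
have [u1 u0 u2] := Re_1inner_ge z1 w1.
have a10 : 0 < 1 + a by lra.
have c0 : 0 < c by rewrite mulr_gt0.
have g0 : 0 < g by rewrite ltr_wpDl// ?mulr_ge0// ltW.
have z0 : 0 < 1 - sumsq z by rewrite subr_gt0.
have w0 : 0 < 1 - sumsq w by rewrite subr_gt0.
have n0 := normc_1inner_gt0 z1 w1.
have nRe : complex.Re (1 - inner z w) <= Normc.normc (1 - inner z w).
  by rewrite -{1}(gtr0_norm u0) Re_le_normc.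
rewrite /slice_kernel (ltW z1) /planar_kernel/= ifT; last first.
  apply/and3P; split=> //.
    by rewrite (le_trans (nsq_le_sumsq z i))// ltW.
  by rewrite -subr_gt0 (_ : _ - _ = 1 - sumsq z)//; rewrite /nsq; ring.
rewrite (_ : 1 - (sumsq z - nsq (tnth z i)) - (complex.Re (tnth z i) ^+ 2 +
   complex.Im (tnth z i) ^+ 2) = 1 - sumsq z); last by rewrite /nsq; ring.
rewrite subrK.
set E := distsq z w - nsq (tnth z i - tnth w i).
have E0 : 0 <= E.
  rewrite /E /distsq (bigD1 i)//= addrAC subrr add0r.
  by apply: sumr_ge0 => j _; exact: nsq_ge0.
have Ed : E <= distsq z w by rewrite gerBl nsq_ge0.
(* When Im <z, w> = 0 the right-hand side is +oo. *)
rewrite /sing; case: ifPn => [_|I0].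
  rewrite gt0_muley ?lte_fin ?powR_gt0// gt0_mulye ?lte_fin ?powR_gt0//; last first.
    by rewrite ltr_pwDl.
  by rewrite gt0_muley ?leey// lte_fin mulr_gt0 ?powR_gt0.
rewrite -!EFinM lee_fin /ball_weight z1 /abs_kernel.
have -> : - (t * (N + 2 * (1 + a))) = (- c) + ((- t) + (- g)).
  by rewrite /c /g -natr1; ring.
rewrite powRD; last by rewrite (gt_eqF n0) implybT.
rewrite powRD; last by rewrite (gt_eqF n0) implybT.
set U := Normc.normc (1 - inner z w).
have hc : (1 - sumsq z) `^ a * U `^ (- c) <= 2 `^ c * (1 - sumsq z) `^ (- s).
  apply: (@le_trans _ _ ((1 - sumsq z) `^ a * (2 `^ c * (1 - sumsq z) `^ (- c)))).
    rewrite ler_wpM2l ?powR_ge0//.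
    have -> : 2 `^ c * (1 - sumsq z) `^ (- c) = ((1 - sumsq z) / 2) `^ (- c).
      rewrite powRM ?invr_ge0 ?(ltW z0)// mulrC; congr (_ * _).
      by rewrite -[in RHS]powR_inv1// -powRrM mulrNN mul1r.
    by apply: ler_powRN; rewrite ?(ltW c0) ?divr_gt0// (le_trans u1).
  rewrite mulrCA ler_wpM2l ?powR_ge0// -powRD; last by rewrite (gt_eqF z0) implybT.
  apply: ler_powR_exp => //; first by rewrite gerBl sumsq_ge0.
  by rewrite lerNl opprD opprK addrC le_max lexx orbT.
have ht : U `^ (- t) <= `|complex.Im (inner z w)| `^ (- t).
  apply: ler_powRN; rewrite ?(ltW t0) ?normr_gt0//.
  by rewrite -normrN -Im_1inner Im_le_normc.
have hg : U `^ (- g) <= 2 `^ g * (1 - sumsq w + E) `^ (- g).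
  have wE : 0 < 1 - sumsq w + E by rewrite ltr_pwDl.
  have -> : 2 `^ g * (1 - sumsq w + E) `^ (- g) = ((1 - sumsq w + E) / 2) `^ (- g).
    rewrite powRM ?invr_ge0 ?(ltW wE)// mulrC; congr (_ * _).
    by rewrite -[in RHS]powR_inv1// -powRrM mulrNN mul1r.
  apply: ler_powRN; rewrite ?(ltW g0) ?divr_gt0//.
  by rewrite (le_trans _ nRe)// (le_trans _ u2)// ler_pM2r// lerD2l.
rewrite [leLHS]mulrA.
apply: le_trans (ler_pM _ _ hc (ler_pM _ _ ht hg)) _; rewrite ?mulr_ge0 ?powR_ge0//.
by rewrite le_eqVlt; apply/orP; left; apply/eqP; ring.
Qed.

(** Put rho = 1 / (8 N). If |u| < rho, then |z|^2 > 1/2, so some |z_i|^2 >= 4 rho, while |z_i -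
    w_i|^2 <= 2 Re u < 2 rho. Polarization gives Re (z_i conj w_i) >= (4 rho - 2 rho) / 2 = rho. *)
Lemma exists_close_coord z w : sumsq z < 1 -> sumsq w < 1 ->
  Normc.normc (1 - inner z w) < (8 * N)^-1 ->
  exists i, (8 * N)^-1 <= complex.Re (tnth z i) * complex.Re (tnth w i) +
            complex.Im (tnth z i) * complex.Im (tnth w i).
Proof.
move=> z1 w1 hu.
have [u1 u0 u2] := Re_1inner_ge z1 w1.
have nRe : complex.Re (1 - inner z w) < (8 * N)^-1.
  by apply: le_lt_trans hu; rewrite -{1}(gtr0_norm u0) Re_le_normc.
have N1 : (8 * N)^-1 <= 8^-1.
  by rewrite lef_pV2 ?posrE ?mulr_gt0// ler_peMr// ler1n.
have [i hi] : exists i, (2 * N)^-1 <= nsq (tnth z i).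
  apply: exists_large_coord.
  have : (1 - sumsq z) / 2 < 8^-1.
    by rewrite (le_lt_trans u1)// (lt_le_trans nRe).
  by move: (sumsq z) => x; lra.
exists i.
have e1 : (2 * N)^-1 = 4 * (8 * N)^-1 by field; rewrite gt_eqF.
have h1 : nsq (tnth z i - tnth w i) <= distsq z w.
  by rewrite /distsq (bigD1 i)//= lerDl sumr_ge0// => j _; exact: nsq_ge0.
have h2 := nsq_ge0 (tnth w i).
move: hi h1 h2; rewrite nsqB /nsq e1; move: (8 * N)^-1 nRe u2 => r nRe u2.
move: (distsq z w) (complex.Re (1 - inner z w)) nRe u2 => d U nRe u2.
by nra.
Qed.

(** Pairs with |u| >= 1 / (8 N) contribute a constant; the others are covered by the slices at all
    indices. The inner integral is thus at most a constant plus a multiple of (1 - |w|^2)^(-t (1 +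
    a)). *)
Lemma integral_abs_kernel a t : -1 < a -> 0 < t -> t < 1 ->
  (\int[lam]_w ((ball_weight a w)%:E * \int[lam]_z
     (ball_weight a z * abs_kernel (t * (N + 2 * (1 + a))) z w)%:E) < +oo)%E.
Proof.
move=> a1 t0 t1.
set c0 := t * (N + 2 * (1 + a)).
pose s := Num.max 0 (t * (1 + a) - a).
pose c := t * (1 + a); pose g := n%:R * t + t * (1 + a).
have a10 : 0 < 1 + a by lra.
have c00 : 0 <= c0 by rewrite mulr_ge0 ?addr_ge0// ?mulr_ge0// ltW.
have r0 : 0 < (8 * N)^-1 by rewrite invr_gt0 mulr_gt0.
have s01 : 0 <= s < 1.
  rewrite /s le_max lexx/= gt_max ltr01/=.
  have : t * (1 + a) < 1 * (1 + a) by rewrite ltr_pM2r.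
  by rewrite mul1r; lra.
have t01 : 0 <= t < 1 by rewrite (ltW t0).
have [C [C0 hC]] := integral_slice_kernel n s01 t01 r0.
pose K := (8 * N)^-1 `^ (- c0); have K0 : 0 < K by rewrite powR_gt0.
pose L := 2 `^ c * 2 `^ g; have L0 : 0 < L by rewrite mulr_gt0 ?powR_gt0.
have ib (r : R) : -1 < r -> (\int[lam]_z (ball_weight r z)%:E)%E \is a fin_num.
  move=> r1; rewrite ge0_fin_numE ?integral_ball_weight//.
  by apply: integral_ge0 => z _; rewrite lee_fin ball_weight_ge0.
pose W := fine (\int[lam]_z (ball_weight a z)%:E)%E.
have hW : (\int[lam]_z (ball_weight a z)%:E)%E = W%:E by rewrite fineK ?ib.
have W0 : 0 <= W.
  by apply/fine_ge0/integral_ge0 => z _; rewrite lee_fin ball_weight_ge0.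
have mb r : measurable_fun setT (fun z => (ball_weight r z)%:E).
  by apply/measurable_EFinP; exact: measurable_ball_weight.
have inner_le w : sumsq w < 1 ->
    (\int[lam]_z (ball_weight a z * abs_kernel c0 z w)%:E <=
     (K * W + L * N * (C * (1 - sumsq w) `^ (- c)))%:E)%E.
  move=> w1.
  pose G i := slice_kernel s t (8 * N)^-1 i (1 - sumsq w) g w.
  have G0 i z : (0 <= G i z)%E by exact: slice_kernel_ge0.
  have mG i : measurable_fun setT (G i) by exact: measurable_slice_kernel.
  have mSG : measurable_fun setT (fun z => \sum_(i < n.+1) G i z)%E.
    by apply: emeasurable_sum => i; exact: mG.
  have sG0 z : (0 <= \sum_(i < n.+1) G i z)%E by apply: sume_ge0 => i _; exact: G0.
  apply: (@le_trans _ _ (\int[lam]_z (K%:E * (ball_weight a z)%:E +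
      L%:E * \sum_(i < n.+1) G i z))%E).
    apply: ge0_le_integralT => z.
      by rewrite lee_fin mulr_ge0 ?ball_weight_ge0 ?abs_kernel_ge0.
    have KW0 : (0 <= K%:E * (ball_weight a z)%:E)%E.
      by rewrite mule_ge0// lee_fin ?(ltW K0) ?ball_weight_ge0.
    have LG0 : (0 <= L%:E * \sum_(i < n.+1) G i z)%E.
      by rewrite mule_ge0// lee_fin ltW.
    have [z1|z1] := ltP (sumsq z) 1; last first.
      by rewrite {1}/ball_weight ltNge z1/= mul0r adde_ge0.
    have [hu|hu] := leP (8 * N)^-1 (Normc.normc (1 - inner z w)).
      rewrite (le_trans _ (leeDl _ _))// -EFinM lee_fin mulrC.
      by rewrite ler_wpM2r ?ball_weight_ge0// ler_powRN.
    have [i hi] := exists_close_coord z1 w1 hu.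
    rewrite (le_trans _ (leeDr _ _))//.
    apply: le_trans (abs_kernel_le_slice a1 t0 t1 z1 w1 hi) _.
    rewrite lee_wpmul2l ?lee_fin ?(ltW L0)// (bigD1 i)//= leeDl//.
    by apply: sume_ge0 => j _; exact: G0.
  rewrite ge0_integralD//; last 4 first.
  - by move=> z _; rewrite mule_ge0// lee_fin ?(ltW K0) ?ball_weight_ge0.
  - by apply: emeasurable_funM => //; exact: measurable_cst.
  - by move=> z _; rewrite mule_ge0// lee_fin ltW.
  - by apply: emeasurable_funM => //; exact: measurable_cst.
  rewrite EFinD leeD//.
    rewrite ge0_integralZl//; last 2 first.
    - by move=> z _; rewrite lee_fin ball_weight_ge0.
    - by rewrite lee_fin ltW.
    by rewrite hW EFinM.
  rewrite -mulrA (EFinM L) ge0_integralZl//; last by rewrite lee_fin ltW.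
  rewrite lee_wpmul2l ?lee_fin ?(ltW L0)// ge0_integral_sum//.
  have hG i : (\int[lam]_z G i z <= (C * (1 - sumsq w) `^ (- c))%:E)%E.
    have -> : - c = n%:R * t - g by rewrite /g /c; ring.
    apply: hC.
    - by rewrite (le_trans (nsq_le_sumsq w i))// ltW.
    - by rewrite subr_gt0.
    - by rewrite lerDl mulr_ge0// ltW.
  apply: le_trans (lee_sum _ (fun i _ => hG i)) _.
  by rewrite sumEFin sumr_const card_ord -[X in (X%:E <= _)%E]mulr_natl.
pose V := fine (\int[lam]_z (ball_weight (a - c) z)%:E)%E.
(* What is left in [w] has exponent a - t (1 + a), and 1 + a - t (1 + a) > 0 because t < 1. *)
have ac1 : -1 < a - c.
  have : t * (1 + a) < 1 * (1 + a) by rewrite ltr_pM2r.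
  by rewrite /c mul1r; lra.
have hV : (\int[lam]_z (ball_weight (a - c) z)%:E)%E = V%:E by rewrite fineK ?ib.
apply: (@le_lt_trans _ _ (\int[lam]_w ((K * W)%:E * (ball_weight a w)%:E +
   (L * N * C)%:E * (ball_weight (a - c) w)%:E))%E).
  apply: ge0_le_integralT => w.
    rewrite mule_ge0 ?lee_fin ?ball_weight_ge0//; apply: integral_ge0 => z _.
    by rewrite lee_fin mulr_ge0 ?ball_weight_ge0 ?abs_kernel_ge0.
  have [w1|w1] := ltP (sumsq w) 1; last first.
    by rewrite /ball_weight ltNge w1/= !(mul0e, mule0) adde0.
  apply: (@le_trans _ _ ((ball_weight a w)%:E *
      (K * W + L * N * (C * (1 - sumsq w) `^ (- c)))%:E)%E).
    by rewrite lee_wpmul2l ?inner_le// lee_fin ball_weight_ge0.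
  rewrite -!EFinM -EFinD lee_fin /ball_weight w1.
  have w0 : 0 < 1 - sumsq w by rewrite subr_gt0.
  rewrite powRD; last by rewrite (gt_eqF w0) implybT.
  by rewrite le_eqVlt; apply/orP; left; apply/eqP; ring.
rewrite ge0_integralD//; last 4 first.
- by move=> z _; rewrite mule_ge0// lee_fin ?mulr_ge0 ?(ltW K0) ?ball_weight_ge0.
- by apply: emeasurable_funM => //; exact: measurable_cst.
- by move=> z _; rewrite mule_ge0// lee_fin ?ball_weight_ge0// !mulr_ge0// ltW.
- by apply: emeasurable_funM => //; exact: measurable_cst.
rewrite !ge0_integralZl//; last 4 first.
- by move=> z _; rewrite lee_fin ball_weight_ge0.
- by rewrite lee_fin !mulr_ge0// ltW.
- by move=> z _; rewrite lee_fin ball_weight_ge0.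
- by rewrite lee_fin mulr_ge0// ltW.
by rewrite hW hV -!EFinM -EFinD ltry.
Qed.

End double_integral.

(** * Passage from Lebesgue measure to [weighted_measure] *)

Section weighted_integral.
Context (R : realType) (n : nat) (alpha : R).
Local Notation lam := (lebesgueCn R n.+1).
Local Notation v := (@weighted_measure R n.+1 alpha).
Local Notation B := (@unit_ball R n.+1).

(** Collects both normalizations, so that v_alpha has density [total_const * ball_weight alpha] for
    Lebesgue measure. Upper bounds use only that it is nonnegative; positivity matters for the lower
    bounds on cells. *)
Definition total_const : R :=
  (fine (lam B))^-1 * weight_const n.+1 alpha.

Lemma total_const_ge0 : 0 <= total_const.
Proof.
by rewrite mulr_ge0 ?invr_ge0 ?fine_ge0// divr_ge0 ?mulr_ge0 ?Gamma_ge0.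
Qed.

Let density_ge0 (z : n.+1.-tuple R[i]) : 0 <= total_const * ball_weight alpha z.
Proof. by rewrite mulr_ge0 ?total_const_ge0 ?ball_weight_ge0. Qed.

Lemma integral_weighted (f : n.+1.-tuple R[i] -> \bar R) :
  measurable_fun setT f -> (forall z, (0 <= f z)%E) ->
  (\int[v]_z f z =
   \int[lam]_z (f z * (total_const * ball_weight alpha z)%:E))%E.
Proof.
move=> mf f0; pose k : R := (fine (lam B))^-1.
have k0 : 0 <= k by rewrite invr_ge0 fine_ge0.
have mb : measurable_fun setT (fun z => k * \1_B z : R).
  apply: measurable_funM; first exact: measurable_cst.
  by apply: measurable_indic; exact: measurable_unit_ball.
have mB : measurable_fun setT (fun z => (\1_B z : R)%:E).
  by apply/measurable_EFinP/measurable_indic; exact: measurable_unit_ball.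
rewrite (integral_density (mu := ball_measure R n.+1) (nu := v)
  (phi := @weight R n.+1 alpha))//; last 2 first.
- exact: measurable_weight.
- exact: weight_ge0.
rewrite (integral_density (mu := lam) (phi := fun z => k * \1_B z))//; last 4 first.
- by move=> z; rewrite mulr_ge0.
- move=> A mA; under eq_integral do rewrite EFinM.
  rewrite ge0_integralZl//; last exact: measurable_funTS.
  rewrite integral_indic//; last exact: measurable_unit_ball.
  by rewrite setIC.
- by apply: emeasurable_funM => //; apply/measurable_EFinP; exact: measurable_weight.
- by move=> z; rewrite mule_ge0// lee_fin weight_ge0.
apply: eq_integral => z _; rewrite -muleA -EFinM; congr (_ * (_)%:E)%E.
rewrite /weight /ball_weight /total_const -/k sqr_cnorm indicE.
case: ifPn => [z1|z1].
  by rewrite mem_set; [rewrite mulr1; ring|exact/unit_ballE].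
by rewrite memNset ?mulr0//= => /unit_ballE; exact/negP.
Qed.

Lemma weighted_measure_lty : -1 < alpha -> (v setT < +oo)%E.
Proof.
move=> a1; rewrite -[v setT]mul1e -integral_cst// integral_weighted//.
(* [total_const] is only known to be nonnegative here, whereas [ge0_integral_leZ] asks for a
   positive factor. *)
have [C [C0 hC]] : exists C, 0 < C /\ total_const <= C.
  by exists (total_const + 1); split; have := total_const_ge0; lra.
apply: (@le_lt_trans _ _ (C%:E * \int[lam]_z (ball_weight alpha z)%:E)%E).
  apply: (ge0_integral_leZ (g := fun z => (ball_weight alpha z)%:E)) => // z.
  - by rewrite lee_fin ball_weight_ge0.
  - by rewrite mul1e lee_fin density_ge0.
  - by rewrite mul1e -EFinM lee_fin ler_wpM2r ?ball_weight_ge0.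
by rewrite lte_mul_pinfty ?lee_fin ?(ltW C0)// integral_ball_weight.
Qed.

Definition weight_double_integral c : \bar R :=
  (\int[v]_z \int[v]_w (\1_B z * \1_B w * abs_kernel c z w)%:E)%E.

(** <w, z> is the conjugate of <z, w>. The symmetry reconciles the order of the variables here with
    that of [integral_abs_kernel]. *)
Lemma abs_kernelC c (z w : n.+1.-tuple R[i]) : abs_kernel c z w = abs_kernel c w z.
Proof.
congr (_ `^ _); rewrite !normc_nsq; congr (Num.sqrt _).
rewrite /nsq !ReB !ImB !Re_inner !Im_inner.
have -> : \sum_(j < n.+1) (complex.Im (tnth z j) * complex.Re (tnth w j) -
                complex.Re (tnth z j) * complex.Im (tnth w j)) =
  - \sum_(j < n.+1) (complex.Im (tnth w j) * complex.Re (tnth z j) -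
                complex.Re (tnth w j) * complex.Im (tnth z j)).
  by rewrite -sumrN; apply: eq_bigr => j _; ring.
rewrite !sub0r opprK sqrrN; congr ((_ - _) ^+ 2 + _).
by apply: eq_bigr => j _; ring.
Qed.

Lemma measurable_indic_ball_kernel c :
  measurable_fun [set: n.+1.-tuple R[i] * n.+1.-tuple R[i]]
    (fun p => (\1_B p.1 * \1_B p.2 * abs_kernel c p.1 p.2)).
Proof.
have mI : measurable_fun setT (\1_B : _ -> R).
  by apply: measurable_indic; exact: measurable_unit_ball.
apply: measurable_funM; last exact: measurable_abs_kernel.
apply: measurable_funM.
  exact: (measurableT_comp mI measurable_fst).
exact: (measurableT_comp mI measurable_snd).
Qed.

Lemma weight_double_integral_lty c : -1 < alpha ->
  c < n.+1%:R + 2 * (1 + alpha) -> (weight_double_integral c < +oo)%E.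
Proof.
move=> a1 hc.
have S0 : 0 < n.+1%:R + 2 * (1 + alpha) :> R by rewrite addr_gt0// mulr_gt0//; lra.
set S := n.+1%:R + 2 * (1 + alpha) in hc S0 *.
(* The midpoint of max(0, c / S) and 1 lies strictly between 0 and 1 and satisfies c <= t S, also
   when c is negative. *)
pose t := (Num.max 0 (c / S) + 1) / 2.
have cS1 : c / S < 1 by rewrite ltr_pdivrMr// mul1r.
have mx1 : Num.max 0 (c / S) < 1 by rewrite gt_max ltr01.
have mx0 : 0 <= Num.max 0 (c / S) by rewrite le_max lexx.
have t0 : 0 < t by rewrite /t; lra.
have t1 : t < 1 by rewrite /t; lra.
have ct : c <= t * S.
  rewrite -ler_pdivrMr//.
  have : c / S <= Num.max 0 (c / S) by rewrite le_max lexx orbT.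
  by rewrite /t; lra.
have := integral_abs_kernel n a1 t0 t1; rewrite -/S.
set I := (\int[lam]_w _)%E => Ioo.
pose K : R := 5 `^ (t * S - c); have K0 : 0 < K by rewrite powR_gt0.
have [C [C0 hC]] : exists C, 0 < C /\ total_const <= C.
  by exists (total_const + 1); split; have := total_const_ge0; lra.
have mk z : measurable_fun setT (fun w => (\1_B z * \1_B w * abs_kernel c z w)%:E).
  apply/measurable_EFinP.
  exact: (measurableT_comp (measurable_indic_ball_kernel c) (pair1_measurable z)).
have k0 z w : 0 <= \1_B z * \1_B w * abs_kernel c z w.
  by rewrite !mulr_ge0 ?abs_kernel_ge0.
have hI z : (\int[v]_w (\1_B z * \1_B w * abs_kernel c z w)%:E =
    \int[lam]_w ((\1_B z * \1_B w * abs_kernel c z w)%:E *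
      (total_const * ball_weight alpha w)%:E))%E.
  by rewrite integral_weighted// => w; rewrite lee_fin.
rewrite /weight_double_integral integral_weighted; last 2 first.
- rewrite (funext hI).
  apply: (measurable_fun_fubini_tonelli_F (m2 := lam) (fun p =>
    ((\1_B p.1 * \1_B p.2 * abs_kernel c p.1 p.2)%:E *
      (total_const * ball_weight alpha p.2)%:E)%E)) => //.
  + apply: emeasurable_funM; apply/measurable_EFinP.
      exact: measurable_indic_ball_kernel.
    apply: measurable_funM; first exact: measurable_cst.
    by apply: (measurableT_comp (measurable_ball_weight _)); exact: measurable_snd.
  + by move=> p; rewrite mule_ge0 ?lee_fin ?k0 ?density_ge0.
- by move=> z; apply: integral_ge0 => w _; rewrite lee_fin.
apply: (@le_lt_trans _ _ ((C * C * K)%:E * I)%E); last first.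
  by rewrite lte_mul_pinfty ?lee_fin// ltW// !mulr_gt0.
apply: (ge0_integral_leZ (g := fun w => ((ball_weight alpha w)%:E *
    \int[lam]_z (ball_weight alpha z * abs_kernel (t * S) z w)%:E)%E)) => //.
- by rewrite !mulr_gt0.
- move=> z; rewrite mule_ge0 ?lee_fin ?ball_weight_ge0//.
  by apply: integral_ge0 => w _; rewrite lee_fin mulr_ge0 ?ball_weight_ge0 ?abs_kernel_ge0.
- move=> z; rewrite mule_ge0 ?lee_fin ?density_ge0//.
  by apply: integral_ge0 => w _; rewrite lee_fin.
move=> z; rewrite hI.
rewrite [X in (X <= _)%E]muleC (_ : (C * C * K)%:E = C%:E * (C * K)%:E)%E; last first.
  by rewrite -EFinM mulrA.
rewrite [X in (_ <= X)%E]muleACA.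
apply: lee_pmul.
- by rewrite lee_fin ?density_ge0.
- apply: integral_ge0 => w _.
  by rewrite mule_ge0// lee_fin ?k0// density_ge0.
- by rewrite -EFinM lee_fin ler_wpM2r ?ball_weight_ge0.
apply: (ge0_integral_leZ (g := fun w => (ball_weight alpha w * abs_kernel (t * S) w z)%:E)) => //.
- by rewrite mulr_gt0.
- by move=> w; rewrite lee_fin mulr_ge0 ?ball_weight_ge0 ?abs_kernel_ge0.
- by move=> w; rewrite mule_ge0// lee_fin ?k0// density_ge0.
move=> w; rewrite -!EFinM lee_fin !indicE.
case: (boolP (z \in B)) => [/set_mem/unit_ballE z1|_]; last first.
  rewrite !mul0r !mulr_ge0 ?ball_weight_ge0 ?abs_kernel_ge0 ?(ltW K0)//.
  exact: ltW.
case: (boolP (w \in B)) => [/set_mem/unit_ballE w1|_]; last first.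
  rewrite !(mul0r, mulr0) !mulr_ge0 ?ball_weight_ge0 ?abs_kernel_ge0 ?(ltW K0)//.
  exact: ltW.
rewrite mulr1n !mul1r -[leRHS]mulrA.
rewrite [leLHS](_ : _ = total_const * (abs_kernel c z w * ball_weight alpha w));
  last by ring.
apply: ler_pM.
- exact: total_const_ge0.
- by rewrite mulr_ge0 ?ball_weight_ge0 ?abs_kernel_ge0.
- by [].
rewrite [X in _ <= X]mulrCA mulrC ler_wpM2l ?ball_weight_ge0//.
have n0 := normc_1inner_gt0 z1 w1.
rewrite (abs_kernelC _ w z) /abs_kernel.
rewrite (_ : - c = (t * S - c) + (- (t * S))); last by ring.
rewrite powRD; last by rewrite (gt_eqF n0) implybT.
rewrite ler_wpM2r ?powR_ge0// ge0_ler_powR ?subr_ge0// ?nnegrE ?(ltW n0)//.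
exact: normc_1inner_le.
Qed.

End weighted_integral.

(** * The kernel in polar form *)

Section kernel.
Context (R : realType) (n : nat).
Implicit Types (z w : n.+1.-tuple R[i]) (c : R).

Lemma invC (a b : R) : (Complex a b)^-1 =
  Complex (a / (a ^+ 2 + b ^+ 2)) (- b / (a ^+ 2 + b ^+ 2)).
Proof. by rewrite -[LHS]/(Complex _ _) mulNr. Qed.

Lemma inv_cpow (u : R[i]) c : (cpow u c)^-1 =
  Complex (Normc.normc u `^ (- c) * cos (c * atan (complex.Im u / complex.Re u)))
    (- (Normc.normc u `^ (- c) * sin (c * atan (complex.Im u / complex.Re u)))).
Proof.
rewrite /cpow invC; set t := c * _; set r := Normc.normc u `^ c.
rewrite powRN -/r !exprMn -mulrDr cos2Dsin2 mulr1.
have [->|r0] := eqVneq r 0; first by rewrite invr0 !(mul0r, oppr0, mulr0).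
by congr Complex; field.
Qed.

(** The quotient Im u / Re u is written with [powR] and exponent -1, to which [measurable_powRl]
    applies; on the ball Re u > 0 and the two agree. *)
Definition Re_kernel c z w : R := abs_kernel c z w *
  cos (c * atan (complex.Im (1 - inner z w) * complex.Re (1 - inner z w) `^ (- 1))).

Definition Im_kernel c z w : R := - (abs_kernel c z w *
  sin (c * atan (complex.Im (1 - inner z w) * complex.Re (1 - inner z w) `^ (- 1)))).

Lemma inv_cpow_kernel c z w : sumsq z < 1 -> sumsq w < 1 ->
  (cpow (1 - inner z w) c)^-1 = Complex (Re_kernel c z w) (Im_kernel c z w).
Proof.
move=> z1 w1; have [_ u0 _] := Re_1inner_ge z1 w1.
by rewrite inv_cpow /Re_kernel /Im_kernel powR_inv1// ltW.
Qed.

Lemma normc_kernel c z w :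
  Normc.normc (Complex (Re_kernel c z w) (Im_kernel c z w)) = abs_kernel c z w.
Proof.
rewrite normc_nsq /nsq/= /Re_kernel /Im_kernel sqrrN !exprMn -mulrDr cos2Dsin2 mulr1.
by rewrite sqrtr_sqr ger0_norm// abs_kernel_ge0.
Qed.

Let measurable_arg c d (T : measurableType d) (f h : T -> n.+1.-tuple R[i]) :
  measurable_fun setT f -> measurable_fun setT h ->
  measurable_fun setT (fun x => c * atan (complex.Im (1 - inner (f x) (h x)) *
    complex.Re (1 - inner (f x) (h x)) `^ (- 1))).
Proof.
move=> mf mh; have [m1 m2] := measurable_normc_1inner mf mh.
apply: measurable_funM; first exact: measurable_cst.
apply: (measurableT_comp (continuous_measurable_fun (@continuous_atan R))).
by meas.
Qed.

Lemma measurable_Re_kernel c d (T : measurableType d) (f h : T -> n.+1.-tuple R[i]) :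
  measurable_fun setT f -> measurable_fun setT h ->
  measurable_fun setT (fun x => Re_kernel c (f x) (h x)).
Proof.
move=> mf mh; apply: measurable_funM; first exact: measurable_abs_kernel.
apply: (measurableT_comp (continuous_measurable_fun (@continuous_cos R))).
exact: measurable_arg.
Qed.

Lemma measurable_Im_kernel c d (T : measurableType d) (f h : T -> n.+1.-tuple R[i]) :
  measurable_fun setT f -> measurable_fun setT h ->
  measurable_fun setT (fun x => Im_kernel c (f x) (h x)).
Proof.
move=> mf mh; apply: measurable_funN; apply: measurable_funM; first exact: measurable_abs_kernel.
apply: (measurableT_comp (continuous_measurable_fun (@continuous_sin R))).
exact: measurable_arg.
Qed.

End kernel.

(** * Sufficiency: boundedness from L^oo to L^1 *)

Section sufficiency.
Context (R : realType) (n : nat) (alpha : R).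
Local Notation lam := (lebesgueCn R n.+1).
Local Notation v := (@weighted_measure R n.+1 alpha).
Local Notation B := (@unit_ball R n.+1).
Implicit Types (z w : n.+1.-tuple R[i]) (c : R).

(** Measurability in the parameter is taken from Tonelli over the sigma-finite [lebesgueCn], after
    moving the density into the integrand; signs are handled by positive and negative parts. *)
Let measurable_weighted_integral (H : n.+1.-tuple R[i] * n.+1.-tuple R[i] -> R) :
  measurable_fun setT H ->
  measurable_fun setT (fun z => fine (\int[v]_w (H (z, w))%:E)%E).
Proof.
move=> mH.
have mE : measurable_fun setT (fun p => (H p)%:E) by apply/measurable_EFinP.
suff nn (G : n.+1.-tuple R[i] * n.+1.-tuple R[i] -> \bar R) :
    measurable_fun setT G -> (forall p, (0 <= G p)%E) ->
    measurable_fun setT (fun z => \int[v]_w G (z, w))%E.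
  apply: (measurableT_comp (fine_measurable (@measurableT _ _))).
  rewrite (_ : (fun z => _) = (fun z =>
     \int[v]_w ((fun p => (H p)%:E)^\+ (z, w)) -
     \int[v]_w ((fun p => (H p)%:E)^\- (z, w)))%E).
    apply: emeasurable_funB; apply: nn => //.
      exact: measurable_funepos.
    exact: measurable_funeneg.
  by apply/funext => z; rewrite integralE; congr (_ - _)%E;
    apply: eq_integral => w _; rewrite ?funeposE ?funenegE.
move=> mG G0.
rewrite (_ : (fun z => _) = (fun z =>
    \int[lam]_w (G (z, w) * (total_const n alpha * ball_weight alpha w)%:E))%E).
  apply: (measurable_fun_fubini_tonelli_F (m2 := lam) (fun p =>
    (G p * (total_const n alpha * ball_weight alpha p.2)%:E)%E)).
    apply: emeasurable_funM => //; apply/measurable_EFinP.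
    apply: measurable_funM; first exact: measurable_cst.
    by apply: (measurableT_comp (measurable_ball_weight _)); exact: measurable_snd.
  move=> p; rewrite mule_ge0// lee_fin mulr_ge0 ?ball_weight_ge0//.
  exact: total_const_ge0.
apply/funext => z; rewrite integral_weighted//.
exact: (measurableT_comp mG (pair1_measurable z)).
Qed.

Lemma bounded_oo_1 c : -1 < alpha -> c < n.+1%:R + 2 * (1 + alpha) ->
  bounded_Lp_Lq alpha +oo 1 (@Kop R n.+1 alpha c).
Proof.
move=> a1 hc.
have mB := @measurable_unit_ball R n.+1.
have Ifin := weight_double_integral_lty a1 hc.
have I0 : (0 <= weight_double_integral n alpha c)%E.
  apply: integral_ge0 => z _; apply: integral_ge0 => w _.
  by rewrite lee_fin !mulr_ge0 ?abs_kernel_ge0.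
(* The factor 2 pays for estimating the real and imaginary parts of K f separately. *)
exists (2 * fine (weight_double_integral n alpha c)) => f [mf foo].
have mI : measurable_fun setT (\1_B : _ -> R) by exact: measurable_indic.
pose f1 w : R := if w \in B then complex.Re (f w) else 0.
pose f2 w : R := if w \in B then complex.Im (f w) else 0.
have mf1 : measurable_fun setT f1.
  rewrite (_ : f1 = (@complex.Re R \o f) \_ B)//.
  apply/(measurable_restrictT _ _).1 => //.
  exact: (measurableT_comp (@measurable_Re R) mf).
have mf2 : measurable_fun setT f2.
  rewrite (_ : f2 = (@complex.Im R \o f) \_ B)//.
  apply/(measurable_restrictT _ _).1 => //.
  exact: (measurableT_comp (@measurable_Im R) mf).
pose H1 (p : n.+1.-tuple R[i] * n.+1.-tuple R[i]) :=
  \1_B p.1 * (f1 p.2 * Re_kernel c p.1 p.2 - f2 p.2 * Im_kernel c p.1 p.2).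
pose H2 (p : n.+1.-tuple R[i] * n.+1.-tuple R[i]) :=
  \1_B p.1 * (f1 p.2 * Im_kernel c p.1 p.2 + f2 p.2 * Re_kernel c p.1 p.2).
have mI1 : measurable_fun [set: n.+1.-tuple R[i] * n.+1.-tuple R[i]]
    (fun p => \1_B p.1 : R) by exact: (measurableT_comp mI measurable_fst).
have mf1' : measurable_fun [set: n.+1.-tuple R[i] * n.+1.-tuple R[i]]
    (fun p => f1 p.2) by exact: (measurableT_comp mf1 measurable_snd).
have mf2' : measurable_fun [set: n.+1.-tuple R[i] * n.+1.-tuple R[i]]
    (fun p => f2 p.2) by exact: (measurableT_comp mf2 measurable_snd).
have mk1 := measurable_Re_kernel c (@measurable_fst _ _ (n.+1.-tuple R[i]) (n.+1.-tuple R[i])) measurable_snd.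
have mk2 := measurable_Im_kernel c (@measurable_fst _ _ (n.+1.-tuple R[i]) (n.+1.-tuple R[i])) measurable_snd.
have mH1 : measurable_fun setT H1 by rewrite /H1; meas.
have mH2 : measurable_fun setT H2 by rewrite /H2; meas.
have hE z w : B z -> B w -> f w / cpow (1 - inner z w) c =
    Complex (H1 (z, w)) (H2 (z, w)).
  move=> Bz Bw; rewrite inv_cpow_kernel; [|exact/unit_ballE|exact/unit_ballE].
  rewrite /H1 /H2 /f1 /f2/= !indicE !mem_set//= !mul1r.
  by case: (f w).
have H0 z w : ~ B w -> H1 (z, w) = 0 /\ H2 (z, w) = 0.
  by move=> Bw; rewrite /H1 /H2 /f1 /f2/= memNset// !mul0r subrr addr0 mulr0.
have KE z : B z -> Kop alpha c f z =
    Complex (fine (\int[v]_w (H1 (z, w))%:E)%E) (fine (\int[v]_w (H2 (z, w))%:E)%E).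
  move=> Bz; rewrite /Kop /Rintegral; congr (Complex (fine _) (fine _)).
    rewrite integral_mkcond; apply: eq_integral => w _; rewrite patchE.
    case: ifPn => [/set_mem Bw|/negP Bw]; first by rewrite hE.
    by rewrite (H0 z w _).1// => /mem_set.
  rewrite integral_mkcond; apply: eq_integral => w _; rewrite patchE.
  case: ifPn => [/set_mem Bw|/negP Bw]; first by rewrite hE.
  by rewrite (H0 z w _).2// => /mem_set.
have mK : measurable_fun B (Kop alpha c f).
  apply: (eq_measurable_fun (fun z => mkC (fine (\int[v]_w (H1 (z, w))%:E)%E,
     fine (\int[v]_w (H2 (z, w))%:E)%E))).
    by move=> z /set_mem Bz; rewrite KE.
  apply: measurable_funTS; apply: (measurableT_comp (@measurable_mkC R)).
  by apply/measurable_fun_pairP; split; exact: measurable_weighted_integral.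
have fin0 : (0 <= Lpnorm alpha +oo f)%E by exact: Lnorm_ge0.
pose M := fine (Lpnorm alpha +oo f).
have ME : Lpnorm alpha +oo f = M%:E by rewrite fineK// ge0_fin_numE.
have M0 : 0 <= M by exact: fine_ge0.
have aef : \forall w \ae v, Normc.normc (f w) * \1_B w <= M.
  (* If the measure is zero, the L^oo norm is 0 by definition instead of an essential supremum; the
     claim then holds off the null set [setT]. *)
  have [v0|v0] := eqVneq (v setT) 0.
    by exists setT; split=> //.
  move: ME; rewrite /Lpnorm unlock lt0e v0 measure_ge0/= => ME.
  have := @ess_sup_ge _ _ _ v (abse \o (EFin \o (@Normc.normc R \o f) \_ B)).
  apply: filterS => w; rewrite ME /= lee_fin => h.
  apply: le_trans h; rewrite patchE indicE; case: ifPn => _.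
    by rewrite mulr1 ler_norm.
  by rewrite mulr0 normr0.
have Habs z w : `|H1 (z, w)| <= Normc.normc (f w) * (\1_B z * \1_B w * abs_kernel c z w) /\
                `|H2 (z, w)| <= Normc.normc (f w) * (\1_B z * \1_B w * abs_kernel c z w).
  have nn0 : 0 <= Normc.normc (f w) * (\1_B z * \1_B w * abs_kernel c z w).
    by rewrite !mulr_ge0 ?abs_kernel_ge0// normc_nsq sqrtr_ge0.
  have [Bw|Bw] := pselect (B w); last first.
    by have [-> ->] := H0 z w Bw; rewrite normr0.
  have [Bz|Bz] := pselect (B z); last first.
    by rewrite /H1 /H2/= indicE memNset//= !mul0r mulr0 normr0.
  rewrite !indicE !mem_set//= !mul1r -normc_kernel -Normc.normcM.
  rewrite -inv_cpow_kernel; [|exact/unit_ballE|exact/unit_ballE].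
  by rewrite hE//; split; [exact: (Re_le_normc (Complex _ _))|exact: (Im_le_normc (Complex _ _))].
have bnd (H : n.+1.-tuple R[i] * n.+1.-tuple R[i] -> R) z : measurable_fun setT H ->
    (forall w, `|H (z, w)| <= Normc.normc (f w) * (\1_B z * \1_B w * abs_kernel c z w)) ->
    (`|fine (\int[v]_w (H (z, w))%:E)|%:E <=
       M%:E * \int[v]_w (\1_B z * \1_B w * abs_kernel c z w)%:E)%E.
  move=> mH Hle.
  have mHz : measurable_fun setT (fun w => (H (z, w))%:E).
    by apply/measurable_EFinP; exact: (measurableT_comp mH (pair1_measurable z)).
  have mkz : measurable_fun setT (fun w => (\1_B z * \1_B w * abs_kernel c z w)%:E).
    apply/measurable_EFinP.
    exact: (measurableT_comp (measurable_indic_ball_kernel c) (pair1_measurable z)).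
  have kz0 w : (0 <= (\1_B z * \1_B w * abs_kernel c z w)%:E)%E.
    by rewrite lee_fin !mulr_ge0 ?abs_kernel_ge0.
  (* [fine] sends infinite values to 0, so this step holds whether or not the integral is finite. *)
  apply: (@le_trans _ _ (`|\int[v]_w (H (z, w))%:E|)%E).
    by case: (\int[v]_w _)%E => [r||] //=; rewrite ?normr0 ?lee_fin// leey.
  apply: le_trans (le_abse_integral _ _ mHz) _ => //.
  rewrite -ge0_integralZl//.
  apply: ae_ge0_le_integral => //.
  - exact: measurableT_comp.
  - by move=> w _; rewrite mule_ge0.
  - by apply: emeasurable_funM => //; exact: measurable_cst.
  apply: filterS aef => w hw _; rewrite /= lee_fin (le_trans (Hle w))//.
  rewrite !indicE in hw *; case: (w \in B) hw => /=; rewrite ?mulr1 => hw.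
    by rewrite ler_wpM2r// mulr_ge0 ?abs_kernel_ge0.
  by rewrite mulr0 mul0r !mulr0.
have main : (Lpnorm alpha 1 (Kop alpha c f) <=
    (2 * fine (weight_double_integral n alpha c))%:E * Lpnorm alpha +oo f)%E.
  rewrite ME /Lpnorm Lnorm1.
  rewrite EFinM fineK ?ge0_fin_numE// -muleA (muleC (weight_double_integral _ _ _)) muleA -EFinM.
  pose k z := (\int[v]_w (\1_B z * \1_B w * abs_kernel c z w)%:E)%E.
  have k0 z : (0 <= k z)%E.
    by apply: integral_ge0 => w _; rewrite lee_fin !mulr_ge0 ?abs_kernel_ge0.
  have k2 : (\int[v]_z ((2 * M)%:E * k z) <= (2 * M)%:E * \int[v]_z k z)%E.
    by apply: ge0_integralZl_le => //; rewrite mulr_ge0.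
  apply: le_trans k2; apply: ge0_le_integralT => // z /=; rewrite patchE.
  case: ifPn => [/set_mem Bz|_]; last first.
    by rewrite normr0 mule_ge0// lee_fin mulr_ge0.
  rewrite -[(_ \o _) z]/(Normc.normc (Kop alpha c f z)) KE// normc_nsq /nsq/=.
  set x := fine _; set y := fine _.
  have hx := bnd H1 z mH1 (fun w => (Habs z w).1).
  have hy := bnd H2 z mH2 (fun w => (Habs z w).2).
  apply: (@le_trans _ _ (`|x|%:E + `|y|%:E)%E); last first.
    by rewrite mulr2n mulrDl mul1r EFinD ge0_muleDl ?lee_fin// leeD.
  rewrite -EFinD lee_fin (ger0_norm (sqrtr_ge0 _)).
  rewrite -(@ler_pXn2r _ 2) ?nnegrE ?sqrtr_ge0 ?addr_ge0// sqr_sqrtr ?addr_ge0 ?sqr_ge0//.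
  by rewrite sqrrD !real_normK ?num_real// addrAC lerDl mulrn_wge0//.
split=> //; split=> //.
apply: le_lt_trans main _.
by rewrite ME -EFinM ltry.
Qed.

End sufficiency.

(** * Cells on which the kernel is nearly positive *)

Section cells.
Context (R : realType) (n : nat).
Implicit Types (e r h T : R) (a t s : n.-tuple R[i]) (z w : n.+1.-tuple R[i]).

Definition tail z : n.-tuple R[i] := [tuple tnth z (lift ord0 j) | j < n].

Lemma sumsq_tail z : sumsq z = nsq (tnth z ord0) + sumsq (tail z).
Proof.
by rewrite /sumsq big_ord_recl; congr (_ + _); apply: eq_bigr => j _; rewrite tnth_mktuple.
Qed.

Lemma distsq_tail z w :
  distsq z w = nsq (tnth z ord0 - tnth w ord0) + distsq (tail z) (tail w).
Proof.
rewrite /distsq big_ord_recl; congr (_ + _); apply: eq_bigr => j _.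
by rewrite !tnth_mktuple.
Qed.

Lemma Im_inner_tail z w : complex.Im (inner z w) =
  complex.Im (tnth z ord0) * complex.Re (tnth w ord0) -
  complex.Re (tnth z ord0) * complex.Im (tnth w ord0) +
  complex.Im (inner (tail z) (tail w)).
Proof.
rewrite !Im_inner big_ord_recl; congr (_ + _); apply: eq_bigr => j _.
by rewrite !tnth_mktuple.
Qed.

Definition box h a : set (n.-tuple R[i]) := [set t | forall j,
  complex.Re (tnth a j) <= complex.Re (tnth t j) < complex.Re (tnth a j) + h /\
  complex.Im (tnth a j) <= complex.Im (tnth t j) < complex.Im (tnth a j) + h].

(** Keeps the whole box in the cube with real coordinates in [0, e]: tails are small, z_0 carries
    most of the norm, and the coordinates have constant sign. *)
Definition corner e h a := forall j,
  0 <= complex.Re (tnth a j) <= e - h /\ 0 <= complex.Im (tnth a j) <= e - h.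

Let sum_le (F : 'I_n -> R) (b : R) :
  (forall j, `|F j| <= b) -> `|\sum_(j < n) F j| <= n%:R * b.
Proof.
move=> Fb; rewrite (le_trans (ler_norm_sum _ _ _))//.
rewrite (le_trans (ler_sum _ (fun j _ => Fb j)))// sumr_const card_ord.
by rewrite -[leLHS]mulr_natl.
Qed.

(* All the coordinatewise estimates have the form |p u - q v| <= b h with
   |p|, |q| <= b of constant sign and 0 <= u, v <= h. *)
Let normB_le (x y b : R) : 0 <= x <= b -> 0 <= y <= b -> `|x - y| <= b.
Proof. by move=> ? ?; rewrite ler_norml; lra. Qed.

Let mul_le (x y b d : R) : `|x| <= b -> `|y| <= d -> `|x * y| <= b * d.
Proof. by move=> ? ?; rewrite normrM ler_pM. Qed.

(** Isolated for [cell_1inner]: X, Y, Z are the squared differences of Re z_0, of Im z_0 and of the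
    tails, and H = h^2. The numerals are 144 = 12^2 and 64 = 8^2, from bounds 12 h and 8 h. *)
Let Re_le (a b X Y Z H r : R) : r ^+ 2 < a <= 2 * r ^+ 2 ->
  r ^+ 2 < b <= 2 * r ^+ 2 -> 0 <= X -> 0 <= Y -> 0 <= Z ->
  X <= 144 * H -> Y <= 64 * H -> Z <= 64^-1 * 2 * r ^+ 2 -> H <= 64^-1 * r ^+ 2 ->
  r ^+ 2 <= (a + b + (X + Y + Z)) / 2 <= 5 * r ^+ 2.
Proof. by lra. Qed.

Let normB_le2 (x y b : R) : `|x| <= 4^-1 * b -> `|y| <= 4^-1 * b ->
  `|x - y| <= 2^-1 * b.
Proof. by rewrite !ler_norml; lra. Qed.

Let sum3_le (x y u X Y Z : R) : `|x| <= 15 * X -> `|y| <= 2 * Y -> `|u| <= Z ->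
  Z <= 8^-1 * Y -> X <= 8^-1 * Y -> 0 <= Y -> `|x + y + u| <= 6 * Y.
Proof. by rewrite !ler_norml; lra. Qed.

Lemma box_distsq h a t s : 0 < h -> box h a t -> box h a s ->
  distsq t s <= n%:R * (2 * h ^+ 2).
Proof.
move=> h0 bt bs; rewrite -[distsq t s]ger0_norm ?distsq_ge0//; apply: sum_le => j.
rewrite ger0_norm ?nsq_ge0// nsqB mulr2n mulrDl mul1r.
have sq (x : R) : `|x| <= h -> x ^+ 2 <= h ^+ 2.
  by move=> xh; rewrite -(real_normK (num_real x)) ler_pXn2r// nnegrE ltW.
by move: (bt j) (bs j) => [t1 t2] [s1 s2]; apply: lerD; apply: sq;
  rewrite ler_norml; lra.
Qed.

Lemma box_Im_inner e h a t : 0 < h -> h <= e -> corner e h a -> box h a t ->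
  `|complex.Im (inner t a)| <= n%:R * (h * e).
Proof.
move=> h0 he ca bt; rewrite Im_inner; apply: sum_le => j.
move: (bt j) (ca j) => [].
move: (complex.Re (tnth a j)) (complex.Im (tnth a j))
      (complex.Re (tnth t j)) (complex.Im (tnth t j)) => x y x' y' t1 t2 [a1 a2].
rewrite (_ : _ - _ = (y' - y) * x - (x' - x) * y); last by ring.
apply: normB_le; (apply/andP; split; [apply: mulr_ge0|apply: ler_pM]); lra.
Qed.

Lemma box_sumsq e h a t : 0 < h -> h <= e -> corner e h a -> box h a t ->
  `|sumsq t - sumsq a| <= n%:R * (4 * h * e).
Proof.
move=> h0 he ca bt; rewrite /sumsq -sumrB; apply: sum_le => j.
move: (bt j) (ca j) => []; rewrite /nsq.
move: (complex.Re (tnth a j)) (complex.Im (tnth a j))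
      (complex.Re (tnth t j)) (complex.Im (tnth t j)) => x y x' y' t1 t2 [a1 a2].
rewrite (_ : _ - _ = (x' - x) * (x' + x) + (y' - y) * (y' + y)); last by ring.
have h1 : 0 <= (x' - x) * (x' + x) <= h * (2 * e).
  by apply/andP; split; [apply: mulr_ge0|apply: ler_pM]; lra.
have h2 : 0 <= (y' - y) * (y' + y) <= h * (2 * e).
  by apply/andP; split; [apply: mulr_ge0|apply: ler_pM]; lra.
by rewrite ler_norml; lra.
Qed.

Lemma box_Im_innerB h a t s : 0 < h -> box h a t -> box h a s ->
  `|complex.Im (inner t s) - (complex.Im (inner t a) - complex.Im (inner s a))|
    <= n%:R * h ^+ 2.
Proof.
move=> h0 bt bs; rewrite !Im_inner -!sumrB; apply: sum_le => j.
move: (bt j) (bs j) => [].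
move: (complex.Re (tnth a j)) (complex.Im (tnth a j))
      (complex.Re (tnth t j)) (complex.Im (tnth t j))
      (complex.Re (tnth s j)) (complex.Im (tnth s j)) => x y x' y' x2 y2 t1 t2 [a1 a2].
rewrite (_ : _ - _ = (y' - y) * (x2 - x) - (x' - x) * (y2 - y)); last by ring.
rewrite expr2.
by apply: normB_le; (apply/andP; split; [apply: mulr_ge0|apply: ler_pM]); lra.
Qed.

Lemma corner_sumsq e h a : 0 < h -> h <= e -> corner e h a ->
  sumsq a <= n%:R * (2 * e ^+ 2).
Proof.
move=> h0 he ca; rewrite -[sumsq a]ger0_norm ?sumsq_ge0//; apply: sum_le => j.
rewrite ger0_norm ?nsq_ge0// /nsq mulr2n mulrDl mul1r.
by move: (ca j) => [a1 a2]; apply: lerD; rewrite ler_pXn2r // ?nnegrE; lra.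
Qed.

(* Put tau = Im z_0 / Re z_0 and let t, s be the tails of z, w.  Within a box
   with corner a, Im <t, s> is Im <t, a> - Im <s, a> up to second order, while
   z_0 and w_0 contribute Re z_0 Re w_0 (tau_z - tau_w).  Letting tau follow
   slope a T makes the two contributions cancel to first order. *)
Definition twist a t : R := complex.Im (inner t a) / (1 - sumsq a).

Definition slope a T t : R := T - (1 + T ^+ 2) * twist a t.

(** The scaling is non-isotropic, as for Koranyi balls: the tail moves by e r, the slope Im z_0 / Re
    z_0 only by e r^2, and the shell then fixes Re z_0. The factor [e] is the margin that makes arg
    u small. *)
Definition in_cell e r a T z : Prop :=
  let x := complex.Re (tnth z ord0) in let y := complex.Im (tnth z ord0) in
  let S := slope a T (tail z) in
  box (e * r) a (tail z) /\
  [/\ 0 < x, r ^+ 2 < 1 - sumsq z <= 2 * r ^+ 2 &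
      S * x <= y < (S + e * r ^+ 2) * x].

Definition cell e r a T : set (n.+1.-tuple R[i]) := [set z | in_cell e r a T z].

Section estimates.
Variables (e r T : R) (a : n.-tuple R[i]).
Hypotheses (e0 : 0 < e) (ne : n.+1%:R * e <= 8^-1) (r0 : 0 < r) (re : r <= e).
Hypotheses (T0 : 0 <= T) (Te : T <= 2 * e) (ca : corner e (e * r) a).

Let h := e * r.

Let e8 : e <= 8^-1.
Proof. by apply: le_trans ne; rewrite ler_peMl ?ler1n// ltW. Qed.

Let ne8 : n%:R * e <= 8^-1.
Proof. by apply: le_trans ne; rewrite ler_pM2r// ler_nat. Qed.

Let ne0 : 0 <= n%:R * e. Proof. by rewrite mulr_ge0// ltW. Qed.

Let h0 : 0 < h. Proof. exact: mulr_gt0. Qed.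

Let r1 : r <= 8^-1. Proof. exact: le_trans e8. Qed.

Let he : h <= e.
Proof. by rewrite /h ler_piMr ?(ltW e0)//; move: r1; lra. Qed.

Let a32 : sumsq a <= 32^-1.
Proof.
apply: le_trans (corner_sumsq h0 he ca) _.
rewrite (_ : _ * _ = 2 * (n%:R * e) * e); last by ring.
by move: (n%:R * e) ne0 ne8 e0 e8 => k *; nra.
Qed.

Let rho2 : 2^-1 <= 1 - sumsq a.
Proof. by move: a32; lra. Qed.

Let twist_le t : box h a t -> `|twist a t| <= 4^-1 * h.
Proof.
move=> bt; have := box_Im_inner h0 he ca bt.
rewrite (_ : _ * _ = (n%:R * e) * h); last by ring.
move=> i1; rewrite /twist normrM normfV [X in _ / X]ger0_norm; last by move: rho2; lra.
rewrite ler_pdivrMr; last by move: rho2; lra.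
rewrite (le_trans i1)//.
move: rho2 ne0 ne8 h0; move: (1 - sumsq a) (n%:R * e) h => p k g *.
by nra.
Qed.

Lemma slope_le t : box (e * r) a t -> `|slope a T t - T| <= e * r.
Proof.
move=> bt; have tw := twist_le bt.
rewrite /slope addrAC subrr add0r normrN normrM ger0_norm ?addr_ge0 ?sqr_ge0//.
have T1 : T <= 1 by move: Te e8; lra.
have T2 : T ^+ 2 <= 1 by rewrite expr2 mulr_ile1.
apply: (@le_trans _ _ (2 * (4^-1 * h))); last by move: h0; rewrite /h; lra.
by apply: ler_pM => //; rewrite ?addr_ge0 ?sqr_ge0//; lra.
Qed.

Lemma box_sumsq_le t : box (e * r) a t -> `|sumsq t - sumsq a| <= 2^-1 * (e * r).
Proof.
move=> bt; rewrite (le_trans (box_sumsq h0 he ca bt))//.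
rewrite (_ : _ * _ = 4 * (n%:R * e) * h); last by ring.
by rewrite -/h; move: ne8 h0; nra.
Qed.

Lemma corner_sumsq_le : sumsq a <= 32^-1.
Proof. exact: a32. Qed.

(** The last bound pins Re z_0 to order h: x^2 (1 + tau^2) = |z_0|^2 = 1 - |t|^2 - (1 - |z|^2),
    where |t|^2 is |a|^2 and tau is T up to O(h), and 1 - |z|^2 is O(r^2). *)
Let cell_arith z : cell e r a T z -> let x := complex.Re (tnth z ord0) in
  exists2 tau, complex.Im (tnth z ord0) = tau * x &
  [/\ 2^-1 <= x <= 1, `|tau| <= 2^-1,
      `|tau - slope a T (tail z)| <= e * r ^+ 2,
      `|slope a T (tail z) - T| <= h &
      `|x ^+ 2 * (1 + T ^+ 2) - (1 - sumsq a)| <= 6 * h].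
Proof.
move=> [bt]; rewrite sumsq_tail /nsq; move: bt.
set t := tail z; set x := complex.Re _; set y := complex.Im _ => bt [x0 d S] /=.
have := slope_le bt; have := box_sumsq_le bt; rewrite -/h => st' ST.
exists (y / x); first by rewrite divfK// gt_eqF.
set tau := y / x.
have yE : y = tau * x by rewrite divfK// gt_eqF.
have tS : 0 <= tau - slope a T t <= e * r ^+ 2.
  move: S; rewrite yE ler_pM2r// ltr_pM2r//; lra.
have hr : e * r ^+ 2 <= 8^-1 * h.
  by rewrite /h expr2 mulrA mulrC ler_pM2r//.
have tT : `|tau - T| <= 2 * h.
  by move: ST tS hr h0; rewrite !ler_norml; lra.
have tau2 : `|tau| <= 2^-1.
  by move: tT T0 Te e8 he; rewrite !ler_norml; lra.
have h64 : h <= 64^-1.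
  by apply: le_trans (ler_pM (ltW e0) (ltW r0) e8 r1) _; lra.
have xx : x ^+ 2 * (1 + tau ^+ 2) = 1 - sumsq t - (1 - (x ^+ 2 + y ^+ 2 + sumsq t)).
  by rewrite yE; ring.
have r2 : 0 < r ^+ 2 <= 8^-1 * r.
  by rewrite exprn_gt0//= expr2 ler_pM2r.
(* By [r <= e] the thickness of the shell, of order r^2, is absorbed into h = e r. *)
have r2h : r ^+ 2 <= h by rewrite /h expr2 ler_pM2r.
have x34 : 2^-1 <= x <= 1.
  move: xx; have := tau2; rewrite ler_norml => tau2'.
  move: d a32 st' h64 r2 (sumsq_ge0 t) r1; rewrite ler_norml.
  move: (1 - (x ^+ 2 + y ^+ 2 + sumsq t)) (sumsq t) (sumsq a) (r ^+ 2) => D st1 sa rr.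
  move=> d a32' st1' h64' r2' st0 r1' xx'.
  have k1 : x ^+ 2 * (1 + tau ^+ 2) <= 1 by rewrite xx'; lra.
  have k2 : 7 / 8 <= x ^+ 2 * (1 + tau ^+ 2) by rewrite xx'; lra.
  have q0 : 0 <= tau ^+ 2 by exact: sqr_ge0.
  have q1 : tau ^+ 2 <= 4^-1 by nra.
  have x2 : 0 <= x ^+ 2 by exact: sqr_ge0.
  have k3 : x ^+ 2 <= 1 by nra.
  have k4 : 2^-1 <= x ^+ 2 by nra.
  by apply/andP; split; nra.
split=> //; first by rewrite ger0_norm; lra.
have dT : `|tau ^+ 2 - T ^+ 2| <= 2 * h.
  rewrite subr_sqr normrM; have : `|tau + T| <= 1.
    by move: tau2 T0 Te e8; rewrite !ler_norml; lra.
  by move: tT (normr_ge0 (tau - T)) (normr_ge0 (tau + T)); move: (`|_|) (`|_|) => k l *; nra.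
rewrite (_ : _ - _ = (x ^+ 2 * (1 + tau ^+ 2) - (1 - sumsq a)) -
   x ^+ 2 * (tau ^+ 2 - T ^+ 2)); last by ring.
have q1 : `|x ^+ 2 * (tau ^+ 2 - T ^+ 2)| <= 2 * h.
  rewrite normrM ger0_norm ?sqr_ge0//.
  have : x ^+ 2 <= 1 by move: x34; nra.
  have := sqr_ge0 x; move: dT (normr_ge0 (tau ^+ 2 - T ^+ 2)); move: (`|_|) (x ^+ 2) => k l *; nra.
move: q1 st' d r2h h0; rewrite xx; move: (1 - (x ^+ 2 + y ^+ 2 + sumsq t)) => D.
by rewrite !ler_norml; lra.
Qed.

(** The ratio of the two bounds gives |Im u| / Re u <= 6 e, independently of r. For Im u the naive
    size is h, of order r; it drops to e r^2 because the slope was tuned to cancel the first-order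
    part of Im <t, s>. *)
Lemma cell_1inner z w : cell e r a T z -> cell e r a T w ->
  r ^+ 2 <= complex.Re (1 - inner z w) <= 5 * r ^+ 2 /\
  `|complex.Im (1 - inner z w)| <= 6 * e * r ^+ 2.
Proof.
move=> cz cw; have [bz [_ dz _]] := cz; have [bw [_ dw _]] := cw.
have dts := box_distsq h0 bz bw; have its := box_Im_innerB h0 bz bw.
have twz := twist_le bz; have tww := twist_le bw.
have [tau yE [x1 tau1 tS ST xK]] := cell_arith cz.
have [tau' yE' [x1' tau1' tS' ST' xK']] := cell_arith cw.
rewrite Re_1inner Im_1inner normrN Im_inner_tail distsq_tail nsqB yE yE'.
set x := complex.Re (tnth z ord0) in x1 xK *.
set x' := complex.Re (tnth w ord0) in x1' xK' *.
set t := tail z in bz dts its twz tS *; set s := tail w in bw dts its tww tS' *.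
set K := 1 + T ^+ 2 in xK xK'; set p := 1 - sumsq a in xK xK'.
have [/andP[xlo xhi] /andP[xlo' xhi']] := (x1, x1').
have x0 : 0 <= x by apply: le_trans xlo; rewrite invr_ge0.
have x0' : 0 <= x' by apply: le_trans xlo'; rewrite invr_ge0.
have xabs : `|x| <= 1 by rewrite ger0_norm.
have xabs' : `|x'| <= 1 by rewrite ger0_norm.
have p0 : p != 0 by rewrite gt_eqF//; apply: lt_le_trans rho2.
have itE u : complex.Im (inner u a) = p * twist a u by rewrite /twist mulrC divfK.
rewrite !itE -mulrBr in its.
have SE u : slope a T u = T - K * twist a u by [].
rewrite !SE in tS tS'.
have r20 : 0 <= r ^+ 2 by exact: sqr_ge0.
have K12 : 1 <= K <= 2.
  have T1 : T <= 1 by move: Te e8; lra.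
  have T2 : T ^+ 2 <= 1 by rewrite expr2 mulr_ile1.
  by rewrite /K; have := sqr_ge0 T; lra.
have /andP[K1 K2] := K12.
have K0 : 0 <= K by exact: le_trans K1.
have K2' : `|K| <= 2 by rewrite ger0_norm.
have hh : h ^+ 2 <= 8^-1 * (e * r ^+ 2).
  rewrite /h exprMn expr2 -mulrA ler_wpM2r//.
  by rewrite mulr_ge0// ltW.
have her : e * r ^+ 2 <= 8^-1 * h.
  by rewrite /h expr2 mulrA mulrC ler_pM2r.
have er : e * r ^+ 2 <= 8^-1 * r ^+ 2 by rewrite ler_wpM2r.
have nh : n%:R * h ^+ 2 <= 8^-1 * (e * r ^+ 2).
  rewrite (_ : _ * _ = (n%:R * e) * (e * r ^+ 2)); last by rewrite /h; ring.
  by rewrite ler_wpM2r// mulr_ge0// ltW.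
have hp := h0.
have xx : `|x' - x| <= 12 * h.
  have e1 : `|(x' ^+ 2 - x ^+ 2) * K| <= 12 * h.
    rewrite (_ : _ * _ = (x' ^+ 2 * K - p) - (x ^+ 2 * K - p)); last by ring.
    by move: xK xK'; rewrite !ler_norml; lra.
  rewrite (le_trans _ e1)// subr_sqr -mulrA normrM ler_peMr//.
  rewrite ger0_norm; last by rewrite mulr_ge0// addr_ge0.
  rewrite -[leLHS]mulr1; apply: ler_pM => //.
  by apply: le_trans (lerD xlo' xlo); rewrite -[2^-1]mul1r -splitr.
have xxK : `|p - x * x' * K| <= 30 * h.
  rewrite (_ : _ - _ = - (x ^+ 2 * K - p) - x * K * (x' - x)); last by ring.
  have xK1 : `|x * K| <= 2.
    by rewrite -[2]mul1r; exact: mul_le.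
  have := mul_le xK1 xx; move: xK; rewrite !ler_norml; lra.
set dw' := twist a t - twist a s in its.
have dtw : `|dw'| <= 2^-1 * h.
  exact: normB_le2 twz tww.
have KD : `|K * dw'| <= h.
  by have := mul_le K2' dtw; rewrite mulrA mulfV ?mul1r// pnatr_eq0.
have D1 : `|(tau - (T - K * twist a t)) - (tau' - (T - K * twist a s))| <= 2 * (e * r ^+ 2).
  by move: tS tS'; rewrite !ler_norml; lra.
set V := _ - _ in D1.
have VE : tau - tau' = V - K * dw' by rewrite /V /dw'; ring.
split; last first.
  (* The first-order term [dw'] is O(h) and appears with the factor p - x x' K, itself O(h) since
     x^2 K is close to p; what remains is the freedom [V] of the slope and the second-order part of
     Im <t, s>. *)
  have -> : tau * x * x' - x * (tau' * x') + complex.Im (inner t s) =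
     (p - x * x' * K) * dw' + x * x' * V +
     (complex.Im (inner t s) - p * dw').
    rewrite (_ : tau * x * x' - _ = x * x' * (tau - tau')); last by ring.
    by rewrite VE; ring.
  have q1 := mul_le xxK dtw.
  have q2 := mul_le (mul_le xabs xabs') D1.
  rewrite (_ : 30 * h * (2^-1 * h) = 15 * h ^+ 2) in q1; last by field.
  rewrite !mul1r in q2.
  rewrite -(mulrA 6).
  exact: (sum3_le q1 q2 its nh hh (mulr_ge0 (ltW e0) r20)).
have tt : `|tau - tau'| <= 2 * h.
  by rewrite VE; move: D1 KD her; rewrite !ler_norml; lra.
have yy : `|tau * x - tau' * x'| <= 8 * h.
  rewrite (_ : _ - _ = (tau - tau') * x - tau' * (x' - x)); last by ring.
  by have := mul_le tt xabs; have := mul_le tau1' xx; rewrite !ler_norml; lra.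
have sq (u b : R) : `|u| <= b -> u ^+ 2 <= b ^+ 2.
  move=> ub; rewrite -(real_normK (num_real u)) ler_pXn2r// nnegrE//.
  exact: le_trans ub.
have sx : (x - x') ^+ 2 <= 144 * h ^+ 2.
  by rewrite (_ : 144 * _ = (12 * h) ^+ 2); [apply: sq; rewrite distrC|ring].
have sy : (tau * x - tau' * x') ^+ 2 <= 64 * h ^+ 2.
  by rewrite (_ : 64 * _ = (8 * h) ^+ 2); [exact: sq|ring].
have hr2 : h ^+ 2 <= 64^-1 * r ^+ 2.
  rewrite (le_trans hh)// (le_trans (ler_wpM2l _ er)) ?invr_ge0//.
  by rewrite mulrA -invfM -natrM.
have dts' : distsq t s <= 64^-1 * 2 * r ^+ 2.
  rewrite (le_trans dts)// (_ : _ * _ = 2 * (n%:R * h ^+ 2)); last by ring.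
  rewrite mulrAC [leRHS]mulrC ler_wpM2l// (le_trans nh)//.
  rewrite (le_trans (ler_wpM2l _ er)) ?invr_ge0//.
  by rewrite mulrA -invfM -natrM.
exact: (Re_le dz dw (sqr_ge0 _) (sqr_ge0 _) (distsq_ge0 t s) sx sy dts' hr2).
Qed.

End estimates.

End cells.

(** * Measure of boxes and cells *)

Section boxes.
Context (R : realType).
Local Notation lebC := (lebesgueC R).
Local Notation leb := (@lebesgue_measure R).

Lemma measurable_itvP d (T : measurableType d) (f g k : T -> R) :
  measurable_fun setT f -> measurable_fun setT g -> measurable_fun setT k ->
  measurable [set x | f x <= g x < k x].
Proof.
move=> mf mg mk; rewrite -[X in measurable X]setTI.
have m : measurable_fun setT (fun x => (f x <= g x) && (g x < k x)).
  by apply: measurable_and; [exact: measurable_fun_ler|exact: measurable_fun_ltr].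
exact: (m measurableT [set true]).
Qed.

Lemma measurable_itvP' d (T : measurableType d) (f g k : T -> R) :
  measurable_fun setT f -> measurable_fun setT g -> measurable_fun setT k ->
  measurable [set x | f x < g x <= k x].
Proof.
move=> mf mg mk; rewrite -[X in measurable X]setTI.
have m : measurable_fun setT (fun x => (f x < g x) && (g x <= k x)).
  by apply: measurable_and; [exact: measurable_fun_ltr|exact: measurable_fun_ler].
exact: (m measurableT [set true]).
Qed.

Lemma measurable_box n h (a : n.-tuple R[i]) : measurable (box h a).
Proof.
rewrite (_ : box h a = \bigcap_(j in [set: 'I_n])
   ([set t | complex.Re (tnth a j) <= complex.Re (tnth t j) < complex.Re (tnth a j) + h] `&`
    [set t | complex.Im (tnth a j) <= complex.Im (tnth t j) < complex.Im (tnth a j) + h])).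
  apply: fin_bigcap_measurable => // j _.
  have := measurable_ReC (@measurable_tnth _ R[i] _ j).
  have := measurable_ImC (@measurable_tnth _ R[i] _ j) => ? ?.
  by apply: measurableI; apply: measurable_itvP => //; exact: measurable_cst.
by apply/seteqP; split=> t; [move=> h1 j _; exact: h1|move=> h1 j; exact: h1].
Qed.

Lemma lebesgue_box n (h : R) (a : n.-tuple R[i]) : 0 <= h ->
  lebesgueCn R n (box h a) = ((h ^+ 2) ^+ n)%:E.
Proof.
move=> h0; elim: n a => [|n IH] a.
  rewrite /= diracE mem_set//.
  by case.
pose Q : set R[i] := [set x |
  complex.Re (tnth a ord0) <= complex.Re x < complex.Re (tnth a ord0) + h] `&` [set x |
  complex.Im (tnth a ord0) <= complex.Im x < complex.Im (tnth a ord0) + h].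
transitivity ((lebC \x lebesgueCn R n)%E (Q `*` box h [tuple of behead a])).
  congr ((lebC \x lebesgueCn R n)%E _); apply/seteqP; split=> -[x t] /=.
    move=> H; split; first by have := H ord0; rewrite tnth0.
    move=> j; have := H (lift ord0 j); rewrite tnthS tnth_behead.
    by rewrite (_ : inord j.+1 = lift ord0 j)//; apply/val_inj; rewrite /= inordK// ltnS.
  move=> [H1 H2] j; have [->|] := eqVneq j ord0; first by rewrite tnth0.
  rewrite eq_sym => /unlift_some[k -> _]; have := H2 k; rewrite tnthS tnth_behead.
  by rewrite (_ : inord k.+1 = lift ord0 k)//; apply/val_inj; rewrite /= inordK// ltnS.
rewrite product_measure1E; last exact: measurable_box.
  rewrite IH (exprS (h ^+ 2)) EFinM; congr (_ * _)%E.
  rewrite /Q; set p := complex.Re (tnth a _); set q := complex.Im (tnth a _).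
  transitivity ((leb \x leb)%E (`[p, p + h[%classic `*` `[q, q + h[%classic)).
    congr ((leb \x leb)%E _); apply/seteqP; split=> -[x y] /=; rewrite !in_itv//=.
  rewrite product_measure1E//= !lebesgue_measure_itv/= !lte_fin !ltrDl.
  have [->|hn0] := eqVneq h 0; first by rewrite ltxx mul0e expr0n.
  by rewrite lt0r hn0 h0/= -!EFinB -EFinM; congr EFin; ring.
apply: measurableI; apply: measurable_itvP; try exact: measurable_cst.
  exact: measurable_Re.
exact: measurable_Im.
Qed.

End boxes.

Section cell_measure.
Context (R : realType) (n : nat).
Local Notation lam := (lebesgueCn R n.+1).
Local Notation lebC := (lebesgueC R).
Local Notation leb := (@lebesgue_measure R).
Implicit Types (e r h T : R) (a t s : n.-tuple R[i]) (z w : n.+1.-tuple R[i]).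

Lemma measurable_tail : measurable_fun setT (@tail R n).
Proof.
apply/measurable_fun_tnthP => j.
rewrite (_ : _ \o _ = fun z => tnth z (lift ord0 j)); first exact: measurable_tnth.
by apply/funext => z; rewrite /= tnth_mktuple.
Qed.

Lemma measurable_slope a T : measurable_fun setT (slope a T).
Proof.
have mi : measurable_fun setT (fun t => complex.Im (inner t a)).
  rewrite (_ : (fun t => _) = fun t => \sum_(j < n)
   (complex.Im (tnth t j) * complex.Re (tnth a j) -
                complex.Re (tnth t j) * complex.Im (tnth a j))).
    apply: measurable_sum => j.
    have := measurable_ReC (@measurable_tnth _ R[i] _ j).
    have := measurable_ImC (@measurable_tnth _ R[i] _ j) => ? ?.
    by meas.
  by apply/funext => z; rewrite Im_inner.
by rewrite /slope /twist; meas.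
Qed.

Lemma measurable_cell e r a T : measurable (cell e r a T).
Proof.
have mR := measurable_ReC (@measurable_tnth _ R[i] n.+1 ord0).
have mI := measurable_ImC (@measurable_tnth _ R[i] n.+1 ord0).
have mS : measurable_fun setT (fun z => slope a T (tail z)).
  exact: (measurableT_comp (measurable_slope a T) measurable_tail).
have mq := @measurable_sumsq R n.+1.
(* The condition 0 < x is written 0 < x <= x to fit [measurable_itvP']. *)
rewrite (_ : cell e r a T = (@tail R n @^-1` box (e * r) a) `&`
  ([set z | 0 < complex.Re (tnth z ord0) <= complex.Re (tnth z ord0)] `&`
   ([set z | r ^+ 2 < 1 - sumsq z <= 2 * r ^+ 2] `&`
   [set z | slope a T (tail z) * complex.Re (tnth z ord0) <= complex.Im (tnth z ord0)
      < (slope a T (tail z) + e * r ^+ 2) * complex.Re (tnth z ord0)]))).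
  apply: measurableI.
    by rewrite -[X in measurable X]setTI; apply: measurable_tail => //; exact: measurable_box.
  apply: measurableI; first by apply: measurable_itvP' => //; exact: measurable_cst.
  by apply: measurableI; [apply: measurable_itvP'|apply: measurable_itvP]; meas.
apply/seteqP; split=> z.
  by move=> [? [? ? ?]]; split=> //; split=> //; rewrite /= lexx andbT.
by move=> [? [/= /andP[? _] [? ?]]]; split.
Qed.

Lemma cell_ball e r a T : cell e r a T `<=` @unit_ball R n.+1.
Proof.
move=> z [_ [_ /andP[h _] _]]; apply/unit_ballE.
by rewrite -subr_gt0 (le_lt_trans _ h)// sqr_ge0.
Qed.

Section volume.
Variables (e r T : R) (a : n.-tuple R[i]).
Hypotheses (e0 : 0 < e) (ne : n.+1%:R * e <= 8^-1) (r0 : 0 < r) (re : r <= e).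
Hypotheses (T0 : 0 <= T) (Te : T <= 2 * e) (ca : corner e (e * r) a).

(** Every tail in the box is the tail of a region of points of the cell: an x-interval of length at
    least r^2 / 4 to the right of 1/2, and for each such x the full window of slopes. *)
Let slab t : box (e * r) a t -> exists X1 X2, [/\ 2^-1 <= X1,
  4^-1 * r ^+ 2 <= X2 - X1 & forall x y, X1 <= x <= X2 ->
    slope a T t * x <= y < (slope a T t + e * r ^+ 2) * x ->
    cell e r a T (ins ord0 (Complex x y, t))].
Proof.
move=> bt; have ST := slope_le e0 ne r0 re T0 Te ca bt.
have st := box_sumsq_le e0 ne r0 re ca bt.
have a32 := corner_sumsq_le e0 ne r0 re ca.
have e8 : e <= 8^-1 by apply: le_trans ne; rewrite ler_peMl ?ler1n// ltW.
have r8 : r <= 8^-1 by exact: le_trans e8.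
have rr : r ^+ 2 <= 64^-1.
  by rewrite expr2 (le_trans (ler_pM (ltW r0) (ltW r0) r8 r8))// -invfM -natrM.
have her : e * r <= 64^-1.
  by rewrite (le_trans (ler_pM (ltW e0) (ltW r0) e8 r8))// -invfM -natrM.
have rr0 : 0 < r ^+ 2 by exact: exprn_gt0.
have err : 0 < e * r ^+ 2 <= 8^-1 * r ^+ 2 by rewrite mulr_gt0//= ler_wpM2r// ltW.
set S := slope a T t in ST *.
have S2 : `|S| <= 3^-1.
  by move: ST her e8 T0 Te; rewrite !ler_norml; lra.
have SS : S ^+ 2 <= 4^-1.
  have : S ^+ 2 <= 3^-1 ^+ 2 by rewrite -(real_normK (num_real S)) ler_pXn2r// nnegrE invr_ge0.
  by lra.
have SS0 := sqr_ge0 S.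
set E := 1 - sumsq t.
have E1 : 15 / 16 <= E <= 1.
  by rewrite /E; move: st (sumsq_ge0 t); rewrite ler_norml; lra.
pose V := 1 + S ^+ 2; have V0 : 0 < V by rewrite /V; lra.
have V1 : V <= 5 / 4 by rewrite /V; lra.
(* With y = S x exactly, 1 - |z|^2 would range over [10/8, 15/8] r^2. The window of slopes perturbs
   y^2 by at most e r^2 <= r^2 / 8, which keeps 1 - |z|^2 in ]r^2, 2 r^2]. *)
pose A1 := (E - 15 / 8 * r ^+ 2) / V; pose A2 := (E - 10 / 8 * r ^+ 2) / V.
have A14 : 4^-1 <= A1 by rewrite /A1 ler_pdivlMr//; lra.
have A21 : A2 <= 1 by rewrite /A2 ler_pdivrMr// /V; lra.
have A12 : 2^-1 * r ^+ 2 <= A2 - A1.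
  rewrite /A1 /A2 -mulrBl ler_pdivlMr//.
  have : r ^+ 2 * V <= r ^+ 2 * (5 / 4) by rewrite ler_wpM2l// ltW.
  by lra.
have A10 : 0 <= A1 by lra.
have A20 : 0 <= A2 by lra.
pose X1 := Num.sqrt A1; pose X2 := Num.sqrt A2.
have X1s : X1 ^+ 2 = A1 by rewrite sqr_sqrtr.
have X2s : X2 ^+ 2 = A2 by rewrite sqr_sqrtr.
have X10 : 0 <= X1 by exact: sqrtr_ge0.
have X20 : 0 <= X2 by exact: sqrtr_ge0.
have X1h : 2^-1 <= X1.
  rewrite -(@ler_pXn2r _ 2) ?nnegrE ?invr_ge0// X1s.
  by rewrite expr2 -invfM -natrM.
have X21 : X2 <= 1 by rewrite -(@ler_pXn2r _ 2) ?nnegrE// X2s expr1n.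
have X12 : X1 <= X2 by rewrite -(@ler_pXn2r _ 2) ?nnegrE// X2s X1s; lra.
have AX : A2 - A1 = (X2 - X1) * (X2 + X1) by rewrite -X1s -X2s subr_sqr.
exists X1, X2; split=> //.
  have : (X2 - X1) * (X2 + X1) <= (X2 - X1) * 2 by rewrite ler_wpM2l ?subr_ge0//; lra.
  by rewrite -AX; lra.
move=> x y /andP[x1 x2] Sy.
have x0 : 0 < x by rewrite (lt_le_trans _ x1)// (lt_le_trans _ X1h)// invr_gt0.
have xs1 : A1 <= x ^+ 2 by rewrite -X1s ler_pXn2r// nnegrE ltW.
have xs2 : x ^+ 2 <= A2 by rewrite -X2s ler_pXn2r// nnegrE ltW.
have Q1 : E - 15 / 8 * r ^+ 2 <= x ^+ 2 * V by rewrite -ler_pdivrMr.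
have Q2 : x ^+ 2 * V <= E - 10 / 8 * r ^+ 2 by rewrite -ler_pdivlMr.
have tz : tail (ins ord0 (Complex x y, t)) = t.
  by apply: eq_from_tnth => j; rewrite tnth_mktuple tnth_ins_lift.
rewrite /cell/= /in_cell tz tnth_ins/= -/S; split=> //; split=> //.
rewrite sumsq_tail tnth_ins tz /nsq/= (_ : 1 - _ = E - (x ^+ 2 + y ^+ 2)); last first.
  by rewrite /E; ring.
pose tau := y / x; have yE : y = tau * x by rewrite divfK// gt_eqF.
have tS : 0 <= tau - S <= e * r ^+ 2.
  by move: Sy; rewrite yE ler_pM2r// ltr_pM2r//; lra.
have x21 : x ^+ 2 <= 1 by exact: le_trans A21.
have ts1 : `|tau + S| <= 1 by move: S2 tS err; rewrite !ler_norml; lra.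
have dy : `|y ^+ 2 - S ^+ 2 * x ^+ 2| <= e * r ^+ 2.
  rewrite yE (_ : _ - _ = (tau - S) * (tau + S) * x ^+ 2); last by ring.
  rewrite normrM [`|x ^+ 2|]ger0_norm ?sqr_ge0// normrM -[leRHS]mulr1.
  apply: ler_pM; rewrite ?mulr_ge0 ?(ltW x0)//.
  rewrite -[leRHS]mulr1; apply: ler_pM => //.
  by rewrite ger0_norm; lra.
have xV : x ^+ 2 * V = x ^+ 2 + S ^+ 2 * x ^+ 2 by rewrite /V; ring.
by move: dy err Q1 Q2; rewrite xV ler_norml; lra.
Qed.

(** The factors are the box of tails, the length r^2 / 4 in x, and the height e r^2 x >= e r^2 / 2
    in y. *)
Lemma cell_volume :
  ((8^-1 * e * r ^+ 4 * ((e * r) ^+ 2) ^+ n)%:E <= lam (cell e r a T))%E.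
Proof.
have h0 : 0 <= e * r by rewrite mulr_ge0// ltW.
have mE d (Y : measurableType d) (D : set Y) : measurable D ->
    measurable_fun setT (fun y => (\1_D y : R)%:E).
  by move=> mD; apply/measurable_EFinP/measurable_indic.
have mC := measurable_cell e r a T.
have mI := mE _ _ _ mC.
have I0 z : (0 <= (\1_(cell e r a T) z)%:E :> \bar R)%E by rewrite lee_fin.
have -> : lam (cell e r a T) = (\int[lam]_z (\1_(cell e r a T) z)%:E)%E.
  by rewrite integral_indic// setIT.
rewrite (integralCn_ins ord0)//.
rewrite EFinM -(lebesgue_box a h0).
have mb := @measurable_box R n (e * r) a.
rewrite -[X in (_ * lebesgueCn R n X)%E]setIT -integral_indic// -ge0_integralZl//; last 2 first.
- exact: mE.
- by rewrite lee_fin !mulr_ge0 ?exprn_ge0 ?(ltW e0) ?(ltW r0).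
apply: ge0_le_integralT => t.
  by rewrite mule_ge0 ?lee_fin// !mulr_ge0 ?exprn_ge0 ?(ltW e0) ?(ltW r0).
rewrite indicE; case: (boolP (t \in box (e * r) a)) => [/set_mem bt|_]; last first.
  by rewrite mule0; apply: integral_ge0.
rewrite mule1.
have [X1 [X2 [X1h X12 cellP]]] := slab bt.
rewrite integralC//; last first.
  apply: (measurableT_comp mI); apply: (measurableT_comp (measurable_ins _)).
  exact: pair2_measurable.
set S := slope a T t in cellP.
have err : 0 < e * r ^+ 2 by rewrite mulr_gt0 ?exprn_gt0.
apply: (@le_trans _ _ (\int[leb]_x ((2^-1 * (e * r ^+ 2))%:E * (\1_(`[X1, X2]%classic) x)%:E))%E).
  rewrite ge0_integralZl//; last 2 first.
  - exact: mE.
  - by rewrite lee_fin mulr_ge0// ltW.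
  rewrite integral_indic//= setIT lebesgue_measure_itv/= lte_fin.
  rewrite ifT; last first.
    by rewrite -subr_gt0 (lt_le_trans _ X12)// mulr_gt0// exprn_gt0.
  rewrite -EFinB -EFinM lee_fin.
  rewrite (_ : _ * _ * _ = 2^-1 * (e * r ^+ 2) * (4^-1 * r ^+ 2)); last by field.
  by rewrite ler_wpM2l// mulr_ge0// ltW.
apply: ge0_le_integralT => x.
  by rewrite mule_ge0// lee_fin ?mulr_ge0// ltW.
rewrite indicE; case: (boolP (x \in _)) => [/set_mem|_]; last first.
  by rewrite mule0; apply: integral_ge0.
rewrite /= in_itv/= mule1 => xX.
have x12 : 2^-1 <= x by case/andP: xX => h _; exact: le_trans h.
apply: (@le_trans _ _ (\int[leb]_y (\1_(`[S * x, (S + e * r ^+ 2) * x[%classic) y)%:E)%E).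
  rewrite integral_indic//= setIT lebesgue_measure_itv/= lte_fin.
  have x0 : 0 < x by rewrite (lt_le_trans _ x12)// invr_gt0.
  rewrite ltr_pM2r// ltrDl err -EFinB lee_fin -mulrBl addrAC subrr add0r mulrC.
  by rewrite ler_wpM2l// ltW.
apply: ge0_le_integralT => y; first by rewrite lee_fin.
rewrite lee_fin !indicE; case: (boolP (y \in _)) => [/set_mem|_].
  by rewrite /= in_itv/= => ySx; rewrite mem_set//; exact: cellP.
by rewrite ler0n.
Qed.

End volume.

End cell_measure.

(** * Positivity of the normalizing constants *)

Section Gamma_positive.
Context (R : realType).
Local Notation leb := (@lebesgue_measure R).

Let integrand (x t : R) : R := t `^ (x - 1) * expR (- t).

Let measurable_integrand x : measurable_fun [set: measurableTypeR R] (integrand x).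
Proof.
apply: measurable_funM; first exact: measurable_powR.
apply: (measurableT_comp (@measurable_expR R)).
exact: (@measurable_funN _ _ _ _ (fun t : measurableTypeR R => t) (@measurable_id _ _ _)).
Qed.

Let integrand_ge0 x t : 0 <= integrand x t.
Proof. by rewrite mulr_ge0 ?powR_ge0 ?expR_ge0. Qed.

(** Beyond 1, (x - 1) ln t <= b ln t <= b ln (2 b) + t / 2, by ln y <= y at y = t / (2 b). Half of
    the decay of exp(-t) remains and is expressed by the exponential density of rate 1/2; the 2 in
    [C] cancels that rate. *)
Let integrand_le x : 0 < x -> exists C : R, 0 < C /\ forall t, 0 < t ->
  integrand x t <= ((fun t => t `^ (- Num.max 0 (1 - x))) \_ `]0, 1]%classic) t +
                   C * exponential_pdf 2^-1 t.
Proof.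
move=> x0; pose b := `|x - 1| + 1.
have b1 : 1 <= b by rewrite lerDr.
have b0 : 0 < b by exact: lt_le_trans b1.
exists (2 * expR (b * ln (2 * b))); split; first by rewrite mulr_gt0// expR_gt0.
move=> t t0; rewrite /exponential_pdf !patchE.
rewrite [X in _ <= _ + X](_ : _ = expR (b * ln (2 * b)) * expR (- (2^-1) * t)); last first.
  rewrite mem_set/=; last by rewrite in_itv/= ltW.
  by field.
have [t1|t1] := leP t 1.
  rewrite mem_set/=; last by rewrite in_itv/= t0.
  rewrite (@le_trans _ _ (t `^ (- Num.max 0 (1 - x))))//; last first.
    by rewrite lerDl mulr_ge0 ?expR_ge0.
  rewrite /integrand -[leRHS]mulr1 ler_pM ?powR_ge0 ?expR_ge0//.
    by apply: ger_powR; rewrite ?t0// lerNl opprB le_max lexx orbT.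
  by rewrite -expR0 ler_expR oppr_le0 ltW.
rewrite memNset/=; last by rewrite in_itv/= t0/= => h; move: t1; rewrite ltNge h.
rewrite add0r /integrand /powR gt_eqF// -!expRD ler_expR.
have lnt : 0 <= ln t by rewrite ln_ge0// ltW.
have h1 : (x - 1) * ln t <= b * ln t.
  by rewrite ler_wpM2r// (le_trans (ler_norm _))// lerDl.
have h2 : ln t <= ln (2 * b) + t / (2 * b).
  have b20 : 0 < 2 * b by rewrite mulr_gt0.
  have -> : t = (2 * b) * (t / (2 * b)) by rewrite mulrC divfK// gt_eqF.
  rewrite lnM ?posrE ?divr_gt0// [X in _ <= _ + X / _]mulrC mulfK ?gt_eqF// lerD2l.
  by apply/ltW/ln_sublinear; rewrite divr_gt0.
have h3 : b * ln t <= b * ln (2 * b) + 2^-1 * t.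
  have -> : 2^-1 * t = b * (t / (2 * b)) by field; rewrite gt_eqF.
  by rewrite -mulrDr ler_wpM2l// ltW.
by lra.
Qed.

(** Finiteness is as essential as positivity, since [fine] would turn an infinite integral into 0.
    Positivity is seen on [1, 2]. *)
Lemma Gamma_gt0 (x : R) : 0 < x -> 0 < Gamma x.
Proof.
move=> x0; rewrite /Gamma /Rintegral.
have mf := measurable_integrand x.
have mE : measurable_fun [set: measurableTypeR R] (fun t => (integrand x t)%:E).
  exact/measurable_EFinP.
have f0 (t : measurableTypeR R) : (0 <= (integrand x t)%:E)%E by rewrite lee_fin integrand_ge0.
have [C [C0 hC]] := integrand_le x0.
pose s := Num.max 0 (1 - x).
have s01 : 0 <= s < 1 by rewrite /s le_max lexx/= gt_max ltr01/=; lra.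
pose g (t : measurableTypeR R) : R := ((fun t => t `^ (- s)) \_ `]0, 1]%classic) t.
pose k (t : measurableTypeR R) : R := exponential_pdf 2^-1 t.
have g0 t : 0 <= g t by rewrite /g patchE; case: ifPn => // _; exact: powR_ge0.
have k0 t : 0 <= k t by rewrite exponential_pdf_ge0// invr_ge0.
have mg : measurable_fun [set: measurableTypeR R] g.
  apply/(measurable_restrictT _ _).1 => //.
  by apply: measurable_funTS; exact: measurable_powR.
have mk : measurable_fun [set: measurableTypeR R] k by exact: measurable_exponential_pdf.
have fin : (\int[leb]_(t in `]0%R, +oo[%classic) (integrand x t)%:E < +oo)%E.
  apply: (@le_lt_trans _ _ (\int[leb]_t ((g t)%:E + C%:E * (k t)%:E))%E).
    rewrite integral_mkcond; apply: ge0_le_integralT => t.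
      by rewrite patchE; case: ifPn.
    rewrite patchE; case: ifPn => [/set_mem|_]; last first.
      by rewrite -EFinM -EFinD lee_fin addr_ge0// mulr_ge0// ltW.
    rewrite /= in_itv/= andbT => t0.
    by rewrite -EFinM -EFinD lee_fin; exact: hC.
  rewrite ge0_integralD//; last 4 first.
  - by move=> t _; rewrite lee_fin.
  - exact/measurable_EFinP.
  - by move=> t _; rewrite mule_ge0// lee_fin// ltW.
  - by apply: emeasurable_funM; [exact: measurable_cst|exact/measurable_EFinP].
  rewrite ge0_integralZl//; last 3 first.
  - exact/measurable_EFinP.
  - by move=> t _; rewrite lee_fin.
  - by rewrite lee_fin ltW.
  rewrite integral_exponential_pdf ?invr_gt0// mule1.
  apply: (@le_lt_trans _ _ (((1 - s)^-1)%:E + C%:E)%E); last by rewrite -EFinD ltry.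
  rewrite leeD// (_ : (fun t => (g t)%:E) =
     ((fun t => (t `^ (- s))%:E) \_ `]0, 1]%classic)); last first.
    by apply/funext => t; rewrite /g !patchE; case: ifPn.
  by rewrite -integral_mkcond; exact: integral_powR01.
have pos : (0 < \int[leb]_(t in `]0%R, +oo[%classic) (integrand x t)%:E)%E.
  pose c := Num.min 1 (2 `^ (x - 1)) * expR (- 2).
  have c0 : 0 < c by rewrite mulr_gt0 ?expR_gt0// lt_min ltr01 powR_gt0.
  apply: (@lt_le_trans _ _ c%:E); first by rewrite lte_fin.
  have -> : c%:E = (\int[leb]_(t in `[1%R, 2%R]%classic) c%:E)%E.
    rewrite integral_cst//= lebesgue_measure_itv/= lte_fin ltr1n -EFinB -EFinM.
    by congr EFin; ring.
  apply: (@le_trans _ _ (\int[leb]_(t in `[1%R, 2%R]%classic) (integrand x t)%:E)%E); last first.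
    apply: ge0_subset_integral => //; first exact: measurable_funTS.
    by move=> t /=; rewrite !in_itv/= andbT => /andP[t1 _]; exact: lt_le_trans t1.
  apply: ge0_le_integral => //; first by move=> t _; rewrite lee_fin ltW.
    exact: measurable_funTS.
  move=> t /=; rewrite in_itv/= => /andP[t1 t2]; rewrite lee_fin /c /integrand.
  rewrite ler_pM ?expR_ge0//; last by rewrite ler_expR lerN2.
  rewrite ge_min; have [x1|x1] := leP 1 x.
    by apply/orP; left; rewrite -[X in X <= _](powRr0 t) ler_powR// subr_ge0.
  apply/orP; right; rewrite -(opprB 1 x); apply: ler_powRN => //.
    by rewrite subr_ge0 ltW.
  exact: lt_le_trans t1.
by rewrite fine_gt0// pos.
Qed.

End Gamma_positive.

Section total_const_positive.
Context (R : realType) (n : nat) (alpha : R).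
Local Notation lam := (lebesgueCn R n.+1).
Local Notation B := (@unit_ball R n.+1).

Lemma lebesgue_unit_ball_lty : (lam B < +oo)%E.
Proof.
have mB := @measurable_unit_ball R n.+1.
rewrite -[X in lam X]setIT -integral_indic//.
rewrite (_ : (fun z => _) = fun z => (ball_weight 0 z)%:E).
  by apply: integral_ball_weight; rewrite ltrN10.
apply/funext => z; rewrite indicE /ball_weight powRr0; congr EFin.
case: ifPn => [z1|z1]; first by rewrite mem_set//; exact/unit_ballE.
by rewrite memNset// => /unit_ballE; exact/negP.
Qed.

(** The ball contains a cell, for instance the one with r = e, T = 0 and corner 0, and [cell_volume]
    bounds its volume below. *)
Lemma lebesgue_unit_ball_gt0 : (0 < lam B)%E.
Proof.
pose e : R := (8 * n.+1%:R)^-1.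
have e0 : 0 < e by rewrite invr_gt0 mulr_gt0.
have ne : n.+1%:R * e <= 8^-1 by rewrite /e invfM mulrCA mulfV ?mulr1 ?pnatr_eq0.
have e8 : e <= 8^-1 by apply: le_trans ne; rewrite ler_peMl ?ler1n// ltW.
have e1 : e <= 1 by lra.
pose a : n.-tuple R[i] := [tuple 0 | j < n].
have ca : corner e (e * e) a.
  by move=> j; rewrite tnth_mktuple/= lexx subr_ge0 ler_piMr// ltW.
have e20 : 0 <= 2 * e by rewrite mulr_ge0// ltW.
have vol := cell_volume e0 ne e0 (lexx e) (lexx 0) e20 ca.
apply: (@lt_le_trans _ _ (lam (cell e e a 0))).
  apply: lt_le_trans vol.
  by rewrite lte_fin !mulr_gt0 ?exprn_gt0 ?mulr_gt0// invr_gt0.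
apply: le_measure; rewrite ?inE; [exact: measurable_cell|exact: measurable_unit_ball|].
exact: cell_ball.
Qed.

Lemma total_const_gt0 : -1 < alpha -> 0 < total_const n alpha.
Proof.
move=> a1; rewrite /total_const mulr_gt0 ?invr_gt0//.
  by rewrite fine_gt0// lebesgue_unit_ball_gt0 lebesgue_unit_ball_lty.
rewrite divr_gt0 ?mulr_gt0 ?Gamma_gt0 ?ltr0n ?fact_gt0//; last by lra.
by have := ler0n R n.+1; lra.
Qed.

End total_const_positive.

(** * L^p norms over a finite measure *)

Section Lnorm_finite_measure.
Local Open Scope ereal_scope.
Context d (T : measurableType d) (R : realType).
Variable mu : {measure set T -> \bar R}.
Hypothesis muoo : mu setT < +oo.

Let mufin : mu setT = (fine (mu setT))%:E.
Proof. by rewrite fineK// ge0_fin_numE. Qed.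

Lemma Lnorm_le_cst (p : \bar R) : 1 <= p -> exists C : R, (0 <= C)%R /\
  forall F : T -> R, (forall x, `|F x| <= 1)%R -> 'N[mu]_p[EFin \o F] <= C%:E.
Proof.
case: p => [r|_|//]; last first.
  exists 1%R; split=> // F F1; rewrite unlock; case: ifPn => // _.
  by apply/ess_supP; apply/nearW => x /=; rewrite lee_fin.
rewrite lee_fin => r1; have r0 : (0 < r)%R by exact: lt_le_trans r1.
exists (fine (mu setT) `^ r^-1)%R; split; first exact: powR_ge0.
move=> F F1; rewrite unlock -poweR_EFin -mufin.
apply: gt0_ler_poweR.
- by rewrite invr_ge0 ltW.
- by rewrite in_itv/= leey andbT; apply: integral_ge0 => x _; rewrite lee_fin powR_ge0.
- by rewrite in_itv/= leey andbT.
rewrite -[leRHS]mul1e -integral_cst//; apply: ge0_le_integralT => x /=.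
  by rewrite lee_fin powR_ge0.
have <- : (1 `^ r = 1 :> R)%R by rewrite powR1.
by rewrite lee_fin ge0_ler_powR ?nnegrE ?(ltW r0)//; exact: F1.
Qed.

(** For finite exponents |F| <= 1 + |F|^r is enough: the constant must depend on [N] but not on [F],
    and need not be linear in [N]. *)
Lemma integral_le_Lnorm (q : \bar R) (N : R) : 1 <= q -> exists C : R,
  forall F : T -> R, measurable_fun setT F -> 'N[mu]_q[EFin \o F] <= N%:E ->
    \int[mu]_x `|(F x)%:E| <= C%:E.
Proof.
case: q => [r|_|//]; last first.
  exists (N * fine (mu setT))%R => F mF; rewrite unlock EFinM -mufin => FN.
  (* For the zero measure the L^oo norm is 0 by definition and says nothing about [F], but the
     integral vanishes. *)
  have [mu0|mu0] := eqVneq (mu setT) 0.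
    rewrite mu0 mule0 -[leRHS](integral0 mu setT).
    apply: ae_ge0_le_integral => //.
    + by apply/measurable_EFinP; exact: measurableT_comp.
    + by exists setT; split.
  move: FN; rewrite lt0e mu0 measure_ge0/= => /ess_supP FN.
  have N0 : 0 <= N%:E.
    have mugt0 : 0 < mu setT by rewrite lt0e mu0 measure_ge0.
    rewrite (le_trans _ (_ : ess_sup mu (abse \o (EFin \o F)) <= _))//.
      by apply: ess_sup_gee => //; apply/nearW => x /=; rewrite lee_fin.
    exact/ess_supP.
  rewrite -integral_cst//; apply: ae_ge0_le_integral => //.
  + by apply/measurable_EFinP; exact: measurableT_comp.
  + by apply: filterS FN => x /= h _.
rewrite lee_fin => r1; have r0 : (0 < r)%R by exact: lt_le_trans r1.
exists (fine (mu setT) + N `^ r)%R => F mF FN.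
apply: (@le_trans _ _ (\int[mu]_x (1 + `|(F x)%:E| `^ r))).
  apply: ge0_le_integralT => x //=; rewrite lee_fin.
  have [F1|F1] := leP `|F x|%R 1%R; first by rewrite (le_trans F1)// lerDl powR_ge0.
  apply: (@le_trans _ _ (`|F x| `^ r)%R); last by rewrite lerDr.
  by rewrite -[X in (X <= _)%R]powRr1// ler_powR// ltW.
rewrite ge0_integralD//; last 2 first.
- by move=> x _; rewrite lee_fin powR_ge0.
- by apply/measurable_EFinP; apply: measurable_powRl; exact: measurableT_comp.
rewrite EFinD leeD//; first by rewrite integral_cst// mul1e -mufin.
rewrite -[X in X <= _](poweR_Lnorm mu (EFin \o F)); last by rewrite gt_eqF.
rewrite -poweR_EFin; apply: gt0_ler_poweR => //.
- exact: ltW.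
- by rewrite in_itv/= leey andbT Lnorm_ge0.
- by rewrite in_itv/= leey andbT (le_trans (Lnorm_ge0 _ _ _) FN).
Qed.

End Lnorm_finite_measure.

(** * Choice of signs *)

Section kernel_form.
Context (R : realType) (n : nat) (alpha c : R).
Local Notation v := (@weighted_measure R n.+1 alpha).
Local Notation B := (@unit_ball R n.+1).
Implicit Types (g h : n.+1.-tuple R[i] -> R) (D : set (n.+1.-tuple R[i])).

Definition test_fun g := measurable_fun setT g /\ forall z, `|g z| <= 1.

Definition ReK g (z : n.+1.-tuple R[i]) : R :=
  \int[v]_(w in B) (g w * Re_kernel c z w).

Definition kform g h : R := \int[v]_(z in B) (h z * ReK g z).

Hypotheses (a1 : -1 < alpha) (c0 : 0 <= c).

Let mB : measurable B. Proof. exact: measurable_unit_ball. Qed.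

Let vB : (v B < +oo)%E.
Proof.
by apply: le_lt_trans (weighted_measure_lty n a1); apply: le_measure; rewrite ?inE.
Qed.

Let integrable_scale (s : R) g :
  v.-integrable B (EFin \o g) -> v.-integrable B (EFin \o (fun z => s * g z)).
Proof. exact: (@integrableZl _ _ _ v B mB s (EFin \o g)). Qed.

Let integrable_add g h :
  v.-integrable B (EFin \o g) -> v.-integrable B (EFin \o h) ->
  v.-integrable B (EFin \o (fun z => g z + h z)).
Proof. exact: (@integrableD _ _ _ v B mB (EFin \o g) (EFin \o h)). Qed.

Lemma test_fun_indic D : measurable D -> test_fun \1_D.
Proof.
move=> mD; split; first exact: measurable_indic.
by move=> z; rewrite indicE ger0_norm//; case: (_ \in _).
Qed.

Let integrable_kernel g z : test_fun g -> B z ->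
  v.-integrable B (EFin \o (fun w => g w * Re_kernel c z w)).
Proof.
move=> [mg g1] /unit_ballE z1; apply: measurable_bounded_integrable => //.
  apply: measurable_funTS; apply: measurable_funM => //.
  by apply: measurable_Re_kernel; [exact: measurable_cst|exact: measurable_id].
pose K := ((1 - sumsq z) / 2) `^ (- c).
exists K; split; first by rewrite num_real.
move=> x Kx w /unit_ballE w1; apply: le_trans (ltW Kx).
have [u1 u0 _] := Re_1inner_ge z1 w1.
rewrite normrM -[leRHS]mul1r ler_pM//.
apply: (@le_trans _ _ (abs_kernel c z w)).
  by rewrite -normc_kernel (Re_le_normc (Complex _ _)).
apply: ler_powRN => //; first by rewrite divr_gt0// subr_gt0.
by rewrite (le_trans u1)// -{1}(gtr0_norm u0) Re_le_normc.
Qed.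

Lemma ReK_Kop g z : test_fun g -> B z ->
  ReK g z = complex.Re (Kop alpha c (fun w => Complex (g w) 0) z).
Proof.
move=> tg Bz.
transitivity (\int[v]_(w in B) complex.Re (Complex (g w) 0 / cpow (1 - inner z w) c)) => //.
apply: eq_Rintegral => w /set_mem Bw.
rewrite inv_cpow_kernel; [|exact/unit_ballE|exact/unit_ballE].
by rewrite /= mul0r subr0.
Qed.

Lemma ReKD g D (s : R) z : test_fun g -> measurable D -> B z ->
  ReK (fun w => g w + s * \1_D w) z = ReK g z + s * ReK \1_D z.
Proof.
move=> tg mD Bz; rewrite /ReK.
have i1 := integrable_kernel tg Bz.
have i2 := integrable_kernel (test_fun_indic mD) Bz.
rewrite -RintegralZl// -RintegralD//; last first.
  exact: integrable_scale.
by apply: eq_Rintegral => w _; ring.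
Qed.

Variable M : R.
Hypothesis ReKM : forall g, test_fun g -> measurable_fun B (ReK g) /\
  (\int[v]_(z in B) `|(ReK g z)%:E| <= M%:E)%E.

Let integrable_kform g h : test_fun g -> test_fun h ->
  v.-integrable B (EFin \o (fun z => h z * ReK g z)).
Proof.
move=> tg [mh h1]; have [mT TM] := ReKM tg.
apply: (@le_integrable _ _ _ _ _ _ _ (EFin \o ReK g)) => //.
- by apply/measurable_EFinP; apply: measurable_funM => //; exact: measurable_funTS.
- by move=> z _; rewrite /= lee_fin normrM ler_piMl.
- apply/integrableP; split; first exact/measurable_EFinP.
  by apply: le_lt_trans TM _; rewrite ltry.
Qed.

Lemma kform_le g : test_fun g -> kform g g <= M.
Proof.
move=> tg; have [mT TM] := ReKM tg.
have i1 := integrable_kform tg tg.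
rewrite (le_trans (ler_norm _))// (le_trans (le_normr_Rintegral mB i1))//.
rewrite -lee_fin; apply: le_trans TM.
rewrite /Rintegral fineK; last first.
  rewrite ge0_fin_numE; last by apply: integral_ge0.
  by have /integrableP[] := i1.
apply: ge0_le_integral => //.
- have /integrableP[m1 _] := i1.
  by apply/measurable_EFinP; apply: measurableT_comp => //; exact/measurable_EFinP.
- by apply/measurable_EFinP; exact: measurableT_comp.
- by move=> z _; rewrite /= lee_fin normrM ler_piMl//; exact: tg.2.
Qed.

(* The cross terms change sign with s, so one of the two signs is favourable. *)
Lemma kform_extend g D : test_fun g -> measurable D -> (forall z, D z -> g z = 0) ->
  exists g', [/\ test_fun g', forall z, ~ D z -> g' z = g z &
    kform g g + kform \1_D \1_D <= kform g' g'].
Proof.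
move=> tg mD gD.
have tD := test_fun_indic mD.
have ext (s : R) : `|s| = 1 -> test_fun (fun w => g w + s * \1_D w).
  move=> s1; split.
    apply: measurable_funD; first exact: tg.1.
    by apply: measurable_funM; [exact: measurable_cst|exact: tD.1].
  move=> z; rewrite indicE; case: (boolP (z \in D)) => [/set_mem Dz|_].
    by rewrite gD// add0r mulr1 s1.
  by rewrite mulr0 addr0; exact: tg.2.
have kformE (s : R) : `|s| = 1 -> s * s = 1 ->
    let g' := fun w => g w + s * \1_D w in
    kform g' g' = kform g g + kform \1_D \1_D + s * (kform g \1_D + kform \1_D g).
  move=> s1 ss.
  have i11 := integrable_kform tg tg; have i12 := integrable_kform tg tD.
  have i21 := integrable_kform tD tg; have i22 := integrable_kform tD tD.
  have ZE := integrable_scale s; have DE := integrable_add.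
  rewrite -RintegralD// -[kform _ _ + kform _ _]RintegralD//.
  rewrite -RintegralZl//; last exact: DE.
  rewrite -RintegralD//; [|exact: DE|by apply: ZE; exact: DE].
  apply: eq_Rintegral => z /set_mem Bz; rewrite ReKD//.
  have -> : (g z + s * \1_D z) * (ReK g z + s * ReK \1_D z) =
    g z * ReK g z + (s * s) * (\1_D z * ReK \1_D z) +
    s * (\1_D z * ReK g z + g z * ReK \1_D z) by ring.
  by rewrite ss mul1r.
have agree (s : R) z : ~ D z -> g z + s * \1_D z = g z.
  by move=> nD; rewrite indicE memNset// mulr0 addr0.
have [x0|x0] := leP 0 (kform g \1_D + kform \1_D g).
  exists (fun w => g w + 1 * \1_D w); split.
  - by apply: ext; rewrite normr1.
  - exact: agree.
  - by rewrite kformE ?normr1 ?mul1r// lerDl.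
exists (fun w => g w + (-1) * \1_D w); split.
- by apply: ext; rewrite normrN1.
- exact: agree.
- by rewrite kformE ?normrN1 ?mulrNN ?mul1r// mulN1r lerDl oppr_ge0 ltW.
Qed.

(** Iterates [kform_extend]. Each extension changes the function only on its own cell, so by
    disjointness it still vanishes on the cells not yet treated; agreement off all cells keeps the
    later shells free. *)
Lemma kform_greedy (I : eqType) (s : seq I) (D : I -> set (n.+1.-tuple R[i])) (k : R) g :
  uniq s -> (forall i j z, D i z -> D j z -> i = j) ->
  (forall i, i \in s -> measurable (D i)) ->
  (forall i, i \in s -> k <= kform \1_(D i) \1_(D i)) ->
  test_fun g -> (forall i z, i \in s -> D i z -> g z = 0) ->
  exists g', [/\ test_fun g', forall z, (forall i, i \in s -> ~ D i z) -> g' z = g z &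
    kform g g + (size s)%:R * k <= kform g' g'].
Proof.
elim: s g => [|i s IH] g /= us dis mD kD tg gD.
  by exists g; split=> //; rewrite mul0r addr0.
move: us => /andP[si us].
have [g1 [tg1 g1E fg1]] := kform_extend tg (mD i (mem_head _ _))
  (fun z => gD i z (mem_head _ _)).
have [|||g2 [tg2 g2E fg2]] := IH g1 us dis _ _ tg1 _.
- by move=> j js; apply: mD; rewrite inE js orbT.
- by move=> j js; apply: kD; rewrite inE js orbT.
- move=> j z js Djz; rewrite g1E; first by apply: (gD j); rewrite // inE js orbT.
  by move=> Diz; move: si; rewrite (dis i j z)// js.
- exists g2; split; first exact: tg2.
    move=> z zs; rewrite g2E; first by apply: g1E; exact/zs/mem_head.
    by move=> j js; apply: zs; rewrite inE js orbT.
  apply: le_trans fg2; rewrite -natr1 mulrDl mul1r addrCA addrC lerD2r.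
  by apply: le_trans fg1; rewrite lerD2l; exact/kD/mem_head.
Qed.

Lemma kform_indic_ge D (k : R) : measurable D -> D `<=` B -> 0 <= k ->
  (forall z w, D z -> D w -> k <= Re_kernel c z w) ->
  k * fine (v D) ^+ 2 <= kform \1_D \1_D.
Proof.
move=> mD DB k0 hk.
have tD := test_fun_indic mD.
have vD : (v D < +oo)%E.
  by apply: le_lt_trans vB; apply: le_measure; rewrite ?inE.
have vDE : \int[v]_(w in B) \1_D w = fine (v D).
  by rewrite /Rintegral integral_indic// setIidl.
have iD : v.-integrable B (EFin \o (\1_D : _ -> R)).
  apply: measurable_bounded_integrable => //.
  exists 1; split; first by rewrite num_real.
  by move=> x x1 w _; apply: le_trans (ltW x1); exact: tD.2.
have iZ (r : R) : v.-integrable B (EFin \o (fun z => r * \1_D z)).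
  exact: integrable_scale.
have Tge z : D z -> k * fine (v D) <= ReK \1_D z.
  move=> Dz; rewrite -vDE -RintegralZl//; apply: le_Rintegral => //.
    by apply: integrable_kernel => //; exact: DB.
  move=> w Bw; rewrite indicE; case: (boolP (w \in D)) => [/set_mem Dw|_].
    by rewrite mulr1 mul1r; exact: hk.
  by rewrite mulr0 mul0r.
rewrite expr2 mulrA -{2}vDE -RintegralZl//; apply: le_Rintegral => //.
  exact: integrable_kform.
move=> z Bz; rewrite indicE; case: (boolP (z \in D)) => [/set_mem Dz|_].
  by rewrite mulr1 mul1r; exact: Tge.
by rewrite mulr0 mul0r.
Qed.

End kernel_form.

(** * From boundedness of the operator to a uniform L^1 bound *)

Section uniform_bound.
Context (R : realType) (n : nat) (alpha c : R).
Local Notation v := (@weighted_measure R n.+1 alpha).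
Local Notation B := (@unit_ball R n.+1).

Lemma bounded_ReK (p q : \bar R) : -1 < alpha -> (1 <= p)%E -> (1 <= q)%E ->
  bounded_Lp_Lq alpha p q (@Kop R n.+1 alpha c) ->
  exists M : R, forall g : n.+1.-tuple R[i] -> R, test_fun g ->
    measurable_fun B (ReK alpha c g) /\
    (\int[v]_(z in B) `|(ReK alpha c g z)%:E| <= M%:E)%E.
Proof.
move=> a1 p1 q1 [M0 hM0].
have mB := @measurable_unit_ball R n.+1.
have voo := weighted_measure_lty n a1.
have [C [C0 hC]] := Lnorm_le_cst voo p1.
(* The constant in [bounded_Lp_Lq] may be negative, hence [|M0|]. *)
have [N hN] := integral_le_Lnorm voo (`|M0| * C) q1.
exists N => g tg; have [mg g1] := tg.
pose f w : R[i] := Complex (g w) 0.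
have fC : (Lpnorm alpha p f <= C%:E)%E.
  apply: hC => w; rewrite patchE; case: ifPn => _; last by rewrite normr0.
  by rewrite /f /= expr0n addr0 sqrtr_sqr normr_id.
have fp : in_Lp alpha p f.
  split; last by rewrite (le_lt_trans fC)// ltry.
  have m2 : measurable_fun setT (fun w => (g w, 0 : R)).
    by apply/measurable_fun_pairP; split=> //; exact: measurable_cst.
  by apply: measurable_funTS; exact: (measurableT_comp (@measurable_mkC R) m2).
have [[mK _] KM] := hM0 f fp.
have mT : measurable_fun B (ReK alpha c g).
  apply: (eq_measurable_fun (@complex.Re R \o Kop alpha c f)).
    by move=> z /set_mem Bz; rewrite /= ReK_Kop.
  exact: (measurableT_comp (@measurable_Re R) mK).
split=> //.
apply: (@le_trans _ _ (\int[v]_z `|(((@Normc.normc R \o Kop alpha c f) \_ B) z)%:E|)%E).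
  rewrite integral_mkcond; apply: ge0_le_integralT => z; rewrite patchE.
    by case: ifPn.
  rewrite patchE; case: ifPn => [/set_mem Bz|_]; last by rewrite abse0.
  rewrite lee_fin ReK_Kop// (le_trans (Re_le_normc _))//; exact: ler_norm.
apply: hN.
  apply/(measurable_restrictT _ _).1 => //.
  exact: (measurableT_comp (@measurable_normc R) mK).
apply: le_trans KM _; rewrite EFinM.
apply: (@le_trans _ _ (`|M0|%:E * Lpnorm alpha p f)%E).
  by apply: lee_wpmul2r; rewrite ?Lnorm_ge0// lee_fin ler_norm.
by apply: lee_wpmul2l.
Qed.

End uniform_bound.

Lemma cos_atan_ge (R : realType) (c : R) : exists e : R, 0 < e /\
  forall s, `|s| <= e -> 2^-1 <= cos (c * atan s).
Proof.
pose f s : R := cos (c * atan s).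
have cf : {for 0, continuous f}.
  apply: continuous_comp; last exact: continuous_cos.
  by apply: cvgM; [exact: cvg_cst|exact: continuous_atan].
have f0 : f 0 = 1 by rewrite /f atan0 mulr0 cos0.
have : \forall s \near (0 : R), 2^-1 < f s.
  apply: (cvgr_gt (f 0) cf); rewrite f0; lra.
move=> /nbhs_ballP[e /= e0 he]; exists (e / 2); split; first exact: divr_gt0.
move=> s se; apply/ltW/he; rewrite /ball/= sub0r normrN (le_lt_trans se)//.
by rewrite ltr_pdivrMr// ltr_pMr// ltr1n.
Qed.

(** * Lower bounds on a single cell *)

Section cell_bounds.
Context (R : realType) (n : nat) (alpha c : R).
Local Notation lam := (lebesgueCn R n.+1).
Local Notation v := (@weighted_measure R n.+1 alpha).
Variables (e r T : R) (a : n.-tuple R[i]).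
Hypotheses (e0 : 0 < e) (ne : n.+1%:R * e <= 8^-1) (r0 : 0 < r) (re : r <= e).
Hypotheses (T0 : 0 <= T) (Te : T <= 2 * e) (ca : corner e (e * r) a).

(** By [cell_1inner], Re u <= 5 r^2 and |Im u| <= 6 e r^2 <= r^2, whence |u| <= 6 r^2; and |Im u /
    Re u| <= 6 e brings the cosine above 1/2. *)
Lemma Re_kernel_cell : 0 <= c -> (forall s, `|s| <= 6 * e -> 2^-1 <= cos (c * atan s)) ->
  forall z w, cell e r a T z -> cell e r a T w ->
    2^-1 * (6 * r ^+ 2) `^ (- c) <= Re_kernel c z w.
Proof.
move=> c0 hcos z w cz cw.
have [/andP[x1 x2] y1] := cell_1inner e0 ne r0 re T0 Te ca cz cw.
have r20 : 0 < r ^+ 2 by exact: exprn_gt0.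
have e8 : e <= 8^-1 by apply: le_trans ne; rewrite ler_peMl ?ler1n// ltW.
rewrite /Re_kernel mulrC; set u := 1 - inner z w in x1 x2 y1 *.
have u0 : 0 < complex.Re u by exact: lt_le_trans x1.
apply: ler_pM; rewrite ?invr_ge0 ?powR_ge0//.
  apply: ler_powRN => //.
    by apply: lt_le_trans (Re_le_normc u); rewrite normr_gt0 gt_eqF.
  have y0 : `|complex.Im u| <= r ^+ 2.
    rewrite (le_trans y1)// -[leRHS]mul1r ler_wpM2r// ?(ltW r20)//; lra.
  rewrite normc_nsq /nsq -(@ler_pXn2r _ 2) ?nnegrE ?sqrtr_ge0//; last by rewrite mulr_ge0// ltW.
  rewrite sqr_sqrtr ?addr_ge0 ?sqr_ge0// -(real_normK (num_real (complex.Im u))).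
  move: (normr_ge0 (complex.Im u)) x1 x2 y0 r20.
  by move: (complex.Re u) (`|_|) (r ^+ 2) => x y rr *; nra.
apply: hcos; rewrite powR_inv1 ?(ltW u0)// normrM normfV (gtr0_norm u0).
rewrite ler_pdivrMr// (le_trans y1)// ler_wpM2l//.
by rewrite mulr_ge0// ltW.
Qed.

(** On the shell (1 - |z|^2) / r^2 lies in [1, 2], so its power [alpha] is at least 2^(-|alpha|)
    whatever the sign of [alpha]. *)
Lemma weighted_measure_cell : (
  (total_const n alpha * 2 `^ (- `|alpha|) * (r ^+ 2) `^ alpha *
   (8^-1 * e * r ^+ 4 * ((e * r) ^+ 2) ^+ n))%:E <= v (cell e r a T))%E.
Proof.
have mC := measurable_cell e r a T.
have mI : measurable_fun setT (fun z => (\1_(cell e r a T) z)%:E : \bar R).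
  by apply/measurable_EFinP/measurable_indic.
have -> : v (cell e r a T) = (\int[v]_z (\1_(cell e r a T) z)%:E)%E.
  by rewrite integral_indic// setIT.
rewrite integral_weighted//.
have k0 : 0 <= total_const n alpha * 2 `^ (- `|alpha|) * (r ^+ 2) `^ alpha.
  by apply: mulr_ge0; [apply: mulr_ge0 (total_const_ge0 _ _) _|]; exact: powR_ge0.
rewrite EFinM; apply: (@le_trans _ _ ((total_const n alpha * 2 `^ (- `|alpha|) *
    (r ^+ 2) `^ alpha)%:E * \int[lam]_z (\1_(cell e r a T) z)%:E)%E).
  apply: lee_wpmul2l; first by rewrite lee_fin.
  by rewrite integral_indic// setIT; exact: cell_volume.
rewrite -ge0_integralZl//.
apply: ge0_le_integralT => z; first by rewrite mule_ge0// lee_fin.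
rewrite indicE; case: (boolP (z \in _)) => [/set_mem Cz|_]; last by rewrite mule0 mul0e.
rewrite mule1 mul1e lee_fin -mulrA; apply: ler_wpM2l; first exact: total_const_ge0.
have /unit_ballE z1 := cell_ball Cz.
rewrite /ball_weight z1; case: Cz => _ [_ /andP[d1 d2] _].
have r20 : 0 < r ^+ 2 by exact: exprn_gt0.
set d := 1 - sumsq z in d1 d2 *.
have x1 : 1 <= d / r ^+ 2 by rewrite ler_pdivlMr// mul1r ltW.
have x2 : d / r ^+ 2 <= 2 by rewrite ler_pdivrMr.
rewrite (_ : d = d / r ^+ 2 * r ^+ 2); last by rewrite divfK// gt_eqF.
rewrite (@powRM _ (d / r ^+ 2)) ?(ltW r20) ?(le_trans _ x1)//; apply: ler_wpM2r; first exact: powR_ge0.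
apply: (@le_trans _ _ ((d / r ^+ 2) `^ (- `|alpha|))).
  by apply: ler_powRN => //; exact: lt_le_trans x1.
by apply: ler_powR => //; rewrite lerNl -normrN ler_norm.
Qed.

End cell_bounds.

(** * Disjoint cells in one shell *)

Section grid.
Context (R : realType) (n N : nat) (e : R).
Hypotheses (N0 : (0 < N)%N) (e0 : 0 < e).
Local Notation r := (N%:R^-1 : R).

Definition grid (q : {ffun 'I_n -> 'I_N * 'I_N}) : n.-tuple R[i] :=
  [tuple Complex (e * r * (q j).1%:R) (e * r * (q j).2%:R) | j < n].

(** With r = 1 / N there are N choices in each of the 2n real coordinates of the corner and N^2
    slopes, hence r^(-2 (n + 1)) cells. The slope parameter advances by 2 e r^2, twice the width of
    a window, because neighbouring slopes may come closer than their parameters. *)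
Definition grid_cell (i : 'I_(N ^ 2) * {ffun 'I_n -> 'I_N * 'I_N}) :
  set (n.+1.-tuple R[i]) := cell e r (grid i.2) (2 * e * r ^+ 2 * i.1%:R).

Let r0 : 0 < r. Proof. by rewrite invr_gt0 ltr0n. Qed.

Let er0 : 0 < e * r. Proof. exact: mulr_gt0. Qed.

Let rN : r * N%:R = 1. Proof. by rewrite mulVf// pnatr_eq0 -lt0n. Qed.

Lemma corner_grid q : corner e (e * r) (grid q).
Proof.
have le (m : 'I_N) : 0 <= e * r * m%:R <= e - e * r.
  rewrite mulr_ge0 ?(ltW er0)//= lerBrDr.
  have -> : e * r * m%:R + e * r = e * r * m.+1%:R by rewrite -natr1 mulrDr mulr1.
  rewrite [leRHS](_ : e = e * r * N%:R); last by rewrite -mulrA rN mulr1.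
  by rewrite ler_wpM2l ?(ltW er0)// ler_nat.
by move=> j; rewrite tnth_mktuple/=; split; exact: le.
Qed.

Lemma grid_slope_ge0 (i : 'I_(N ^ 2)) : 0 <= 2 * e * r ^+ 2 * i%:R.
Proof. by rewrite !mulr_ge0 ?sqr_ge0// ltW. Qed.

Lemma grid_slope_le (i : 'I_(N ^ 2)) : 2 * e * r ^+ 2 * i%:R <= 2 * e.
Proof.
rewrite [leRHS](_ : _ = 2 * e * r ^+ 2 * N%:R ^+ 2); last first.
  by rewrite -[RHS]mulrA -exprMn rN expr1n mulr1.
rewrite ler_wpM2l//; first by rewrite !mulr_ge0 ?sqr_ge0// ltW.
by rewrite -natrX ler_nat ltnW.
Qed.

(** The tail determines the corner. For equal corners the slopes differ by (T - T') (1 - (T + T')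
    twist), at least half of T - T' since T + T' <= 4 e <= 1/2 and |twist| <= 1; the step 2 e r^2
    then separates windows of width e r^2. *)
Lemma grid_cell_inj i j z : n.+1%:R * e <= 8^-1 -> r <= e ->
  grid_cell i z -> grid_cell j z -> i = j.
Proof.
move=> ne re; case: i j => [i q] [j q'] [/= bi [x0 _ si]] [/= bj [_ _ sj]].
have cellE (k l : 'I_N) (x : R) : e * r * k%:R <= x < e * r * k%:R + e * r ->
    e * r * l%:R <= x < e * r * l%:R + e * r -> k = l.
  have aux (k' l' : 'I_N) : e * r * k'%:R <= x -> x < e * r * l'%:R + e * r -> (k' <= l')%N.
    move=> h1 h2; have := le_lt_trans h1 h2.
    have -> : e * r * l'%:R + e * r = e * r * l'.+1%:R by rewrite -natr1 mulrDr mulr1.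
    by rewrite ltr_pM2l// ltr_nat ltnS.
  move=> /andP[k1 k2] /andP[l1 l2]; apply/val_inj/eqP.
  by rewrite eqn_leq (aux _ _ k1 l2) (aux _ _ l1 k2).
have qq : q = q'.
  apply/ffunP => m; have [b1 b2] := bi m; have [b3 b4] := bj m.
  rewrite !tnth_mktuple/= in b1 b2 b3 b4.
  move: (cellE _ _ _ b1 b3) (cellE _ _ _ b2 b4).
  by case: (q m) (q' m) => [? ?] [? ?] /= -> ->.
rewrite -{q'}qq in bj sj *.
congr pair.
set a := grid q in bi bj si sj; set t := tail z in bi bj si sj.
set x := complex.Re _ in x0 si sj; set y := complex.Im _ in si sj.
have tw : `|twist a t| <= 1.
  have e20 : 0 <= 2 * e by rewrite mulr_ge0// ltW.
  (* At T = 0 the slope is minus the twist, so [slope_le] bounds the twist. *)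
  have := slope_le e0 ne r0 re (lexx 0) e20 (corner_grid q) bi.
  rewrite /slope expr0n addr0 mul1r subr0 sub0r normrN => h.
  have e1 : e <= 1.
    by rewrite (le_trans (_ : e <= n.+1%:R * e)) ?ler_peMl ?ler1n ?(ltW e0)//; lra.
  apply: le_trans h _; rewrite mulr_ile1 ?(ltW e0) ?(ltW r0)//.
  exact: le_trans e1.
have e8 : e <= 8^-1 by apply: le_trans ne; rewrite ler_peMl ?ler1n// ltW.
have aux (k l : 'I_(N ^ 2)) : slope a (2 * e * r ^+ 2 * k%:R) t * x <= y ->
    y < (slope a (2 * e * r ^+ 2 * l%:R) t + e * r ^+ 2) * x -> (k <= l)%N.
  move=> h1 h2; rewrite leqNgt; apply/negP => kl.
  have := le_lt_trans h1 h2; rewrite ltr_pM2r//; apply/negP; rewrite -leNgt.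
  have := grid_slope_le k; have := grid_slope_le l.
  have := grid_slope_ge0 k; have := grid_slope_ge0 l.
  have : 2 * e * r ^+ 2 * l%:R + 2 * (e * r ^+ 2) <= 2 * e * r ^+ 2 * k%:R.
    rewrite (_ : _ + _ = 2 * e * r ^+ 2 * l.+1%:R); last by rewrite -natr1; ring.
    by rewrite ler_wpM2l ?ler_nat// !mulr_ge0 ?sqr_ge0// ltW.
  have er2 : 0 <= e * r ^+ 2 by rewrite mulr_ge0 ?sqr_ge0// ltW.
  move: er2; move: (e * r ^+ 2) => d.
  move: (2 * e * r ^+ 2 * l%:R) (2 * e * r ^+ 2 * k%:R) => T' T d0 dT T'0 T0 T'e Te.
  rewrite /slope -lerBrDl.
  rewrite (_ : _ - _ = (T - T') * (1 - (T + T') * twist a t)); last by ring.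
  have p2 : 2^-1 <= 1 - (T + T') * twist a t.
    have : `|(T + T') * twist a t| <= 2^-1 * 1.
      by rewrite normrM; apply: ler_pM => //; rewrite ger0_norm; lra.
    by rewrite ler_norml; lra.
  have : (T - T') * 2^-1 <= (T - T') * (1 - (T + T') * twist a t).
    by apply: ler_wpM2l => //; lra.
  by lra.
apply/val_inj/eqP; move: si sj => /andP[s1 s2] /andP[s3 s4].
by rewrite eqn_leq (aux _ _ s1 s4) (aux _ _ s3 s2).
Qed.

End grid.

(** * Necessity: a fixed gain from every shell *)

Section necessity.
Context (R : realType) (n : nat) (alpha c M e : R).
Local Notation v := (@weighted_measure R n.+1 alpha).
Local Notation B := (@unit_ball R n.+1).
Hypotheses (a1 : -1 < alpha) (c0 : 0 <= c) (hc : n.+1%:R + 2 * (1 + alpha) <= c).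
Hypotheses (e0 : 0 < e) (ne : n.+1%:R * e <= 8^-1).
Hypothesis hcos : forall s, `|s| <= 6 * e -> 2^-1 <= cos (c * atan s).
Hypothesis ReKM : forall g : n.+1.-tuple R[i] -> R, test_fun g ->
    measurable_fun B (ReK alpha c g) /\
    (\int[v]_(z in B) `|(ReK alpha c g z)%:E| <= M%:E)%E.

(** The constant of [weighted_measure_cell] without its powers of r: with x = r^2, a cell has
    measure at least W x^alpha x^2 x^n. *)
Let W : R := total_const n alpha * 2 `^ (- `|alpha|) * (8^-1 * e * (e ^+ 2) ^+ n).

Let W0 : 0 < W.
Proof.
apply: mulr_gt0; last by rewrite !mulr_gt0 ?exprn_gt0.
by apply: mulr_gt0; [exact: total_const_gt0|exact: powR_gt0].
Qed.

Let gain : R := 2^-1 * 6 `^ (- c) * W ^+ 2.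

Let gain0 : 0 < gain.
Proof.
apply: mulr_gt0; last exact: exprn_gt0.
by apply: mulr_gt0; [rewrite invr_gt0|exact: powR_gt0].
Qed.

Let cell_gain (x : R) : R :=
  2^-1 * (6 * x) `^ (- c) * (W * (x `^ alpha * x ^+ 2 * x ^+ n)) ^+ 2.

Let kform_cell (r T : R) (a : n.-tuple R[i]) : 0 < r -> r <= e -> 0 <= T -> T <= 2 * e ->
  corner e (e * r) a ->
  cell_gain (r ^+ 2) <= kform alpha c \1_(cell e r a T) \1_(cell e r a T).
Proof.
move=> r0 re T0 Te ca.
have mC := measurable_cell e r a T.
have k0 : 0 <= 2^-1 * (6 * r ^+ 2) `^ (- c) by rewrite mulr_ge0 ?powR_ge0.
have K := Re_kernel_cell e0 ne r0 re T0 Te ca c0 hcos.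
apply: le_trans (kform_indic_ge a1 c0 ReKM mC (@cell_ball _ _ _ _ _ _) k0 K).
rewrite /cell_gain ler_wpM2l//.
have := weighted_measure_cell alpha e0 ne r0 re T0 Te ca.
have vfin : v (cell e r a T) \is a fin_num.
  rewrite ge0_fin_numE//; apply: le_lt_trans (weighted_measure_lty n a1).
  by apply: le_measure; rewrite ?inE.
rewrite -{1}(fineK vfin) lee_fin => h.
have V0 : 0 <= W * ((r ^+ 2) `^ alpha * (r ^+ 2) ^+ 2 * (r ^+ 2) ^+ n).
  by rewrite mulr_ge0 ?(ltW W0)// !mulr_ge0 ?powR_ge0 ?exprn_ge0 ?(ltW r0).
rewrite ler_pXn2r ?nnegrE ?fine_ge0//; apply: le_trans h.
rewrite le_eqVlt; apply/orP; left; apply/eqP.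
rewrite /W (@exprMn _ 2 e r) (@exprMn _ n (e ^+ 2) (r ^+ 2)).
rewrite (_ : r ^+ 4 = (r ^+ 2) ^+ 2); last by rewrite -exprM.
by move: (total_const n alpha) => C; ring.
Qed.

(* This is where hc enters: a shell of width x = r ^+ 2 consists of
   (x ^+ n.+1)^-1 cells. *)
Let gain_le (x : R) : 0 < x -> x <= 1 ->
  gain <= (x ^+ n.+1)^-1 * cell_gain x.
Proof.
move=> x0 x1; have xn (k : nat) : 0 < x ^+ k by exact: exprn_gt0.
have A0 : 0 < x `^ alpha by exact: powR_gt0.
have xc0 : 0 < x `^ c by exact: powR_gt0.
rewrite /cell_gain (@powRM _ 6)// ?(ltW x0)// (powRN x).
rewrite [leRHS](_ : _ = gain * ((x `^ alpha) ^+ 2 * x ^+ n.+3 / x `^ c)); last first.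
  have xE : x != 0 by rewrite gt_eqF.
  rewrite /gain (exprS x n.+2) (exprS x n.+1) (exprS x n).
  move: xE (gt_eqF xc0) (gt_eqF (xn n)) => /eqP xE /eqP cE /eqP nE.
  move: (x ^+ n) (x `^ c) (x `^ alpha) (6 `^ (- c)) W nE cE => P C A k w nE cE.
  by field; rewrite !(introN eqP).
rewrite ler_peMr ?(ltW gain0)// ler_pdivlMr// mul1r.
rewrite -powR_mulrn ?(ltW A0)// -powRrM -powR_mulrn ?(ltW x0)// -powRD; last first.
  by rewrite (gt_eqF x0) implybT.
(* The total exponent 2 alpha + n + 3 is exactly N + 2 (1 + alpha) for the dimension N = n + 1;
   since x <= 1, a larger [c] only increases the gain. *)
apply: ler_powR_exp => //; apply: le_trans hc.
by rewrite -(natr1 n.+2) -(natr1 n.+1); lra.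
Qed.

(** The hypothesis makes [g] vanish on the cells of the shell r^2 < 1 - |z|^2 <= 2 r^2, r = 1 / N,
    where [kform_greedy] requires it; the new function is untouched beyond the shell, towards the
    sphere, so the construction can go on there. *)
Lemma kform_shell (N : nat) (g : n.+1.-tuple R[i] -> R) : (0 < N)%N -> N%:R^-1 <= e -> test_fun g ->
  (forall z, 1 - sumsq z <= 2 * N%:R^-1 ^+ 2 -> g z = 0) ->
  exists g' : n.+1.-tuple R[i] -> R, [/\ test_fun g', forall z, 1 - sumsq z <= N%:R^-1 ^+ 2 -> g' z = 0 &
    kform alpha c g g + gain <= kform alpha c g' g'].
Proof.
move=> N0 re tg g0; pose r : R := N%:R^-1.
have r0 : 0 < r by rewrite invr_gt0 ltr0n.
have [||||||g' [tg' gE hg']] := kform_greedy (s := enum {: 'I_(N ^ 2) * {ffun 'I_n -> 'I_N * 'I_N}})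
  (D := @grid_cell R n N e) (k := cell_gain (r ^+ 2)) (g := g) a1 c0 ReKM.
- exact: enum_uniq.
- by move=> i j z; exact: grid_cell_inj.
- by move=> i _; exact: measurable_cell.
- move=> i _; apply: kform_cell => //; first exact: grid_slope_ge0.
    exact: grid_slope_le.
  exact: corner_grid.
- exact: tg.
- by move=> i z _ [_ [_ /andP[_ h] _]]; exact: g0.
exists g'; split; first exact: tg'.
  move=> z hz; rewrite gE; first by apply: g0; apply: le_trans hz _; rewrite ler_peMl ?sqr_ge0// ler1n.
  by move=> i _ [_ [_ /andP[h _] _]]; move: h; rewrite ltNge hz.
apply: le_trans hg'; rewrite lerD2l.
have -> : (size (enum {: 'I_(N ^ 2) * {ffun 'I_n -> 'I_N * 'I_N}}))%:R =
    ((r ^+ 2) ^+ n.+1)^-1 :> R.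
  rewrite -cardE card_prod card_ffun !card_prod !card_ord exprS invfM natrM !natrX natrM.
  by rewrite -!exprVn /r invrK expr2.
apply: gain_le; first exact: exprn_gt0.
apply: exprn_ile1; first exact: ltW.
have e8 : e <= 8^-1 by apply: le_trans ne; rewrite ler_peMl ?ler1n// ltW.
by apply: le_trans re _; lra.
Qed.

Lemma kform_unbounded (m : nat) : exists g : n.+1.-tuple R[i] -> R,
  test_fun g /\ m%:R * gain <= kform alpha c g g.
Proof.
have [k0 hk0] : exists k0 : nat, (2 ^ k0)%:R^-1 <= e.
  exists (Num.truncn e^-1).+1; rewrite invf_ple ?posrE ?ltr0n ?expn_gt0//.
  apply: le_trans (ltW (truncnS_gt _)) _.
  by rewrite ler_nat ltnW// ltn_expl.
pose r k : R := (2 ^ (k0 + k))%:R^-1.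
suff [g [tg _ hg]] : exists g : n.+1.-tuple R[i] -> R, [/\ test_fun g,
    forall z, 1 - sumsq z <= 2 * r m ^+ 2 -> g z = 0 &
    m%:R * gain <= kform alpha c g g] by exists g.
elim: m => [|m [g [tg g0 hg]]].
  exists (fun=> 0); split.
  - by split; [exact: measurable_cst|move=> z; rewrite normr0].
  - by [].
  rewrite mul0r /kform; under eq_Rintegral do rewrite mul0r.
  by apply: Rintegral_ge0.
have rm : r m <= e.
  apply: le_trans hk0; rewrite lef_pV2 ?posrE ?ltr0n ?expn_gt0//.
  by rewrite ler_nat leq_exp2l// leq_addr.
have [||||g' [tg' g0' hg']] := @kform_shell (2 ^ (k0 + m)) g.
- by rewrite expn_gt0.
- exact: rm.
- exact: tg.
- exact: g0.
exists g'; split=> //.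
  move=> z hz; apply: g0'; apply: le_trans hz _.
  (* Halving r makes the shells disjoint: 2 (r / 2)^2 = r^2 / 2 <= r^2. *)
  rewrite /r addnS expnS natrM invfM exprMn mulrA ler_piMl ?sqr_ge0//; lra.
by rewrite -natr1 mulrDl mul1r (le_trans _ hg')// lerD2r.
Qed.

End necessity.

Lemma bounded_Lp_Lq_lt (R : realType) (n : nat) (alpha c : R) (p q : \bar R) :
  -1 < alpha -> (1 <= p)%E -> (1 <= q)%E ->
  bounded_Lp_Lq alpha p q (@Kop R n.+1 alpha c) ->
  c < n.+1%:R + 2 * (1 + alpha).
Proof.
move=> a1 p1 q1 bK; rewrite ltNge; apply/negP => hc.
have c0 : 0 <= c.
  by apply: le_trans hc; rewrite addr_ge0// mulr_ge0//; lra.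
have [M hM] := bounded_ReK a1 p1 q1 bK.
have [e1 [e10 hcos]] := cos_atan_ge c.
have n0 : 0 < n.+1%:R :> R by rewrite ltr0n.
(* The first bound puts slopes up to 6 e in the range of [cos_atan_ge]; the second is the smallness
   used for the geometry of the cells. *)
pose e := Num.min (e1 / 6) (8^-1 / n.+1%:R).
have e0 : 0 < e by rewrite lt_min !divr_gt0.
have ne : n.+1%:R * e <= 8^-1 by rewrite mulrC -ler_pdivlMr// ge_min lexx orbT.
have hcos6 s : `|s| <= 6 * e -> 2^-1 <= cos (c * atan s).
  move=> h; apply: hcos; apply: le_trans h _.
  by rewrite mulrC -ler_pdivlMr// ge_min lexx.
have : exists2 k : R, 0 < k & forall m : nat, exists g : n.+1.-tuple R[i] -> R,
    test_fun g /\ m%:R * k <= kform alpha c g g.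
  eexists; last exact: (kform_unbounded a1 c0 hc e0 ne hcos6 hM).
  apply: mulr_gt0; last apply: exprn_gt0.
    by apply: mulr_gt0; [rewrite invr_gt0|exact: powR_gt0].
  apply: mulr_gt0; last by rewrite !mulr_gt0 ?exprn_gt0.
  by apply: mulr_gt0; [exact: total_const_gt0|exact: powR_gt0].
move=> [k k0 hk].
have [g [tg hg]] := hk (Num.truncn (M / k)).+1.
have := le_trans hg (kform_le hM tg); apply/negP; rewrite -ltNge.
by rewrite -ltr_pdivrMr// truncnS_gt.
Qed.

Theorem corollary5p1 (R : realType) (n : nat) (alpha c : R)
    (hn : (1 <= n)%N) (halpha : -1 < alpha) :
  (exists p q : \bar R, [/\ (1 <= p)%E, (1 <= q)%E &
     bounded_Lp_Lq alpha p q (@Kop R n alpha c)]) <->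
  c < n%:R + 2 * (1 + alpha).
Proof.
case: n hn => // n _; split=> [[p [q [p1 q1 bK]]]|hc].
  exact: bounded_Lp_Lq_lt halpha p1 q1 bK.
by exists +oo%E, 1%E; split; [exact: leey|exact: lexx|exact: bounded_oo_1].
Qed.
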